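(* Let $\mu>0$. There exists $\varphi_0\in C^\infty([0,1])$ with $\varphi_0(0)=0$ and $|\varphi_0(1)|>\pi$ such that the short time smooth solution $(v,w,\varphi)$ (with pressures $Q,R$) of $$\begin{cases} v_t+vv_r-\mu\big(v_{rr}+\frac{v_r}{r}-\frac{v}{r^2}\big)+Q_r=-\big(\varphi_{rr}+\frac{\varphi_r}{r}-\frac{\sin(2\varphi)}{2r^2}\big)\varphi_r, & r\in[0,1],\\ w_t+ww_z-\mu w_{zz}+R_z=0, & z\in[0,1],\\ \frac1r(rv)_r+w_z=0, & (r,z)\in[0,1]\times[0,1],\\ \varphi_t+v\varphi_r=\varphi_{rr}+\frac{\varphi_r}{r}-\frac{\sin(2\varphi)}{2r^2}, & r\in[0,1], \end{cases}$$ for unknowns $v=v(r,t)$, $w=w(z,t)$, $\varphi=\varphi(r,t)$, $Q=Q(r,t)$, $R=R(z,t)$, with initial conditions $v(r,0)=r$, $w(z,0)=-2z$, $\varphi(r,0)=\varphi_0(r)$ and boundary conditions $v(0,t)=0$, $v(1,t)=1$, $w(0,t)=0$, $w(1,t)=-2$, $\varphi(0,t)=0$, $\varphi(1,t)=\varphi_0(1)$, must blow up at some time $T_0$ with $0<T_0=T_0(\varphi_0)<+\infty$. More precisely, $\varphi_r(0,t)\to\infty$ as $t\to T_0^-$. *)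

(* Defs.v *)
From Stdlib Require Import Reals List.
From Coquelicot Require Import Coquelicot.
Open Scope R_scope.

Definition pdx (f : R -> R -> R) : R -> R -> R :=
  fun x y => Derive (fun x' => f x' y) x.
Definition pdt (f : R -> R -> R) : R -> R -> R :=
  fun x y => Derive (fun y' => f x y') y.

Fixpoint Dl (l : list bool) (f : R -> R -> R) : R -> R -> R :=
  match l with
  | nil => f
  | b :: l' => (if b then pdx else pdt) (Dl l' f)
  end.

Definition smooth2_on (S : R -> R -> Prop) (f : R -> R -> R) : Prop :=
  exists U : R * R -> Prop,
    open U /\ (forall x y, S x y -> U (x, y)) /\
    forall (l : list bool) x y, U (x, y) ->
      ex_derive (fun x' => Dl l f x' y) x /\
      ex_derive (fun y' => Dl l f x y') y /\
      continuous (fun p : R * R => Dl l f (fst p) (snd p)) (x, y).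

Definition smooth1_on (S : R -> Prop) (f : R -> R) : Prop :=
  exists U : R -> Prop,
    open U /\ (forall x, S x -> U x) /\
    forall (n : nat) x, U x -> ex_derive_n f n x.

Definition slab (T : R) : R -> R -> Prop :=
  fun x t => 0 <= x <= 1 /\ 0 <= t < T.

Definition is_solution (mu : R) (phi0 : R -> R) (T : R)
  (v w ph Q Rp : R -> R -> R) : Prop :=
  smooth2_on (slab T) v /\ smooth2_on (slab T) w /\ smooth2_on (slab T) ph /\
  smooth2_on (slab T) Q /\ smooth2_on (slab T) Rp /\
  (forall r t, 0 < r < 1 -> 0 < t < T ->
     pdt v r t + v r t * pdx v r t
     - mu * (pdx (pdx v) r t + pdx v r t / r - v r t / r ^ 2) + pdx Q r t
     = - (pdx (pdx ph) r t + pdx ph r t / r - sin (2 * ph r t) / (2 * r ^ 2))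
         * pdx ph r t) /\
  (forall z t, 0 < z < 1 -> 0 < t < T ->
     pdt w z t + w z t * pdx w z t - mu * pdx (pdx w) z t + pdx Rp z t = 0) /\
  (forall r z t, 0 < r < 1 -> 0 < z < 1 -> 0 < t < T ->
     / r * pdx (fun r' t' => r' * v r' t') r t + pdx w z t = 0) /\
  (forall r t, 0 < r < 1 -> 0 < t < T ->
     pdt ph r t + v r t * pdx ph r t
     = pdx (pdx ph) r t + pdx ph r t / r - sin (2 * ph r t) / (2 * r ^ 2)) /\
  (forall r, 0 <= r <= 1 -> v r 0 = r /\ ph r 0 = phi0 r) /\
  (forall z, 0 <= z <= 1 -> w z 0 = -2 * z) /\
  (forall t, 0 <= t < T ->
     v 0 t = 0 /\ v 1 t = 1 /\ w 0 t = 0 /\ w 1 t = -2 /\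
     ph 0 t = 0 /\ ph 1 t = phi0 1).

(* Main.v *)
(* The boundary values force v = r and w = -2 z, and the pressures absorb the momentum equations, so only the
   scalar equation for phi matters.  Writing phi = r (c0 + exp (r^2/4) y) with c0 = 4 PI turns it into a
   semilinear heat equation y_t = y_rr + 3 y_r / r + Psi (t, r, y) on the unit ball of R^4 with y = 0 at r = 1.
   The forcing is switched on by a ramp that is flat at t = 0, so y = 0 for t <= 0 and the compatibility
   conditions at the corner hold to all orders; the solution of the theorem starts at the end t1 of the ramp.
   For truncated Psi a global smooth solution is the limit of the regularized equations y = (K + eps) q,
   y_t = Psi (y) - q, where K inverts minus the Dirichlet Laplacian and the maximum principle holds uniformly in eps;
   smoothness in r follows by iterating y = K (Psi - y_t), and a Seeley extension reaches beyond r = 1.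
   Comparison gives y >= 0 and monotonicity of phi / r in r, so that phi_r (0, t) controls the lifespan and
   must tend to infinity at the maximal time.  That time is finite because of the subsolution
   2 atan (r / l(t)) + 4 r^(3/2) on r <= 1/2, with l (t) = (1 - (t - t1)/2)^2. *)
Require Import Defs.
From Stdlib Require Import Reals Lra Lia Psatz List ClassicalEpsilon FunctionalExtensionality.
From Coquelicot Require Import Coquelicot.
Open Scope R_scope.

(** * Continuity, parameter integrals and uniform limits *)

(** The unknown G = phi / r turns phi_rr + phi_r / r - phi / r^2 into r times the radial Laplacian
    of G in R^4, and the sine then enters only through the smooth quotient [h], so nothing singular
    is left at r = 0. The drift caused by v = r becomes - r G_r, and conjugation by exp (r^2/4)
    removes it. The number 4 PI does three jobs: c0 r is a subsolution by an inequality for sin (8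
    PI r), it lies above the initial bubble, and its value 2 PI at r = 1/2 exceeds PI + 2.
    Smoothness in the statement means smoothness on an open neighbourhood of the slab; hence the
    solution must also exist before its initial time and beyond r = 1. For fixed eps the regularized
    equation is an ODE in a Banach space, but its Lipschitz constant is of order 1 / eps; all
    uniform bounds come from the sign of q at a maximum of y. That phi_r (0, t) has a limit, and not
    just an infinite upper limit, rests on a lifespan bound c / (1 + y (0, t))^2, which comes from
    the ODE u' = kap u^3. *)

Lemma continuous_eps {U : UniformSpace} (f : U -> R) (x : U) :
  continuous f x <->
  forall eps, 0 < eps -> exists d : posreal, forall y, ball x d y -> Rabs (f y - f x) < eps.
Proof.
  split.
  - intros H eps he.
    destruct (proj1 (filterlim_locally f (f x)) H (mkposreal eps he)) as [d Hd].
    exists d. intros y hy. exact (Hd y hy).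
  - intros H. apply filterlim_locally. intros eps.
    destruct (H eps (cond_pos eps)) as [d Hd]. exists d. intros y hy. exact (Hd y hy).
Qed.

Lemma cont_plus {U : UniformSpace} (f g : U -> R) x :
  continuous f x -> continuous g x -> continuous (fun y => f y + g y) x.
Proof. intros hf hg. exact (continuous_plus f g x hf hg). Qed.
Lemma cont_opp {U : UniformSpace} (f : U -> R) x :
  continuous f x -> continuous (fun y => - f y) x.
Proof. intros hf. exact (continuous_opp f x hf). Qed.
Lemma cont_minus {U : UniformSpace} (f g : U -> R) x :
  continuous f x -> continuous g x -> continuous (fun y => f y - g y) x.
Proof. intros hf hg. exact (continuous_minus f g x hf hg). Qed.
Lemma cont_mult {U : UniformSpace} (f g : U -> R) x :
  continuous f x -> continuous g x -> continuous (fun y => f y * g y) x.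
Proof. intros hf hg. exact (continuous_mult f g x hf hg). Qed.
Lemma cont_comp {U : UniformSpace} (f : U -> R) (h : R -> R) x :
  continuous f x -> continuous h (f x) -> continuous (fun y => h (f y)) x.
Proof. intros hf hg. exact (continuous_comp f h x hf hg). Qed.
Lemma cont_pow {U : UniformSpace} (f : U -> R) n x :
  continuous f x -> continuous (fun y => f y ^ n) x.
Proof.
  intros hf. induction n as [|n IH]; simpl. apply continuous_const.
  now apply cont_mult.
Qed.
Lemma cont_abs {U : UniformSpace} (f : U -> R) x :
  continuous f x -> continuous (fun y => Rabs (f y)) x.
Proof. intros hf. apply (cont_comp f Rabs); auto. apply continuous_Rabs. Qed.

Definition clamp a b x := Rmax a (Rmin b x).
Lemma clamp_range a b x : a <= b -> a <= clamp a b x <= b.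
Proof. intros. unfold clamp, Rmax, Rmin. destruct Rle_dec; destruct Rle_dec; lra. Qed.
Lemma clamp_id a b x : a <= x <= b -> clamp a b x = x.
Proof. intros. unfold clamp, Rmax, Rmin. repeat destruct Rle_dec; lra. Qed.
Lemma clamp_lip a b x y : Rabs (clamp a b x - clamp a b y) <= Rabs (x - y).
Proof.
  unfold clamp, Rmax, Rmin. repeat destruct Rle_dec; unfold Rabs; repeat destruct Rcase_abs; lra.
Qed.
Lemma lip1_continuous (f : R -> R) : (forall x y, Rabs (f x - f y) <= Rabs (x - y)) -> forall x, continuous f x.
Proof.
  intros H x. apply continuous_eps. intros eps he. exists (mkposreal eps he).
  intros y hy. eapply Rle_lt_trans. apply H. exact hy.
Qed.
Lemma continuous_clamp a b x : continuous (clamp a b) x.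
Proof. apply lip1_continuous. apply clamp_lip. Qed.

(* A function f on [0, 1] is represented by its even extension, constant beyond 1, that is by f = f o cl. *)
Definition cl (x : R) := Rmin 1 (Rabs x).
Lemma cl_range x : 0 <= cl x <= 1.
Proof. unfold cl, Rmin. generalize (Rabs_pos x). destruct Rle_dec; lra. Qed.
Lemma cl_id x : 0 <= x <= 1 -> cl x = x.
Proof. intros. unfold cl. rewrite Rabs_pos_eq by lra. unfold Rmin. destruct Rle_dec; lra. Qed.
Lemma cl_cl x : cl (cl x) = cl x.
Proof. apply cl_id, cl_range. Qed.
Lemma cl_opp x : cl (- x) = cl x.
Proof. unfold cl. now rewrite Rabs_Ropp. Qed.
Lemma continuous_cl x : continuous cl x.
Proof.
  apply lip1_continuous. clear x. intros x y. unfold cl, Rmin, Rabs.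
  repeat destruct Rle_dec; repeat destruct Rcase_abs; lra.
Qed.

Lemma ball_R (x e y : R) : ball x e y <-> Rabs (y - x) < e.
Proof. reflexivity. Qed.

(** Tube lemma: joint continuity along {u0} x [a, b] gives a gauge on [a, b], and compactness
    replaces it by one radius that serves all s. This is the source of uniformity whenever a
    parameter moves along a compact interval. *)
Lemma tube {U : UniformSpace} (f : U -> R -> R) (u0 : U) a b :
  (forall s, a <= s <= b -> continuous (fun p : U * R => f (fst p) (snd p)) (u0, s)) ->
  forall eps, 0 < eps -> exists d : posreal, forall u, ball u0 d u ->
    forall s, a <= s <= b -> Rabs (f u s - f u0 s) < eps.
Proof.
  intros Hc eps he.
  assert (H : forall s, exists d : posreal, a <= s <= b -> forall u s', ball u0 d u -> Rabs (s' - s) < d ->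
     Rabs (f u s' - f u0 s) < eps / 2).
  { intros s. destruct (excluded_middle_informative (a <= s <= b)) as [hs|hs].
    - destruct (proj1 (continuous_eps _ _) (Hc s hs) (eps/2)) as [d Hd]. lra.
      exists d. intros _ u s' hu hs'. exact (Hd (u, s') (conj hu hs')).
    - exists (mkposreal 1 Rlt_0_1). tauto. }
  pose (dl := fun s => proj1_sig (constructive_indefinite_description _ (H s))).
  assert (Hdl : forall s, a <= s <= b -> forall u s', ball u0 (dl s) u -> Rabs (s' - s) < dl s ->
     Rabs (f u s' - f u0 s) < eps / 2).
  { intros s. unfold dl. apply (proj2_sig (constructive_indefinite_description _ (H s))). }
  destruct (compactness_value_1d a b dl) as [d Hd].
  exists d. intros u hu s hs.
  (* The covering point of [s] comes out of compactness under a double negation. *)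
  destruct (NNPP _ (Hd s hs)) as [t [ht [h1 h2]]].
  assert (A1 := Hdl t ht u s (ball_le _ _ _ h2 _ hu) h1).
  assert (A2 := Hdl t ht u0 s (ball_center _ _) h1).
  replace (f u s - f u0 s) with ((f u s - f u0 t) - (f u0 s - f u0 t)) by ring.
  eapply Rle_lt_trans. apply Rabs_triang. rewrite Rabs_Ropp. lra.
Qed.

Lemma continuous_slice {U V W : UniformSpace} (f : U * V -> W) u v :
  continuous f (u, v) -> continuous (fun y => f (u, y)) v.
Proof.
  intros H. apply (continuous_comp (fun y => (u, y)) f); auto.
  apply filterlim_locally. intros e. exists e. intros y hy. split; [apply ball_center|exact hy].
Qed.
Lemma continuous_slice' {U V W : UniformSpace} (f : U * V -> W) u v :
  continuous f (u, v) -> continuous (fun y => f (y, v)) u.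
Proof.
  intros H. apply (continuous_comp (fun y => (y, v)) f); auto.
  apply filterlim_locally. intros e. exists e. intros y hy. split; [exact hy|apply ball_center].
Qed.

Lemma ex_RInt_cont (f : R -> R) a b : a <= b -> (forall s, a <= s <= b -> continuous f s) -> ex_RInt f a b.
Proof.
  intros hab H. apply (ex_RInt_continuous (V := R_CompleteNormedModule)).
  intros z hz. rewrite Rmin_left, Rmax_right in hz by auto. now apply H.
Qed.
Lemma ex_RInt_contT (f : R -> R) a b : (forall s, continuous f s) -> ex_RInt f a b.
Proof. intros H. apply (ex_RInt_continuous (V := R_CompleteNormedModule)). auto. Qed.

Lemma continuous_RInt_par_loc {U : UniformSpace} (f : U -> R -> R) (u0 : U) a b : a <= b ->
  locally u0 (fun u => forall s, a <= s <= b -> continuous (fun p : U * R => f (fst p) (snd p)) (u, s)) ->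
  continuous (fun u => RInt (f u) a b) u0.
Proof.
  intros hab [d0 Hc]. apply continuous_eps. intros eps he.
  destruct (tube f u0 a b (Hc u0 (ball_center _ _)) (eps / (b - a + 1))) as [d Hd].
  { apply Rdiv_lt_0_compat; lra. }
  exists (mkposreal (Rmin d0 d) (Rmin_stable_in_posreal d0 d)). intros u hu.
  assert (hu0 := ball_le _ _ _ (Rmin_l _ _) _ hu). assert (hu1 := ball_le _ _ _ (Rmin_r _ _) _ hu).
  assert (I : forall u, ball u0 d0 u -> ex_RInt (f u) a b).
  { intros u' hu'. apply ex_RInt_cont; auto. intros s hs.
    apply (continuous_slice (fun p : U * R => f (fst p) (snd p))). now apply Hc. }
  assert (I1 := I u hu0). assert (I0 := I u0 (ball_center _ _)).
  replace (RInt (f u) a b - RInt (f u0) a b) with (RInt (fun s => f u s - f u0 s) a b)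
    by (apply (RInt_minus (V:=R_CompleteNormedModule) (f u) (f u0)); auto).
  eapply Rle_lt_trans.
  apply abs_RInt_le_const with (M := eps / (b - a + 1)); auto.
  - apply (ex_RInt_minus (V:=R_CompleteNormedModule) (f u) (f u0)); auto.
  - intros t ht. left. now apply Hd.
  - apply Rmult_lt_reg_r with (b - a + 1). lra. field_simplify; [|lra]. nra.
Qed.
Lemma continuous_RInt_par {U : UniformSpace} (f : U -> R -> R) (u0 : U) a b :
  a <= b -> (forall u s, a <= s <= b -> continuous (fun p : U * R => f (fst p) (snd p)) (u, s)) ->
  continuous (fun u => RInt (f u) a b) u0.
Proof. intros hab H. apply continuous_RInt_par_loc; auto. apply filter_forall. auto. Qed.

Lemma max_interval (f : R -> R) a b : a <= b -> (forall x, a <= x <= b -> continuous f x) ->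
  exists m, a <= m <= b /\ forall x, a <= x <= b -> f x <= f m.
Proof.
  intros hab H. destruct (continuity_ab_maj f a b hab) as [m [h1 h2]].
  - intros c hc. apply continuity_pt_filterlim. now apply H.
  - exists m. split; auto.
Qed.

(** Maximize in x for each y with a chosen maximizer [mm y]. The maximizer may jump, but the maximal
    value is continuous in y by [tube], so it attains its maximum in turn. *)
Lemma max_rect (f : R -> R -> R) a b c d : a <= b -> c <= d ->
  (forall x y, a <= x <= b -> c <= y <= d -> continuous (fun p : R * R => f (fst p) (snd p)) (x, y)) ->
  exists m n, a <= m <= b /\ c <= n <= d /\ forall x y, a <= x <= b -> c <= y <= d -> f x y <= f m n.
Proof.
  intros hab hcd H.
  assert (H1 : forall y, exists m, a <= m <= b /\ (c <= y <= d -> forall x, a <= x <= b -> f x y <= f m y)).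
  { intros y. destruct (excluded_middle_informative (c <= y <= d)) as [hy|hy].
    - destruct (max_interval (fun x => f x y) a b hab) as [m [hm hm']].
      + intros x hx. apply (continuous_slice' (fun p : R * R => f (fst p) (snd p))). now apply H.
      + exists m. auto.
    - exists a. split; [lra|tauto]. }
  pose (mm := fun y => proj1_sig (constructive_indefinite_description _ (H1 y))).
  assert (Hm : forall y, a <= mm y <= b /\ (c <= y <= d -> forall x, a <= x <= b -> f x y <= f (mm y) y)).
  { intros y. unfold mm. apply (proj2_sig (constructive_indefinite_description _ (H1 y))). }
  (* Continuity is two-sided even at c and d, while [mm] is unconstrained outside [c, d]; composing
     with [clamp] repairs this. *)
  destruct (max_interval (fun y => f (mm (clamp c d y)) (clamp c d y)) c d hcd) as [n [hn hn']].
  { intros y0 hy0. apply continuous_eps. intros eps he.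
    destruct (tube (fun y x => f x (clamp c d y)) y0 a b) with (eps := eps) as [dd Hd]; auto.
    { intros s hs. apply (continuous_comp (fun p : R*R => (snd p, clamp c d (fst p))) (fun p : R * R => f (fst p) (snd p)) (y0, s)); simpl.
      - intros P [e He].
        destruct (proj1 (continuous_eps _ _) (continuous_clamp c d y0) e (cond_pos e)) as [d1 Hd1].
        pose proof (Rmin_stable_in_posreal e d1) as hmin.
        exists (mkposreal (Rmin e d1) (Rmin_stable_in_posreal e d1)).
        intros [p1 p2] [hp1 hp2]. simpl in hp1, hp2. apply He. split; simpl.
        + eapply ball_le; [|exact hp2]. apply Rmin_l.
        + apply Hd1. eapply ball_le; [|exact hp1]. apply Rmin_r.
      - rewrite (clamp_id c d y0) by auto. now apply H. }
    exists dd. intros y hy.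
    assert (R1 := clamp_range c d y hcd). assert (R2 := clamp_range c d y0 hcd).
    set (ya := clamp c d y) in *. set (yb := clamp c d y0) in *.
    destruct (Hm ya) as [A1 A2]. destruct (Hm yb) as [B1 B2].
    assert (C1 := Hd y hy (mm ya) A1). assert (C2 := Hd y hy (mm yb) B1).
    fold ya in C1, C2. fold yb in C1, C2.
    specialize (A2 R1 _ B1). specialize (B2 R2 _ A1).
    apply Rabs_def2 in C1. apply Rabs_def2 in C2. apply Rabs_def1; lra. }
  exists (mm n), n. destruct (Hm n) as [A1 A2]. split; [|split]; auto.
  intros x y hx hy. specialize (hn' y hy). rewrite (clamp_id c d n), (clamp_id c d y) in hn' by auto.
  destruct (Hm y) as [B1 B2]. specialize (B2 hy x hx). lra.
Qed.

Lemma continuous_pair {U V W : UniformSpace} (f : U -> V) (g : U -> W) x :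
  continuous f x -> continuous g x -> continuous (fun y => (f y, g y)) x.
Proof.
  intros hf hg. apply filterlim_locally. intros e.
  generalize (filter_and _ _ (proj1 (filterlim_locally f (f x)) hf e) (proj1 (filterlim_locally g (g x)) hg e)).
  apply filter_imp. intros y [h1 h2]. split; auto.
Qed.

Lemma continuous_comp2 {U : UniformSpace} (F : R -> R -> R) (f g : U -> R) x :
  continuous (fun p : R * R => F (fst p) (snd p)) (f x, g x) ->
  continuous f x -> continuous g x -> continuous (fun y => F (f y) (g y)) x.
Proof.
  intros H hf hg.
  apply (continuous_comp (fun y => (f y, g y)) (fun p : R * R => F (fst p) (snd p))); auto.
  now apply continuous_pair.
Qed.

Definition limf {U : Type} (u : nat -> U -> R) (x : U) : R := real (Lim_seq (fun n => u n x)).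

Lemma geom_cauchy (u : nat -> R) c q : 0 <= q < 1 -> (forall n, Rabs (u (S n) - u n) <= c * q ^ n) ->
  is_lim_seq u (real (Lim_seq u)) /\ forall n, Rabs (real (Lim_seq u) - u n) <= c * q ^ n / (1 - q).
Proof.
  intros hq H.
  assert (hc : 0 <= c). { specialize (H 0%nat). simpl in H. generalize (Rabs_pos (u 1%nat - u 0%nat)). lra. }
  assert (hp : forall n, 0 <= q ^ n) by (intros; apply pow_le; lra).
  assert (B : forall n k, Rabs (u (n + k)%nat - u n) <= c * q ^ n / (1 - q) * (1 - q ^ k)).
  { intros n k. induction k as [|k IH].
    - rewrite Nat.add_0_r, Rminus_eq_0, Rabs_R0. simpl. lra.
    - rewrite Nat.add_succ_r. replace (u (S (n + k)) - u n) with ((u (S (n+k)) - u (n+k)%nat) + (u (n+k)%nat - u n)) by ring.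
      eapply Rle_trans. apply Rabs_triang. specialize (H (n+k)%nat). rewrite pow_add in H.
      replace (c * q ^ n / (1 - q) * (1 - q ^ S k)) with (c * (q ^ n * q ^ k) + c * q ^ n / (1 - q) * (1 - q ^ k)).
      lra. simpl. field. lra. }
  assert (B' : forall n k, Rabs (u (n + k)%nat - u n) <= c * q ^ n / (1 - q)).
  { intros n k. eapply Rle_trans. apply B.
    assert (0 <= c * q ^ n / (1 - q)). { apply Rdiv_le_0_compat. apply Rmult_le_pos; auto. lra. }
    generalize (hp k). nra. }
  assert (L0 : is_lim_seq (fun n => c * q ^ n / (1 - q)) 0).
  { replace (Finite 0) with (Rbar_mult (c / (1 - q)) 0) by (simpl; f_equal; ring).
    apply is_lim_seq_ext with (fun n => c / (1-q) * q ^ n). intros; field; lra.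
    apply is_lim_seq_scal_l. apply is_lim_seq_geom. rewrite Rabs_pos_eq; lra. }
  assert (E : ex_finite_lim_seq u).
  { apply ex_lim_seq_cauchy_corr. intros eps.
    apply is_lim_seq_spec in L0. destruct (L0 (pos_div_2 eps)) as [N HN].
    exists N. intros n m hn hm.
    assert (A1 := B' N (n - N)%nat). assert (A2 := B' N (m - N)%nat).
    replace (N + (n - N))%nat with n in A1 by lia. replace (N + (m - N))%nat with m in A2 by lia.
    specialize (HN N (Nat.le_refl N)). simpl in HN. rewrite Rminus_0_r in HN. apply Rabs_def2 in HN.
    replace (u n - u m) with ((u n - u N) - (u m - u N)) by ring.
    eapply Rle_lt_trans. apply Rabs_triang. rewrite Rabs_Ropp. lra. }
  assert (L : is_lim_seq u (real (Lim_seq u))) by (apply Lim_seq_correct'; auto).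
  split; auto. intros n.
  apply (is_lim_seq_le (fun k => Rabs (u (k + n)%nat - u n)) (fun _ => c * q ^ n / (1 - q)) (Rabs (real (Lim_seq u) - u n)) (c * q ^ n / (1 - q))).
  - intros k. rewrite Nat.add_comm. apply B'.
  - apply (is_lim_seq_abs (fun k => u (k + n)%nat - u n) (real (Lim_seq u) - u n)).
    apply is_lim_seq_minus'. now apply is_lim_seq_incr_n. apply is_lim_seq_const.
  - apply is_lim_seq_const.
Qed.

Lemma limf_continuous {U : UniformSpace} (u : nat -> U -> R) q C x :
  0 <= q < 1 -> locally x (fun y => forall n, Rabs (u (S n) y - u n y) <= C * q ^ n) ->
  (forall n, continuous (u n) x) -> continuous (limf u) x.
Proof.
  intros hq hC Hc. apply continuous_eps. intros eps he.
  assert (B : forall y n, (forall n, Rabs (u (S n) y - u n y) <= C * q ^ n) -> Rabs (limf u y - u n y) <= C / (1 - q) * q ^ n).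
  { intros y n hy. destruct (geom_cauchy (fun n => u n y) C q hq hy) as [_ G].
    eapply Rle_trans. apply G. right. field. lra. }
  assert (L0 : is_lim_seq (fun n => C / (1-q) * q ^ n) 0).
  { replace (Finite 0) with (Rbar_mult (C / (1 - q)) 0) by (simpl; f_equal; ring).
    apply is_lim_seq_scal_l. apply is_lim_seq_geom. rewrite Rabs_pos_eq; lra. }
  apply is_lim_seq_spec in L0. destruct (L0 (mkposreal (eps/3) ltac:(lra))) as [N HN].
  specialize (HN N (Nat.le_refl N)). simpl in HN. rewrite Rminus_0_r in HN. apply Rabs_def2 in HN.
  destruct (proj1 (continuous_eps _ _) (Hc N) (eps/3)) as [d1 Hd1]. lra.
  destruct hC as [d2 Hd2].
  exists (mkposreal (Rmin d1 d2) (Rmin_stable_in_posreal d1 d2)). simpl. intros y hy.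
  assert (h1 := Hd1 y (ball_le _ _ _ (Rmin_l _ _) _ hy)).
  assert (h2 := B y N (Hd2 y (ball_le _ _ _ (Rmin_r _ _) _ hy))).
  assert (h3 := B x N (Hd2 x (ball_center _ _))).
  apply Rabs_def2 in h1. apply Rabs_le_between in h2. apply Rabs_le_between in h3. apply Rabs_def1; lra.
Qed.

Lemma is_derive_eps (f : R -> R) t l :
  is_derive f t l <->
  forall eps, 0 < eps -> exists d, 0 < d /\ forall s, Rabs (s - t) < d -> Rabs (f s - f t - (s - t) * l) <= eps * Rabs (s - t).
Proof.
  split.
  - intros H eps he. apply is_derive_Reals in H. destruct (H eps he) as [d Hd].
    exists d. split. apply cond_pos. intros s hs. destruct (Req_dec s t) as [->|hn].
    + replace (f t - f t - (t - t) * l) with 0 by ring. rewrite Rminus_eq_0, Rabs_R0. lra.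
    + specialize (Hd (s - t)). replace (t + (s - t)) with s in Hd by ring.
      assert (h0 : s - t <> 0) by lra. specialize (Hd h0 hs).
      replace (f s - f t - (s - t) * l) with (((f s - f t) / (s - t) - l) * (s - t)) by (field; auto).
      rewrite Rabs_mult. apply Rmult_le_compat_r. apply Rabs_pos. lra.
  - intros H. apply is_derive_Reals. intros eps he. destruct (H (eps/2)) as [d [hd Hd]]. lra.
    exists (mkposreal d hd). intros h hh hlt. simpl in hlt. specialize (Hd (t + h)).
    replace (t + h - t) with h in Hd by ring. specialize (Hd hlt).
    replace ((f (t + h) - f t) / h - l) with ((f (t + h) - f t - h * l) / h) by (field; auto).
    unfold Rdiv. rewrite Rabs_mult, Rabs_Rinv by auto.
    assert (0 < Rabs h) by (apply Rabs_pos_lt; auto).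
    apply Rmult_lt_reg_r with (Rabs h); auto. rewrite Rmult_assoc, Rinv_l by lra. nra.
Qed.

Lemma mvt (f g : R -> R) a b : (forall x, Rmin a b <= x <= Rmax a b -> is_derive f x (g x)) ->
  exists c, Rmin a b <= c <= Rmax a b /\ f b - f a = g c * (b - a).
Proof.
  intros H. apply MVT_gen.
  - intros x hx. apply H. lra.
  - intros x hx. apply continuity_pt_filterlim. apply (ex_derive_continuous (V := R_NormedModule)).
    exists (g x). now apply H.
Qed.

Lemma between_abs a b c : Rmin a b <= c <= Rmax a b -> Rabs (c - a) <= Rabs (b - a).
Proof. unfold Rmin, Rmax. destruct Rle_dec; intros; unfold Rabs; repeat destruct Rcase_abs; lra. Qed.

Lemma is_derive_lim (f g : nat -> R -> R) (F G : R -> R) t0 (dl : R) :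
  0 < dl -> (forall n t, Rabs (t - t0) < dl -> is_derive (f n) t (g n t)) ->
  (forall t, Rabs (t - t0) < dl -> is_lim_seq (fun n => f n t) (F t)) ->
  (forall eps, 0 < eps -> exists N, forall n, (N <= n)%nat -> forall t, Rabs (t - t0) < dl -> Rabs (g n t - G t) <= eps) ->
  continuous G t0 -> is_derive F t0 (G t0).
Proof.
  intros hdl Hd Hl Hu Hc. apply is_derive_eps. intros eps he.
  destruct (proj1 (continuous_eps _ _) Hc (eps/2)) as [d Hd']. lra.
  destruct (Hu (eps/2)) as [N HN]. lra.
  exists (Rmin dl d). split. apply Rmin_glb_lt; auto. apply cond_pos.
  intros s hs. assert (hs1 := Rlt_le_trans _ _ _ hs (Rmin_l _ _)). assert (hs2 := Rlt_le_trans _ _ _ hs (Rmin_r _ _)).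
  assert (h00 : Rabs (t0 - t0) < dl) by (rewrite Rminus_eq_0, Rabs_R0; auto).
  apply (is_lim_seq_le_loc (fun n => Rabs (f n s - f n t0 - (s - t0) * G t0)) (fun _ => eps * Rabs (s - t0))
     (Rabs (F s - F t0 - (s - t0) * G t0)) (eps * Rabs (s - t0))).
  - exists N. intros n hn.
    destruct (mvt (f n) (g n) t0 s) as [c [hc1 hc2]].
    { intros x hx. apply Hd. apply between_abs in hx. lra. }
    rewrite hc2. apply between_abs in hc1.
    replace (g n c * (s - t0) - (s - t0) * G t0) with ((g n c - G t0) * (s - t0)) by ring.
    rewrite Rabs_mult. apply Rmult_le_compat_r. apply Rabs_pos.
    assert (A1 := HN n hn c ltac:(lra)). assert (A2 := Hd' c ltac:(apply ball_R; lra)).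
    replace (g n c - G t0) with ((g n c - G c) + (G c - G t0)) by ring.
    eapply Rle_trans. apply Rabs_triang. lra.
  - apply (is_lim_seq_abs _ (F s - F t0 - (s - t0) * G t0)).
    apply is_lim_seq_minus'. apply is_lim_seq_minus'; auto. apply is_lim_seq_const.
  - apply is_lim_seq_const.
Qed.

Lemma is_derive_RInt_par (f g : R -> R -> R) x0 a b (dl : R) :
  0 < dl -> a <= b ->
  (forall x s, Rabs (x - x0) < dl -> a <= s <= b -> is_derive (fun x => f x s) x (g x s)) ->
  (forall x s, Rabs (x - x0) < dl -> a <= s <= b -> continuous (fun p : R * R => f (fst p) (snd p)) (x, s)) ->
  (forall s, a <= s <= b -> continuous (fun p : R * R => g (fst p) (snd p)) (x0, s)) ->
  is_derive (fun x => RInt (f x) a b) x0 (RInt (g x0) a b).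
Proof.
  intros hdl hab Hd Hf Hg. apply is_derive_eps. intros eps he.
  destruct (tube g x0 a b Hg (eps / (b - a + 1))) as [d Hd'].
  { apply Rdiv_lt_0_compat; lra. }
  exists (Rmin dl d). split. apply Rmin_glb_lt; auto. apply cond_pos.
  intros s hs. assert (hs1 := Rlt_le_trans _ _ _ hs (Rmin_l _ _)). assert (hs2 := Rlt_le_trans _ _ _ hs (Rmin_r _ _)).
  assert (h00 : Rabs (x0 - x0) < dl) by (rewrite Rminus_eq_0, Rabs_R0; auto).
  assert (I1 : forall x, Rabs (x - x0) < dl -> ex_RInt (f x) a b).
  { intros x hx. apply ex_RInt_cont; auto. intros z hz.
    apply (continuous_slice (fun p : R * R => f (fst p) (snd p))). now apply Hf. }
  assert (I2 : ex_RInt (g x0) a b).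
  { apply ex_RInt_cont; auto. intros z hz.
    apply (continuous_slice (fun p : R * R => g (fst p) (snd p))). now apply Hg. }
  assert (E1 : is_RInt (fun z => f s z - f x0 z - (s - x0) * g x0 z) a b
     (RInt (f s) a b - RInt (f x0) a b - (s - x0) * RInt (g x0) a b)).
  { apply (is_RInt_minus (V:=R_NormedModule)). apply (is_RInt_minus (V:=R_NormedModule)).
    apply (RInt_correct (V := R_CompleteNormedModule)); auto. apply (RInt_correct (V := R_CompleteNormedModule)); auto.
    apply (is_RInt_scal (V:=R_NormedModule)). apply (RInt_correct (V := R_CompleteNormedModule)); auto. }
  rewrite <- (is_RInt_unique (V := R_CompleteNormedModule) _ _ _ _ E1).
  eapply Rle_trans. apply abs_RInt_le_const with (M := eps / (b - a + 1) * Rabs (s - x0)); auto.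
  - eexists. exact E1.
  - intros z hz. destruct (mvt (fun x => f x z) (fun x => g x z) x0 s) as [c [hc1 hc2]].
    { intros x hx. apply Hd; auto. apply between_abs in hx. lra. }
    rewrite hc2. replace (g c z * (s - x0) - (s - x0) * g x0 z) with ((g c z - g x0 z) * (s - x0)) by ring.
    rewrite Rabs_mult. apply Rmult_le_compat_r. apply Rabs_pos.
    left. apply Hd'; auto. apply between_abs in hc1. apply ball_R. lra.
  - rewrite <- Rmult_assoc. apply Rmult_le_compat_r. apply Rabs_pos.
    apply Rmult_le_reg_r with (b - a + 1). lra. field_simplify; [|lra]. nra.
Qed.

Ltac cc := repeat match goal with
  | |- continuous (fun _ => ?c) _ => apply continuous_const
  | |- continuous (fun x => x) _ => apply continuous_id
  | |- continuous (fun p => fst p) _ => apply continuous_fst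
  | |- continuous (fun p => snd p) _ => apply continuous_snd
  | |- continuous (fun x => @?f x + @?g x) _ => apply (cont_plus f g)
  | |- continuous (fun x => @?f x - @?g x) _ => apply (cont_minus f g)
  | |- continuous (fun x => @?f x * @?g x) _ => apply (cont_mult f g)
  | |- continuous (fun x => - @?f x) _ => apply (cont_opp f)
  | |- continuous (fun x => @?f x ^ ?n) _ => apply (cont_pow f n)
  | |- continuous (fun x => Rabs (@?f x)) _ => apply (cont_abs f)
  | |- continuous (fun x => exp (@?f x)) _ => apply (cont_comp f exp); [|apply continuous_exp]
  | |- continuous (fun x => sin (@?f x)) _ => apply (cont_comp f sin); [|apply continuous_sin]
  | |- continuous (fun x => cos (@?f x)) _ => apply (cont_comp f cos); [|apply continuous_cos]
  end.
(** The equality is first retyped in R, since integrals and series leave it in the carrier of a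
    normed module. *)
Ltac rring := intros; lazymatch goal with |- ?a = ?b => change (@eq R a b) end; ring.

(** * Classes of smooth functions *)

(** A smooth function packed with all its derivatives; [shift] is then its derivative as an object
    of the same type, and chain rules can be iterated indefinitely. *)
Record smf := mksmf { sf : nat -> R -> R; sfP : forall n x, is_derive (sf n) x (sf (S n) x) }.
Definition shift (H : smf) : smf := mksmf (fun n => sf H (S n)) (fun n x => sfP H (S n) x).

Lemma sf_continuous H n x : continuous (sf H n) x.
Proof. apply (ex_derive_continuous (V := R_NormedModule)). eexists. apply sfP. Qed.

Section Class.
Context {Pt : Type} (P0 : (Pt -> R) -> Prop) (D1 D2 : (Pt -> R) -> (Pt -> R) -> Prop).

(** The algebra of smooth functions is done once, for an abstract regularity [P0] and two partial
    derivatives given as relations. The later instances are functions on the line, continuous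
    families in time, sequences with uniform bounds, functions up to a boundary and functions on an
    open set. A relation leaves room for derivatives that are required only on part of the
    domain. *)
Record derivation (D : (Pt -> R) -> (Pt -> R) -> Prop) : Prop := {
  D_const : forall c : R, D (fun _ => c) (fun _ => 0);
  D_plus : forall f f' g g', D f f' -> D g g' -> D (fun p => f p + g p) (fun p => f' p + g' p);
  D_mult : forall f f' g g', D f f' -> D g g' -> D (fun p => f p * g p) (fun p => f' p * g p + f p * g' p);
  D_comp : forall H f f', D f f' -> D (fun p => sf H 0 (f p)) (fun p => sf H 1 (f p) * f' p) }.

Record base : Prop := {
  B_const : forall c : R, P0 (fun _ => c);
  B_plus : forall f g, P0 f -> P0 g -> P0 (fun p => f p + g p);
  B_mult : forall f g, P0 f -> P0 g -> P0 (fun p => f p * g p);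
  B_comp : forall H f, P0 f -> P0 (fun p => sf H 0 (f p)) }.

(* [Cl j k f]: all mixed derivatives of f with at most j applications of D1 and k of D2 satisfy P0. *)
Fixpoint Cl (j : nat) : nat -> (Pt -> R) -> Prop :=
  fix Clk (k : nat) (f : Pt -> R) : Prop :=
    P0 f /\
    match j with O => True | S j' => exists g, D1 f g /\ Cl j' k g end /\
    match k with O => True | S k' => exists g, D2 f g /\ Clk k' g end.

Lemma Cl_eq j k f : Cl j k f <->
  (P0 f /\ (forall j', j = S j' -> exists g, D1 f g /\ Cl j' k g) /\
           (forall k', k = S k' -> exists g, D2 f g /\ Cl j k' g)).
Proof.
  split.
  - destruct j, k; intros [h0 [h1 h2]]; (split; [exact h0|split]);
      intros x e; (discriminate || (injection e as <-; assumption)).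
  - intros [h0 [h1 h2]]; destruct j, k; (split; [exact h0|split]); auto.
Qed.

Lemma Cl_base j k f : Cl j k f -> P0 f.
Proof. intros H. now apply Cl_eq in H. Qed.
Lemma Cl_D1 j k f : Cl (S j) k f -> exists g, D1 f g /\ Cl j k g.
Proof. intros H. apply Cl_eq in H. destruct H as [_ [H _]]. now apply H. Qed.
Lemma Cl_D2 j k f : Cl j (S k) f -> exists g, D2 f g /\ Cl j k g.
Proof. intros H. apply Cl_eq in H. destruct H as [_ [_ H]]. now apply H. Qed.

Lemma Cl_mono_step n : forall j k, (j + k <= n)%nat -> forall f,
  (Cl (S j) k f -> Cl j k f) /\ (Cl j (S k) f -> Cl j k f).
Proof.
  induction n as [|n IH]; intros j k hn f; (split; intros H; assert (H0 := H); apply Cl_eq in H; destruct H as [h0 [h1 h2]];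
    apply Cl_eq; split; [exact h0|split|exact h0|split]).
  - intros j' ->. lia.
  - intros k' ->. lia.
  - intros j' ->. lia.
  - intros k' ->. lia.
  - intros j' ->. destruct (h1 _ eq_refl) as [g [hg hg']]. exists g. split; auto. apply (proj1 (IH j' k ltac:(lia) g)); auto.
  - intros k' ->. destruct (h2 _ eq_refl) as [g [hg hg']]. exists g. split; auto. apply (proj1 (IH j k' ltac:(lia) g)); auto.
  - intros j' ->. destruct (h1 _ eq_refl) as [g [hg hg']]. exists g. split; auto. apply (proj2 (IH j' k ltac:(lia) g)); auto.
  - intros k' ->. destruct (h2 _ eq_refl) as [g [hg hg']]. exists g. split; auto. apply (proj2 (IH j k' ltac:(lia) g)); auto.
Qed.

Lemma Cl_mono1 j k f : Cl (S j) k f -> Cl j k f.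
Proof. apply (proj1 (Cl_mono_step (j + k) j k (Nat.le_refl _) f)). Qed.
Lemma Cl_mono2 j k f : Cl j (S k) f -> Cl j k f.
Proof. apply (proj2 (Cl_mono_step (j + k) j k (Nat.le_refl _) f)). Qed.
Lemma Cl_le j j' k k' f : (j <= j')%nat -> (k <= k')%nat -> Cl j' k' f -> Cl j k f.
Proof.
  intros h1 h2. induction h1 as [|j' h1 IH1]; [induction h2 as [|k' h2 IH2]|]; auto.
  - intros H. apply IH2. now apply Cl_mono2.
  - intros H. apply IH1. now apply Cl_mono1.
Qed.

Hypotheses (HB : base) (H1 : derivation D1) (H2 : derivation D2).

Lemma Cl_const j k c : Cl j k (fun _ => c).
Proof.
  assert (forall n j k, (j + k <= n)%nat -> forall c, Cl j k (fun _ => c)).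
  { clear j k c. intros n. induction n as [|n IH]; intros j k hn c; apply Cl_eq; (split; [apply HB|split; intros l ->]); try lia.
    - eexists. split. apply H1. apply IH. lia.
    - eexists. split. apply H2. apply IH. lia. }
  eauto.
Qed.

Lemma Cl_plus j k f g : Cl j k f -> Cl j k g -> Cl j k (fun p => f p + g p).
Proof.
  assert (forall n j k, (j + k <= n)%nat -> forall f g, Cl j k f -> Cl j k g -> Cl j k (fun p => f p + g p)).
  { clear j k f g. intros n. induction n as [|n IH]; intros j k hn f g hf hg; apply Cl_eq;
      (split; [apply HB; eapply Cl_base; eauto|split; intros l ->]); try lia.
    - apply Cl_D1 in hf, hg. destruct hf as [f' [hf hf']], hg as [g' [hg hg']].
      eexists. split. apply H1; eauto. apply IH; auto. lia.
    - apply Cl_D2 in hf, hg. destruct hf as [f' [hf hf']], hg as [g' [hg hg']].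
      eexists. split. apply H2; eauto. apply IH; auto. lia. }
  eauto.
Qed.

Lemma Cl_mult j k f g : Cl j k f -> Cl j k g -> Cl j k (fun p => f p * g p).
Proof.
  assert (forall n j k, (j + k <= n)%nat -> forall f g, Cl j k f -> Cl j k g -> Cl j k (fun p => f p * g p)).
  { clear j k f g. intros n. induction n as [|n IH]; intros j k hn f g hf hg; apply Cl_eq;
      (split; [apply HB; eapply Cl_base; eauto|split; intros l ->]); try lia.
    - assert (mf := Cl_mono1 _ _ _ hf). assert (mg := Cl_mono1 _ _ _ hg).
      apply Cl_D1 in hf, hg. destruct hf as [f' [hf hf']], hg as [g' [hg hg']].
      eexists. split. apply H1; eauto. apply Cl_plus; apply IH; auto; lia.
    - assert (mf := Cl_mono2 _ _ _ hf). assert (mg := Cl_mono2 _ _ _ hg).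
      apply Cl_D2 in hf, hg. destruct hf as [f' [hf hf']], hg as [g' [hg hg']].
      eexists. split. apply H2; eauto. apply Cl_plus; apply IH; auto; lia. }
  eauto.
Qed.

(** The chain rule produces [shift H], so the induction on j + k runs over all smooth outer
    functions at once. *)
Lemma Cl_comp j k H f : Cl j k f -> Cl j k (fun p => sf H 0 (f p)).
Proof.
  assert (forall n j k, (j + k <= n)%nat -> forall H f, Cl j k f -> Cl j k (fun p => sf H 0 (f p))).
  { clear j k H f. intros n. induction n as [|n IH]; intros j k hn H f hf; apply Cl_eq;
      (split; [apply HB; eapply Cl_base; eauto|split; intros l ->]); try lia.
    - assert (mf := Cl_mono1 _ _ _ hf). apply Cl_D1 in hf. destruct hf as [f' [hf hf']].
      eexists. split. apply H1; eauto. apply Cl_mult; auto. apply (IH l k ltac:(lia) (shift H)). auto.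
    - assert (mf := Cl_mono2 _ _ _ hf). apply Cl_D2 in hf. destruct hf as [f' [hf hf']].
      eexists. split. apply H2; eauto. apply Cl_mult; auto. apply (IH j l ltac:(lia) (shift H)). auto. }
  eauto.
Qed.

Lemma Cl_scal j k c f : Cl j k f -> Cl j k (fun p => c * f p).
Proof. intros. apply Cl_mult; auto. apply Cl_const. Qed.
Lemma Cl_minus j k f g : Cl j k f -> Cl j k g -> Cl j k (fun p => f p - g p).
Proof.
  intros hf hg. replace (fun p => f p - g p) with (fun p => f p + (-1) * g p)
    by (apply functional_extensionality; intros; ring).
  apply Cl_plus; auto. now apply Cl_scal.
Qed.
End Class.

(** Nonlinearities are kept as syntax: their derivatives in t and y are again expressions, and
    [eval_class] shows by one induction that substitution into an expression stays in every class
    [Cl] that contains the arguments. *)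
Inductive expr :=
  | Et | Er | Ey | Ec (c : R) | Eadd (a b : expr) | Emul (a b : expr) | Ecomp (H : smf) (a : expr).
Fixpoint eval (e : expr) (t r y : R) : R :=
  match e with
  | Et => t | Er => r | Ey => y | Ec c => c
  | Eadd a b => eval a t r y + eval b t r y
  | Emul a b => eval a t r y * eval b t r y
  | Ecomp H a => sf H 0 (eval a t r y)
  end.
Fixpoint dt (e : expr) : expr :=
  match e with
  | Et => Ec 1 | Er | Ey | Ec _ => Ec 0
  | Eadd a b => Eadd (dt a) (dt b)
  | Emul a b => Eadd (Emul (dt a) b) (Emul a (dt b))
  | Ecomp H a => Emul (Ecomp (shift H) a) (dt a)
  end.
Fixpoint dy (e : expr) : expr :=
  match e with
  | Ey => Ec 1 | Er | Et | Ec _ => Ec 0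
  | Eadd a b => Eadd (dy a) (dy b)
  | Emul a b => Eadd (Emul (dy a) b) (Emul a (dy b))
  | Ecomp H a => Emul (Ecomp (shift H) a) (dy a)
  end.

Lemma is_derive_plus' (f g : R -> R) (x a b : R) : is_derive f x a -> is_derive g x b -> is_derive (fun y => f y + g y) x (a + b).
Proof. intros hf hg. exact (is_derive_plus f g x a b hf hg). Qed.
Lemma is_derive_minus' (f g : R -> R) (x a b : R) : is_derive f x a -> is_derive g x b -> is_derive (fun y => f y - g y) x (a - b).
Proof. intros hf hg. exact (is_derive_minus f g x a b hf hg). Qed.
Lemma is_derive_mult' (f g : R -> R) (x a b : R) : is_derive f x a -> is_derive g x b -> is_derive (fun y => f y * g y) x (a * g x + f x * b).
Proof. intros hf hg. exact (is_derive_mult f g x a b hf hg Rmult_comm). Qed.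
Lemma is_derive_scal' (g : R -> R) (c x b : R) : is_derive g x b -> is_derive (fun y => c * g y) x (c * b).
Proof. intros hg. exact (is_derive_scal g x c b hg). Qed.
Lemma is_derive_comp' (f g : R -> R) (x a b : R) : is_derive f (g x) a -> is_derive g x b -> is_derive (fun y => f (g y)) x (a * b).
Proof. intros hf hg. rewrite Rmult_comm. exact (is_derive_comp f g x a b hf hg). Qed.
Lemma is_derive_opp' (f : R -> R) (x a : R) : is_derive f x a -> is_derive (fun y => - f y) x (- a).
Proof. intros hf. exact (is_derive_opp f x a hf). Qed.
Lemma is_derive_val (f : R -> R) (x a b : R) : is_derive f x a -> a = b -> is_derive f x b.
Proof. now intros H <-. Qed.
Lemma is_derive_c (c x : R) : is_derive (fun _ : R => c) x 0.
Proof. exact (is_derive_const c x). Qed.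
Lemma is_derive_i (x : R) : is_derive (fun y : R => y) x 1.
Proof. exact (is_derive_id x). Qed.

Lemma eval_derive e r (u : R -> R) (t u' : R) : is_derive u t u' ->
  is_derive (fun s => eval e s r (u s)) t (eval (dt e) t r (u t) + eval (dy e) t r (u t) * u').
Proof.
  intros hu. induction e as [| | |c|a IHa b IHb|a IHa b IHb|H a IHa]; simpl.
  - eapply is_derive_val. apply is_derive_i. ring.
  - eapply is_derive_val. apply is_derive_c. ring.
  - eapply is_derive_val. apply hu. ring.
  - eapply is_derive_val. apply is_derive_c. ring.
  - eapply is_derive_val. apply is_derive_plus'; eauto. ring.
  - eapply is_derive_val. apply is_derive_mult'; eauto. simpl. ring.
  - eapply is_derive_val. apply (is_derive_comp' (sf H 0)). apply sfP. eauto. simpl. ring.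
Qed.

Lemma eval_dy e t r y : is_derive (fun y => eval e t r y) y (eval (dy e) t r y).
Proof.
  induction e as [| | |c|a IHa b IHb|a IHa b IHb|H a IHa]; simpl.
  - apply is_derive_c.
  - apply is_derive_c.
  - apply is_derive_i.
  - apply is_derive_c.
  - apply is_derive_plus'; eauto.
  - apply is_derive_mult'; eauto.
  - apply (is_derive_comp' (sf H 0)). apply sfP. eauto.
Qed.

Lemma smf_bounded H n M : exists B, forall x, Rabs x <= M -> Rabs (sf H n x) <= B.
Proof.
  destruct (Rle_dec 0 M) as [hM|hM].
  - destruct (max_interval (fun x => Rabs (sf H n x)) (-M) M) as [m [_ Hm]]. lra.
    + intros. apply cont_abs, sf_continuous.
    + eexists. intros x hx. apply Hm. apply Rabs_le_between in hx. lra.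
  - exists 0. intros x hx. generalize (Rabs_pos x). lra.
Qed.

Lemma eval_bounded e M : exists B, forall t r y, Rabs t <= M -> Rabs r <= M -> Rabs y <= M -> Rabs (eval e t r y) <= B.
Proof.
  induction e as [| | |c|a [A HA] b [B HB]|a [A HA] b [B HB]|H a [A HA]]; simpl.
  1-3: exists M; auto.
  - exists (Rabs c). intros; lra.
  - exists (A + B). intros. eapply Rle_trans. apply Rabs_triang. apply Rplus_le_compat; auto.
  - exists (A * B). intros. rewrite Rabs_mult. apply Rmult_le_compat; auto using Rabs_pos.
  - destruct (smf_bounded H 0 A) as [B HB]. exists B. auto.
Qed.

Lemma eval_lipschitz e M : exists L, 0 <= L /\ forall t r y z, Rabs t <= M -> Rabs r <= M -> Rabs y <= M -> Rabs z <= M ->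
  Rabs (eval e t r y - eval e t r z) <= L * Rabs (y - z).
Proof.
  destruct (eval_bounded (dy e) M) as [B HB]. exists (Rabs B). split. apply Rabs_pos.
  intros t r y z ht hr hy hz.
  destruct (mvt (fun y => eval e t r y) (fun y => eval (dy e) t r y) z y) as [c [hc ->]].
  - intros. apply eval_dy.
  - rewrite Rabs_mult. apply Rmult_le_compat_r. apply Rabs_pos.
    eapply Rle_trans; [|apply Rle_abs]. apply HB; auto.
    apply Rabs_le_between in hy. apply Rabs_le_between in hz. apply Rabs_le_between.
    revert hc. unfold Rmin, Rmax. destruct Rle_dec; lra.
Qed.

Lemma eval_class {Pt : Type} (P0 : (Pt -> R) -> Prop) D1 D2 (HB : base P0) (H1 : derivation D1) (H2 : derivation D2)
  j k e (t r u : Pt -> R) :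
  Cl P0 D1 D2 j k t -> Cl P0 D1 D2 j k r -> Cl P0 D1 D2 j k u -> Cl P0 D1 D2 j k (fun p => eval e (t p) (r p) (u p)).
Proof.
  intros ht hr hu. induction e; simpl; auto.
  - now apply Cl_const.
  - now apply Cl_plus.
  - now apply Cl_mult.
  - now apply Cl_comp.
Qed.

(** * Cut-offs and the nonlinearity *)

Definition cont1 (f : R -> R) := forall x, continuous f x.
Definition der1 (f g : R -> R) := forall x, is_derive f x (g x).
Definition C1 n f := Cl cont1 der1 der1 n 0 f.

Lemma base_cont1 : base cont1.
Proof.
  split; unfold cont1; intros.
  - apply continuous_const.
  - now apply cont_plus.
  - now apply cont_mult.
  - apply cont_comp; auto. apply sf_continuous.
Qed.
Lemma derivation_der1 : derivation der1.
Proof.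
  split; unfold der1; intros.
  - apply is_derive_c.
  - now apply is_derive_plus'.
  - now apply is_derive_mult'.
  - apply (is_derive_comp' (sf H 0)). apply sfP. auto.
Qed.
#[local] Hint Resolve base_cont1 derivation_der1 : core.

Lemma C1_intro n f g : der1 f g -> C1 n g -> C1 (S n) f.
Proof.
  intros h1 h2. apply Cl_eq. split; [|split].
  - intros x. apply (ex_derive_continuous (V := R_NormedModule)). eexists. apply h1.
  - intros j [= <-]. eauto.
  - discriminate.
Qed.
Lemma C1_id n : C1 n (fun x => x).
Proof.
  destruct n as [|n].
  - apply Cl_eq. split; [|split; discriminate]. intros x. apply continuous_id.
  - apply (C1_intro _ _ (fun _ => 1)). intros x. apply is_derive_i. now apply Cl_const.
Qed.

Lemma C1_Derive_n f : (forall n, C1 n f) -> forall n m, C1 m (Derive_n f n).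
Proof.
  intros H n. induction n as [|n IH]; intros m; simpl; auto.
  destruct (Cl_D1 _ _ _ _ _ _ (IH (S m))) as [g [hg hg']].
  replace (fun x => Derive (Derive_n f n) x) with g; auto.
  apply functional_extensionality. intros x. symmetry. apply is_derive_unique. apply hg.
Qed.
Lemma C1_smf f : (forall n, C1 n f) -> exists H : smf, sf H 0 = f.
Proof.
  intros H.
  assert (A : forall n x, is_derive (Derive_n f n) x (Derive_n f (S n) x)).
  { intros n x. simpl. apply Derive_correct.
    destruct (Cl_D1 _ _ _ _ _ _ (C1_Derive_n f H n 1%nat)) as [g [hg _]]. exists (g x). apply hg. }
  exists (mksmf (Derive_n f) A). reflexivity.
Qed.

Lemma C1_inv n : forall f, (forall x, f x <> 0) -> C1 n f -> C1 n (fun x => / f x).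
Proof.
  induction n as [|n IH]; intros f hf H.
  - apply Cl_eq. split; [|split; discriminate]. intros x. apply (cont_comp f Rinv).
    apply (Cl_base _ _ _ _ _ _ H). now apply continuous_Rinv.
  - assert (H' := Cl_mono1 _ _ _ _ _ _ H).
    destruct (Cl_D1 _ _ _ _ _ _ H) as [g [hg hg']].
    apply (C1_intro _ _ (fun x => -1 * (g x * ((/ f x) * (/ f x))))).
    + intros x. eapply is_derive_val. apply is_derive_inv; auto. field. auto.
    + apply Cl_scal; auto. apply Cl_mult; auto. apply Cl_mult; auto; apply IH; auto.
Qed.

(** For m = 0 this is the usual flat function exp (-1/x). The powers of 1/x close the family under
    differentiation up to linear combinations, so smoothness is an induction over all m. *)
Definition flat (m : nat) (x : R) : R := if Rle_dec x 0 then 0 else (/ x) ^ m * exp (- / x).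

(** For m > 0 this is u / m < exp (u / m), raised to the m-th power. *)
Lemma pow_exp_le m u : 0 < u -> u ^ m * exp (- u) <= INR m ^ m + 1.
Proof.
  intros hu. destruct m as [|m].
  - simpl. rewrite Rmult_1_l. assert (exp (-u) <= exp 0) by (left; apply exp_increasing; lra).
    rewrite exp_0 in H. lra.
  - set (k := INR (S m)). assert (hk : 0 < k) by (apply lt_0_INR; lia).
    assert (A : (u / k) ^ S m <= exp u).
    { replace (exp u) with (exp (u / k) ^ S m).
      - apply pow_incr. split. apply Rlt_le, Rdiv_lt_0_compat; auto.
        assert (0 < u / k) by (apply Rdiv_lt_0_compat; auto). generalize (exp_ineq1 (u/k)). lra.
      - rewrite <- Rpower_pow by apply exp_pos. unfold Rpower. rewrite ln_exp. f_equal. fold k. field. lra. }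
    rewrite exp_Ropp. assert (he := exp_pos u).
    apply Rle_trans with (k ^ S m); [|lra].
    apply Rmult_le_reg_r with (exp u); auto. rewrite Rmult_assoc, Rinv_l, Rmult_1_r by lra.
    unfold Rdiv in A. rewrite Rpow_mult_distr, pow_inv in A.
    assert (hp : 0 < k ^ S m) by (apply pow_lt; auto).
    apply Rmult_le_reg_r with (/ k ^ S m). now apply Rinv_0_lt_compat.
    eapply Rle_trans. exact A. rewrite Rmult_comm, <- Rmult_assoc, Rinv_l by lra. lra.
Qed.

Lemma flat_pos_derive m x : 0 < x -> is_derive (flat m) x (flat (m+2) x - INR m * flat (m+1) x).
Proof.
  intros hx.
  apply (is_derive_ext_loc (fun x => (/ x) ^ m * exp (- / x))).
  - exists (mkposreal x hx). intros y hy. change (Rabs (y - x) < x) in hy. apply Rabs_def2 in hy.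
    unfold flat. destruct (Rle_dec y 0); [lra|auto].
  - unfold flat. destruct (Rle_dec x 0); [lra|].
    assert (A : is_derive (fun x => (/ x) ^ m) x (- INR m * (/ x) ^ (m + 1))).
    { induction m as [|m IH].
      - simpl. eapply is_derive_val. apply is_derive_c. ring.
      - simpl (fun x => (/x) ^ S m). eapply is_derive_val. apply is_derive_mult'; [|apply IH].
        apply is_derive_inv. apply is_derive_i. lra. rewrite S_INR, !pow_add. simpl. field. lra. }
    eapply is_derive_val. apply is_derive_mult'. exact A.
    apply (is_derive_comp' exp (fun x => - / x)). apply is_derive_exp.
    apply (is_derive_opp (fun x => / x)). apply is_derive_inv. apply is_derive_i. lra.
    unfold opp; simpl. rewrite !pow_add. simpl. field. lra.
Qed.

(** At 0 the difference quotient is controlled by writing [flat m s] as s^2 times [flat (m+2) s],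
    the latter being bounded by [pow_exp_le]. *)
Lemma flat_derive m x : is_derive (flat m) x (flat (m+2) x - INR m * flat (m+1) x).
Proof.
  destruct (Rtotal_order x 0) as [hx|[->|hx]]; [| |now apply flat_pos_derive].
  - apply (is_derive_ext_loc (fun _ => 0)).
    + exists (mkposreal (-x) ltac:(lra)). intros y hy. change (Rabs (y - x) < - x) in hy. apply Rabs_def2 in hy.
      unfold flat. destruct (Rle_dec y 0); lra.
    + unfold flat. destruct (Rle_dec x 0); [|lra]. eapply is_derive_val. apply is_derive_c. ring.
  - replace (flat (m+2) 0 - INR m * flat (m+1) 0) with 0 by (unfold flat; destruct Rle_dec; lra).
    apply is_derive_eps. intros eps he.
    set (B := INR (m + 2) ^ (m + 2) + 1). assert (hB : 0 < B).
    { unfold B. generalize (pow_le (INR (m+2)) (m+2) (pos_INR _)). lra. }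
    exists (eps / B). split. apply Rdiv_lt_0_compat; auto.
    intros s hs. rewrite Rminus_0_r in *. unfold flat. destruct (Rle_dec 0 0); [|lra].
    destruct (Rle_dec s 0).
    + replace (0 - 0 - s * 0) with 0 by ring. rewrite Rabs_R0. apply Rmult_le_pos. lra. apply Rabs_pos.
    + assert (h := pow_exp_le (m + 2) (/ s) ltac:(apply Rinv_0_lt_compat; lra)). fold B in h.
      rewrite (Rabs_pos_eq s) in * by lra.
      set (E := (/ s) ^ (m+2) * exp (- / s)) in *.
      replace ((/ s) ^ m * exp (- / s) - 0 - s * 0) with (s * s * E)
        by (unfold E; rewrite pow_add; simpl; field; lra).
      assert (0 <= E). { unfold E. apply Rmult_le_pos. apply pow_le. left. apply Rinv_0_lt_compat. lra. left. apply exp_pos. }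
      rewrite Rabs_pos_eq by (apply Rmult_le_pos; nra).
      rewrite Rmult_assoc, Rmult_comm. apply Rmult_le_compat_r. lra.
      apply Rle_trans with (s * B). nra.
      apply Rmult_lt_compat_r with (r := B) in hs; auto. field_simplify in hs; lra.
Qed.

Lemma C1_flat n : forall m, C1 n (flat m).
Proof.
  induction n as [|n IH]; intros m.
  - apply Cl_eq. split; [|split; discriminate].
    intros x. apply (ex_derive_continuous (V := R_NormedModule)). eexists. apply flat_derive.
  - eapply C1_intro. intros x. apply flat_derive. apply Cl_minus; auto. apply IH. apply Cl_scal; auto. apply IH.
Qed.

Lemma flat0_pos x : 0 < x -> 0 < flat 0 x.
Proof. intros. unfold flat. destruct Rle_dec. lra. simpl. rewrite Rmult_1_l. apply exp_pos. Qed.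
Lemma flat0_zero x : x <= 0 -> flat 0 x = 0.
Proof. intros. unfold flat. destruct Rle_dec; lra. Qed.
Lemma flat0_nonneg x : 0 <= flat 0 x.
Proof. destruct (Rle_dec x 0). rewrite flat0_zero; lra. left. apply flat0_pos. lra. Qed.

Definition step (x : R) : R := flat 0 x * / (flat 0 x + flat 0 (1 - x)).
Lemma step_den x : 0 < flat 0 x + flat 0 (1 - x).
Proof.
  destruct (Rle_dec x 0). generalize (flat0_pos (1-x)) (flat0_nonneg x). lra.
  generalize (flat0_pos x) (flat0_nonneg (1-x)). lra.
Qed.
Lemma step_0 x : x <= 0 -> step x = 0.
Proof. intros. unfold step. rewrite flat0_zero by auto. ring. Qed.
Lemma step_1 x : 1 <= x -> step x = 1.
Proof. intros. unfold step. generalize (step_den x). rewrite (flat0_zero (1-x)) by lra. intros. field. lra. Qed.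
Lemma step_range x : 0 <= step x <= 1.
Proof.
  unfold step. assert (d := step_den x). assert (a := flat0_nonneg x). assert (b := flat0_nonneg (1-x)).
  split. apply Rmult_le_pos; auto. left. now apply Rinv_0_lt_compat.
  apply Rmult_le_reg_r with (flat 0 x + flat 0 (1 - x)); auto. rewrite Rmult_assoc, Rinv_l by lra. lra.
Qed.

Lemma C1_step n : C1 n step.
Proof.
  destruct (C1_smf (flat 0) (fun n => C1_flat n 0)) as [H HH].
  assert (C1 n (fun x => flat 0 (1 - x))).
  { rewrite <- HH. apply Cl_comp; auto. apply Cl_minus; auto. now apply Cl_const. apply C1_id. }
  apply Cl_mult; auto. apply C1_flat. apply C1_inv.
  intros x. generalize (step_den x). lra. apply Cl_plus; auto. apply C1_flat.
Qed.
Definition step_smf : smf := proj1_sig (constructive_indefinite_description _ (C1_smf step C1_step)).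
Lemma step_smfE : sf step_smf 0 = step.
Proof. exact (proj2_sig (constructive_indefinite_description _ (C1_smf step C1_step))). Qed.

Lemma eta_smf_ex t1 : exists H, sf H 0 = (fun t => step (t / t1)).
Proof.
  apply C1_smf. intros n. rewrite <- step_smfE. apply Cl_comp; auto. unfold Rdiv.
  apply Cl_mult; auto. apply C1_id. now apply Cl_const.
Qed.

Definition cut (M y : R) : R := y * (step (2 - y / M) * step (2 + y / M)).
Lemma cut_smf_ex M : exists H, sf H 0 = cut M.
Proof.
  apply C1_smf. intros n. unfold cut. rewrite <- step_smfE.
  apply Cl_mult; auto. apply C1_id. apply Cl_mult; auto; apply Cl_comp; auto; [apply Cl_minus|apply Cl_plus]; auto;
    try (now apply Cl_const); (apply Cl_mult; [auto..|apply C1_id|now apply Cl_const]).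
Qed.
Lemma cut_id M y : 0 < M -> Rabs y <= M -> cut M y = y.
Proof.
  intros hM hy. apply Rabs_le_between in hy. unfold cut.
  assert (-1 <= y / M). { apply Rmult_le_reg_r with M; auto. unfold Rdiv. rewrite Rmult_assoc, Rinv_l by lra. lra. }
  assert (y / M <= 1). { apply Rmult_le_reg_r with M; auto. unfold Rdiv. rewrite Rmult_assoc, Rinv_l by lra. lra. }
  rewrite !step_1 by lra. ring.
Qed.
Lemma cut_far M y : 0 < M -> 2 * M <= Rabs y -> cut M y = 0.
Proof.
  intros hM hy. unfold cut. unfold Rabs in hy. destruct Rcase_abs.
  - rewrite (step_0 (2 + y / M)). ring.
    apply Rmult_le_reg_r with M; auto. field_simplify; lra.
  - rewrite (step_0 (2 - y / M)). ring.
    apply Rmult_le_reg_r with M; auto. field_simplify; lra.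
Qed.
Lemma cut_bound M y : 0 < M -> Rabs (cut M y) <= 2 * M.
Proof.
  intros hM. destruct (Rle_dec (2 * M) (Rabs y)).
  - rewrite cut_far by auto. rewrite Rabs_R0. lra.
  - unfold cut. rewrite !Rabs_mult. rewrite !(Rabs_pos_eq (step _)) by apply step_range.
    assert (a := step_range (2 - y / M)). assert (b := step_range (2 + y / M)).
    assert (0 <= step (2 - y / M) * step (2 + y / M) <= 1) by (split; nra).
    assert (hy := Rabs_pos y). nra.
Qed.
(** [cut M] vanishes for |y| >= 2 M, so it is unchanged when y is clamped to [-2 M, 2 M], where the
    derivative is bounded by compactness. *)
Lemma cut_lip M : 0 < M -> exists L, 0 <= L /\ forall y z, Rabs (cut M y - cut M z) <= L * Rabs (y - z).
Proof.
  intros hM. destruct (cut_smf_ex M) as [H HH].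
  assert (cc : forall y, cut M y = cut M (clamp (-(2*M)) (2*M) y)).
  { intros y. destruct (Rle_dec y (-(2*M))); [|destruct (Rle_dec (2*M) y)].
    - replace (clamp (-(2*M)) (2*M) y) with (-(2*M)). rewrite !cut_far; auto. rewrite Rabs_Ropp, Rabs_pos_eq; lra.
      rewrite Rabs_left1; lra. unfold clamp, Rmax, Rmin; repeat destruct Rle_dec; lra.
    - replace (clamp (-(2*M)) (2*M) y) with (2*M). rewrite !cut_far; auto. rewrite Rabs_pos_eq; lra.
      rewrite Rabs_pos_eq; lra. unfold clamp, Rmax, Rmin; repeat destruct Rle_dec; lra.
    - rewrite clamp_id; auto. lra. }
  destruct (smf_bounded H 1 (2*M)) as [B HB]. exists (Rabs B). split. apply Rabs_pos.
  intros y z. rewrite (cc y), (cc z). rewrite <- HH.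
  set (a := clamp _ _ y). set (b := clamp _ _ z).
  assert (ha : -(2*M) <= a <= 2*M) by (apply clamp_range; lra).
  assert (hb : -(2*M) <= b <= 2*M) by (apply clamp_range; lra).
  destruct (mvt (sf H 0) (sf H 1) b a) as [c [hc ->]]. intros; apply sfP.
  rewrite Rabs_mult. apply Rmult_le_compat; try apply Rabs_pos.
  - eapply Rle_trans; [|apply Rle_abs]. apply HB. apply Rabs_le_between. revert hc. unfold Rmin, Rmax; destruct Rle_dec; lra.
  - apply clamp_lip.
Qed.

(** * The even quotient (2 x - sin (2 x)) / (2 x^3) and its monotonicity *)

Definition trigI (T : R -> R) (m : nat) (x : R) : R := RInt (fun s => 2 * (1 - s) ^ 2 * (2 * s) ^ m * T (2 * s * x)) 0 1.

(** Each x-derivative brings down a factor 2 s and replaces T by T'; the index m counts these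
    factors. *)
Lemma trigI_derive (T T' : R -> R) m : der1 T T' -> cont1 T' -> der1 (trigI T m) (trigI T' (S m)).
Proof.
  intros hT cT' x.
  assert (cT : cont1 T) by (intros z; apply (ex_derive_continuous (V := R_NormedModule)); eexists; apply hT).
  assert (K : forall F, cont1 F -> forall n y s, continuous (fun p : R * R => 2 * (1 - snd p) ^ 2 * (2 * snd p) ^ n * F (2 * snd p * fst p)) (y, s)).
  { intros F hF n y s. cc.
    apply (cont_comp (fun p : R * R => 2 * snd p * fst p) F); auto.
    cc. }
  apply (is_derive_RInt_par (fun x s => 2 * (1 - s) ^ 2 * (2 * s) ^ m * T (2 * s * x))
    (fun x s => 2 * (1 - s) ^ 2 * (2 * s) ^ (S m) * T' (2 * s * x)) x 0 1 1); try lra; auto.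
  intros y s _ _. eapply is_derive_val. apply is_derive_scal'. apply (is_derive_comp' T). apply hT.
  apply (is_derive_scal' (fun y => y)). apply is_derive_i. simpl. ring.
Qed.

Lemma C1_trigI n : forall m, C1 n (trigI cos m) /\ C1 n (trigI sin m).
Proof.
  assert (dc : der1 cos (fun x => - sin x)) by (intros x; apply is_derive_cos).
  assert (ds : der1 sin cos) by (intros x; apply is_derive_sin).
  assert (ccos : cont1 cos) by (intros x; apply continuous_cos).
  assert (csin : cont1 sin) by (intros x; apply continuous_sin).
  assert (cms : cont1 (fun x => - sin x)) by (intros x; apply cont_opp; auto).
  assert (E : forall m, trigI (fun x => - sin x) m = (fun x => -1 * trigI sin m x)).
  { intros m. apply functional_extensionality. intros x. unfold trigI.
    rewrite <- (RInt_scal (V := R_CompleteNormedModule)).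
    apply RInt_ext. intros s _. unfold scal; simpl; unfold mult; simpl. ring.
    apply ex_RInt_contT. intros s.
    cc. }
  induction n as [|n IH]; intros m.
  - split; (apply Cl_eq; split; [|split; discriminate]); intros x; apply (ex_derive_continuous (V := R_NormedModule)); eexists;
      eapply trigI_derive; eauto.
  - split.
    + apply (C1_intro _ _ (trigI (fun x => - sin x) (S m))). now apply trigI_derive. rewrite (E (S m)). apply Cl_scal; auto. exact (proj2 (IH (S m))).
    + apply (C1_intro _ _ (trigI cos (S m))). now apply trigI_derive. exact (proj1 (IH (S m))).
Qed.

(* [h x = (2 x - sin (2 x)) / (2 x^3)], written as an integral that is smooth at 0. *)
Definition h := trigI cos 0.
Definition h' (x : R) := - trigI sin 1 x.
Lemma h_derive x : is_derive h x (h' x).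
Proof.
  assert (E : h' x = trigI (fun x => - sin x) 1 x).
  { unfold h', trigI. symmetry. apply is_RInt_unique.
    apply (is_RInt_ext (fun s => - (2 * (1 - s) ^ 2 * (2 * s) ^ 1 * sin (2 * s * x)))).
    { intros s _. simpl. ring. }
    apply (is_RInt_opp (V := R_NormedModule)). apply (RInt_correct (V := R_CompleteNormedModule)).
    apply ex_RInt_contT. intros s. apply (ex_derive_continuous (V := R_NormedModule)). auto_derive. auto. }
  rewrite E. apply trigI_derive. intros y; apply is_derive_cos. intros y. apply cont_opp, continuous_sin.
Qed.
Definition h_smf : smf := proj1_sig (constructive_indefinite_description _ (C1_smf h (fun n => proj1 (C1_trigI n 0)))).
Lemma h_smfE : sf h_smf 0 = h.
Proof. exact (proj2_sig (constructive_indefinite_description _ (C1_smf h (fun n => proj1 (C1_trigI n 0))))). Qed.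

Lemma h_bound x : Rabs (h x) <= 2.
Proof.
  unfold h, trigI. apply Rle_trans with ((1 - 0) * 2); [|lra].
  apply abs_RInt_le_const. lra.
  - apply ex_RInt_contT. intros s. apply (ex_derive_continuous (V := R_NormedModule)). auto_derive. auto.
  - intros s hs. rewrite !Rabs_mult. simpl (_ ^ 0). rewrite Rabs_R1, (Rabs_pos_eq 2), (Rabs_pos_eq ((1-s)^2)) by nra.
    assert (Rabs (cos (2 * s * x)) <= 1) by (apply Rabs_le; apply COS_bound). generalize (Rabs_pos (cos (2 * s * x))). nra.
Qed.

Lemma h_id x : x ^ 3 * h x = x - sin (2 * x) / 2.
Proof.
  destruct (Req_dec x 0) as [->|hx]. rewrite Rmult_0_r, sin_0. simpl. lra.
  (* The antiderivative results from two integrations by parts, followed by integrating cos (2 s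
     x). *)
  assert (E : is_RInt (fun s => 2 * (1 - s) ^ 2 * (2 * s) ^ 0 * cos (2 * s * x)) 0 1
    (((1 - 1) ^ 2 * sin (2 * 1 * x) / x - (1 - 1) * cos (2 * 1 * x) / x ^ 2 - sin (2 * 1 * x) / (2 * x ^ 3)) -
     ((1 - 0) ^ 2 * sin (2 * 0 * x) / x - (1 - 0) * cos (2 * 0 * x) / x ^ 2 - sin (2 * 0 * x) / (2 * x ^ 3)))).
  { apply (is_RInt_derive (V := R_CompleteNormedModule)
      (fun s => (1 - s) ^ 2 * sin (2 * s * x) / x - (1 - s) * cos (2 * s * x) / x ^ 2 - sin (2 * s * x) / (2 * x ^ 3))).
    - intros s _. auto_derive. repeat split; auto. simpl. field. auto.
    - intros s _. apply (ex_derive_continuous (V := R_NormedModule)). auto_derive. auto. }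
  unfold h, trigI. rewrite (is_RInt_unique (V := R_CompleteNormedModule) _ _ _ _ E).
  replace (2 * 0 * x) with 0 by ring. replace (2 * 1 * x) with (2 * x) by ring. rewrite sin_0, cos_0. field. auto.
Qed.

Lemma nondec_of_derive (f g : R -> R) a b : a <= b -> (forall x, a <= x <= b -> is_derive f x (g x)) ->
  (forall x, a <= x <= b -> 0 <= g x) -> f a <= f b.
Proof.
  intros hab hd hg. destruct (mvt f g a b) as [c [hc hc']].
  - intros x. rewrite Rmin_left, Rmax_right by lra. auto.
  - rewrite Rmin_left, Rmax_right in hc by lra. specialize (hg c hc). nra.
Qed.

Lemma PI_gt_3 : 3 < PI.
Proof. assert (hh := PI2_3_2). unfold PI2 in *. lra. Qed.

(** For z >= 3 the left side is at most 3 and the right side at least z. Below 3 < PI three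
    differentiations reduce the claim to x sin x >= 0. *)
Lemma cusa_huygens z : 0 <= z -> 3 * sin z <= z * (2 + cos z).
Proof.
  intros hz. destruct (Rle_dec 3 z) as [h3|h3].
  { generalize (SIN_bound z) (COS_bound z). nra. }
  assert (hp := PI_gt_3).
  assert (s0 : forall x, 0 <= x <= z -> 0 <= sin x) by (intros; apply sin_ge_0; lra).
  assert (A : forall x, 0 <= x <= z -> 0 <= sin x - x * cos x).
  { intros x hx. replace 0 with (sin 0 - 0 * cos 0) by (rewrite sin_0; ring).
    apply (nondec_of_derive (fun x => sin x - x * cos x) (fun x => x * sin x)); try lra.
    - intros y _. auto_derive; auto. ring.
    - intros y hy. apply Rmult_le_pos. lra. apply s0. lra. }
  assert (B : forall x, 0 <= x <= z -> 0 <= 2 * (1 - cos x) - x * sin x).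
  { intros x hx. replace 0 with (2 * (1 - cos 0) - 0 * sin 0) by (rewrite cos_0; ring).
    apply (nondec_of_derive (fun x => 2 * (1 - cos x) - x * sin x) (fun x => sin x - x * cos x)); try lra.
    - intros y _. auto_derive; auto. ring.
    - intros y hy. apply A. lra. }
  assert (C : 0 * (2 + cos 0) - 3 * sin 0 <= z * (2 + cos z) - 3 * sin z).
  { apply (nondec_of_derive (fun x => x * (2 + cos x) - 3 * sin x) (fun x => 2 * (1 - cos x) - x * sin x)); try lra.
    - intros y _. auto_derive; auto. ring.
    - intros y hy. apply B. lra. }
  rewrite sin_0 in C. lra.
Qed.

(** Differentiating [h_id] gives 2 x^4 h' = - (z (2 + cos z) - 3 sin z) with z = 2 x, to which the
    Cusa-Huygens inequality applies. This sign is what makes phi / r decrease in r, see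
    [gsr_nonpos]. *)
Lemma h'_nonpos x : 0 <= x -> h' x <= 0.
Proof.
  intros hx. destruct (Req_dec x 0) as [->|hn].
  { unfold h', trigI. rewrite (RInt_ext _ (fun _ => 0)). rewrite RInt_const. unfold scal; simpl; unfold mult; simpl. lra.
    intros s _. rewrite Rmult_0_r, sin_0. simpl. ring. }
  assert (D1 : is_derive (fun x => x ^ 3 * h x) x (3 * x ^ 2 * h x + x ^ 3 * h' x)).
  { eapply is_derive_val. apply is_derive_mult'. 2: apply h_derive.
    apply (is_derive_pow (fun x => x) 3 x 1). apply is_derive_i. simpl. ring. }
  assert (D2 : is_derive (fun x => x ^ 3 * h x) x (1 - cos (2 * x))).
  { apply (is_derive_ext (fun x => x - sin (2 * x) / 2)). intros; symmetry; apply h_id.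
    auto_derive; auto. field. }
  assert (E : 3 * x ^ 2 * h x + x ^ 3 * h' x = 1 - cos (2 * x)).
  { rewrite <- (is_derive_unique _ _ _ D1). apply is_derive_unique. exact D2. }
  assert (H := h_id x). assert (Cu := cusa_huygens (2 * x) ltac:(lra)).
  assert (F : 2 * x ^ 4 * h' x = - ((2 * x) * (2 + cos (2 * x)) - 3 * sin (2 * x))).
  { replace (2 * x ^ 4 * h' x) with (2 * x * (3 * x ^ 2 * h x + x ^ 3 * h' x) - 6 * (x ^ 3 * h x)) by ring.
    rewrite E, H. field. }
  assert (0 < 2 * x ^ 4) by (apply Rmult_lt_0_compat; [lra|apply pow_lt; lra]).
  nra.
Qed.

(** * The radial Dirichlet problem in dimension four *)

Definition cont2 (u : R -> R -> R) := forall p : R * R, continuous (fun p : R * R => u (fst p) (snd p)) p.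
Definition inX (f : R -> R) := cont1 f /\ forall x, f x = f (cl x).
Definition XT (u : R -> R -> R) := cont2 u /\ forall r t, u r t = u (cl r) t.

Lemma XT_slice u t : XT u -> inX (fun r => u r t).
Proof.
  intros [h1 h2]. split; auto. intros x.
  apply (continuous_slice' (fun p : R * R => u (fst p) (snd p))). apply h1.
Qed.
Lemma XT_slice_t u r : XT u -> cont1 (u r).
Proof. intros [h1 h2] t. apply (continuous_slice (fun p : R * R => u (fst p) (snd p))). apply h1. Qed.

Lemma XT_tube u t0 eps : XT u -> 0 < eps -> exists d, 0 < d /\ forall t, Rabs (t - t0) < d -> forall x, Rabs (u x t - u x t0) < eps.
Proof.
  intros [h1 h2] he.
  destruct (tube (fun t x => u x t) t0 0 1) with (eps := eps) as [d Hd]; auto.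
  - intros s _. apply (continuous_comp (fun p : R * R => (snd p, fst p)) (fun p : R * R => u (fst p) (snd p))).
    apply continuous_pair. apply continuous_snd. apply continuous_fst. apply h1.
  - exists d. split. apply cond_pos. intros t ht x. rewrite (h2 x t), (h2 x t0). apply Hd. exact ht. apply cl_range.
Qed.

Lemma inX_bounded f : inX f -> exists B, 0 <= B /\ forall x, Rabs (f x) <= B.
Proof.
  intros [h1 h2]. destruct (max_interval (fun x => Rabs (f x)) 0 1) as [m [_ Hm]]. lra.
  intros; apply cont_abs, h1. exists (Rabs (f m)). split. apply Rabs_pos. intros x. rewrite h2. apply Hm, cl_range.
Qed.

(** Bounded linear operators on C([0, 1]) with the sup norm; C bounds the operator norm. *)
Definition bop (T : (R -> R) -> R -> R) (C : R) :=
  0 <= C /\ (forall f, inX f -> inX (T f)) /\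
  (forall f g a b, inX f -> inX g -> forall x, T (fun x => a * f x + b * g x) x = a * T f x + b * T g x) /\
  (forall f B, inX f -> (forall x, Rabs (f x) <= B) -> forall x, Rabs (T f x) <= C * B).

Lemma inX_lin f g a b : inX f -> inX g -> inX (fun x => a * f x + b * g x).
Proof.
  intros [f1 f2] [g1 g2]. split.
  - intros x. apply cont_plus; apply cont_mult; auto; apply continuous_const.
  - intros x. now rewrite f2, g2.
Qed.
Lemma inX_const c : inX (fun _ => c).
Proof. split; auto. intros x. apply continuous_const. Qed.

Lemma bop_minus T C f g : bop T C -> inX f -> inX g -> forall x, T (fun x => f x - g x) x = T f x - T g x.
Proof.
  intros [_ [_ [hl _]]] hf hg x. generalize (hl f g 1 (-1) hf hg x).
  replace (fun x => 1 * f x + -1 * g x) with (fun x => f x - g x) by (apply functional_extensionality; intros; ring).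
  intros ->. ring.
Qed.
Lemma inX_minus f g : inX f -> inX g -> inX (fun x => f x - g x).
Proof.
  intros hf hg. replace (fun x => f x - g x) with (fun x => 1 * f x + -1 * g x) by (apply functional_extensionality; intros; ring).
  now apply inX_lin.
Qed.

Lemma bop_scal T C c : bop T C -> bop (fun f x => c * T f x) (Rabs c * C).
Proof.
  intros [h0 [h1 [h2 h3]]]. split; [|split; [|split]].
  - apply Rmult_le_pos; auto. apply Rabs_pos.
  - intros f hf. destruct (h1 f hf) as [a b]. split.
    intros x. apply cont_mult; auto. apply continuous_const. intros x. now rewrite b.
  - intros f g a b hf hg x. rewrite h2 by auto. ring.
  - intros f B hf hB x. rewrite Rabs_mult, Rmult_assoc. apply Rmult_le_compat_l. apply Rabs_pos. now apply h3.
Qed.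

Definition lift (T : (R -> R) -> R -> R) (u : R -> R -> R) : R -> R -> R := fun r t => T (fun x => u x t) r.

Lemma lift_XT T C u : bop T C -> XT u -> XT (lift T u).
Proof.
  intros HT hu. assert (HT' := HT). destruct HT' as [h0 [h1 [h2 h3]]]. split.
  - intros [r0 t0]. apply continuous_eps. intros eps he.
    destruct (XT_tube u t0 (eps / 2 / (C + 1)) hu) as [d [hd Hd]].
    { apply Rdiv_lt_0_compat; lra. }
    destruct (h1 _ (XT_slice u t0 hu)) as [c1 _].
    destruct (proj1 (continuous_eps _ _) (c1 r0) (eps/2)) as [d2 Hd2]. lra.
    exists (mkposreal (Rmin d d2) (Rmin_pos _ _ hd (cond_pos d2))). intros [r t] [hr ht]. simpl in *.
    assert (a1 := Hd2 r (ball_le _ _ _ (Rmin_r _ _) _ hr)).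
    assert (ht' : Rabs (t - t0) < d) by (eapply Rlt_le_trans; [exact ht|apply Rmin_l]).
    assert (a2 := h3 (fun x => u x t - u x t0) (eps / 2 / (C + 1)) (inX_minus _ _ (XT_slice u t hu) (XT_slice u t0 hu))
       (fun x => Rlt_le _ _ (Hd t ht' x)) r).
    rewrite (bop_minus T C) in a2; auto using XT_slice.
    unfold lift. replace (T (fun x => u x t) r - T (fun x => u x t0) r0) with
      ((T (fun x => u x t) r - T (fun x => u x t0) r) + (T (fun x => u x t0) r - T (fun x => u x t0) r0)) by ring.
    eapply Rle_lt_trans. apply Rabs_triang.
    assert (C * (eps / 2 / (C + 1)) <= eps / 2).
    { apply Rmult_le_reg_r with (C + 1). lra. field_simplify; lra. }
    lra.
  - intros r t. unfold lift. apply (h1 _ (XT_slice u t hu)).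
Qed.

(** Difference quotients in t converge uniformly in x by [XT_tube], so a bounded operator passes to
    their limit. *)
Lemma lift_derive T C u v : bop T C -> XT u -> XT v -> (forall r t, is_derive (u r) t (v r t)) ->
  forall r t, is_derive (lift T u r) t (lift T v r t).
Proof.
  intros HT hu hv hd r t. assert (HT' := HT). destruct HT' as [h0 [h1 [h2 h3]]].
  apply is_derive_eps. intros eps he.
  destruct (XT_tube v t (eps / (C + 1)) hv) as [d [hd0 Hd]].
  { apply Rdiv_lt_0_compat; lra. }
  exists d. split; auto. intros s hs. unfold lift.
  assert (E : T (fun x => u x s - u x t - (s - t) * v x t) r = T (fun x => u x s) r - T (fun x => u x t) r - (s - t) * T (fun x => v x t) r).
  { rewrite <- (bop_minus T C) by auto using XT_slice.
    generalize (h2 (fun x => u x s - u x t) (fun x => v x t) 1 (- (s - t))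
      (inX_minus _ _ (XT_slice u s hu) (XT_slice u t hu)) (XT_slice v t hv) r).
    replace (fun x => 1 * (u x s - u x t) + - (s - t) * v x t) with (fun x => u x s - u x t - (s - t) * v x t)
      by (apply functional_extensionality; intros; ring).
    intros ->. ring. }
  rewrite <- E.
  eapply Rle_trans. apply h3 with (B := eps / (C + 1) * Rabs (s - t)).
  - replace (fun x => u x s - u x t - (s - t) * v x t) with (fun x => 1 * (u x s - u x t) + - (s - t) * v x t)
      by (apply functional_extensionality; intros; ring).
    apply inX_lin; auto using XT_slice. apply inX_minus; auto using XT_slice.
  - intros x. destruct (mvt (u x) (v x) t s) as [c [hc ->]]. auto.
    replace (v x c * (s - t) - (s - t) * v x t) with ((v x c - v x t) * (s - t)) by ring.
    rewrite Rabs_mult. apply Rmult_le_compat_r. apply Rabs_pos. left. apply Hd. apply between_abs in hc. lra.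
  - rewrite <- Rmult_assoc. apply Rmult_le_compat_r. apply Rabs_pos.
    apply Rmult_le_reg_r with (C + 1). lra. field_simplify; lra.
Qed.

(** For p = 3 this is r^-4 times the integral of x^3 w (x) from 0 to r, rescaled to a fixed interval
    so that it is regular at r = 0. Solving (r^3 u_r)_r = - r^3 w gives u_r = - r A 3 w. Each
    r-derivative passes to w and raises p by one. *)
Definition A (p : nat) (w : R -> R) (r : R) : R := RInt (fun s => s ^ p * w (r * s)) 0 1.
(* [K] inverts minus the radial Dirichlet Laplacian of the unit ball of R^4. *)
Definition K (w : R -> R) (r : R) : R := RInt (fun x => x * A 3 w x) (cl r) 1.

Lemma A_cont p w : cont1 w -> cont1 (A p w).
Proof.
  intros hw r. apply (continuous_RInt_par (fun r s => s ^ p * w (r * s))). lra.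
  intros u s _. apply cont_mult. apply cont_pow, continuous_snd.
  apply (cont_comp (fun q : R * R => fst q * snd q) w); auto. apply cont_mult. apply continuous_fst. apply continuous_snd.
Qed.
Lemma A_ex p w r : cont1 w -> ex_RInt (fun s => s ^ p * w (r * s)) 0 1.
Proof.
  intros hw. apply ex_RInt_contT. intros s. apply cont_mult. apply cont_pow, continuous_id.
  apply (cont_comp (fun s => r * s) w); auto. apply cont_mult. apply continuous_const. apply continuous_id.
Qed.
Lemma A_lin p f g a b r : cont1 f -> cont1 g -> A p (fun x => a * f x + b * g x) r = a * A p f r + b * A p g r.
Proof.
  intros hf hg. unfold A. apply (is_RInt_unique (V := R_CompleteNormedModule)).
  apply (is_RInt_ext (fun s => a * (s ^ p * f (r * s)) + b * (s ^ p * g (r * s)))). rring.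
  apply (is_RInt_plus (V := R_NormedModule)); apply (is_RInt_scal (V := R_NormedModule));
    apply (RInt_correct (V := R_CompleteNormedModule)); now apply A_ex.
Qed.
Lemma A_bound p f B : cont1 f -> (forall x, Rabs (f x) <= B) -> forall r, Rabs (A p f r) <= B.
Proof.
  intros hf hB r. unfold A. replace B with ((1 - 0) * B) by ring. apply abs_RInt_le_const. lra. now apply A_ex.
  intros s hs. rewrite Rabs_mult. assert (0 <= s ^ p <= 1).
  { split. apply pow_le; lra. rewrite <- (pow1 p). apply pow_incr. lra. }
  rewrite (Rabs_pos_eq (s^p)) by lra. generalize (Rabs_pos (f (r * s))) (hB (r * s)). nra.
Qed.
Lemma A_even p f : inX f -> forall r, A p f (- r) = A p f r.
Proof.
  intros [_ h2] r. unfold A. apply RInt_ext. intros s _. f_equal. rewrite (h2 (-r * s)), (h2 (r * s)).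
  f_equal. rewrite <- cl_opp. f_equal. ring.
Qed.

Lemma xA_cont w : cont1 w -> cont1 (fun x => x * A 3 w x).
Proof. intros hw x. apply cont_mult. apply continuous_id. now apply A_cont. Qed.

(** Starting from [r] instead of [cl r] gives a function differentiable on the whole line; evenness
    identifies it with [K w] on [-1, 1], also across 0. *)
Definition Kt (w : R -> R) (r : R) : R := RInt (fun x => x * A 3 w x) r 1.
Lemma Kt_derive w r : cont1 w -> is_derive (Kt w) r (- (r * A 3 w r)).
Proof.
  intros hw. apply (is_derive_RInt' (fun x => x * A 3 w x) (Kt w) r 1).
  - apply filter_forall. intros y. apply (RInt_correct (V := R_CompleteNormedModule)). apply ex_RInt_contT. now apply xA_cont.
  - now apply xA_cont.
Qed.
Lemma Kt_even w r : inX w -> Kt w (- r) = Kt w r.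
Proof.
  intros hw. assert (hc := proj1 hw).
  destruct (mvt (fun r => Kt w (- r) - Kt w r) (fun _ => 0) 0 r) as [c [_ E]].
  - intros x _. eapply is_derive_val. apply is_derive_minus'.
    apply (is_derive_comp' (Kt w) (fun x => - x)). now apply Kt_derive.
    apply (is_derive_opp' (fun x => x)). apply is_derive_i. now apply Kt_derive.
    rewrite A_even by auto. ring.
  - rewrite Ropp_0 in E. lra.
Qed.
Lemma K_Kt w r : inX w -> -1 <= r <= 1 -> K w r = Kt w r.
Proof.
  intros hw hr. change (K w r) with (Kt w (cl r)). destruct (Rle_dec 0 r).
  - now rewrite cl_id by lra.
  - rewrite <- cl_opp, cl_id by lra. now apply Kt_even.
Qed.
Lemma K_derive w r : inX w -> -1 < r < 1 -> is_derive (K w) r (- (r * A 3 w r)).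
Proof.
  intros hw hr. apply (is_derive_ext_loc (Kt w)); [|apply Kt_derive, hw].
  exists (mkposreal (Rmin (1 - r) (r + 1)) ltac:(apply Rmin_pos; lra)). intros y hy.
  change (Rabs (y - r) < Rmin (1 - r) (r + 1)) in hy.
  assert (h1 := Rlt_le_trans _ _ _ hy (Rmin_l _ _)). assert (h2 := Rlt_le_trans _ _ _ hy (Rmin_r _ _)).
  apply Rabs_def2 in h1. apply Rabs_def2 in h2. symmetry. apply K_Kt; auto. lra.
Qed.
Lemma K_1 w r : 1 <= Rabs r -> K w r = 0.
Proof.
  intros hr. unfold K. replace (cl r) with 1. exact (RInt_point (V := R_CompleteNormedModule) 1 _).
  unfold cl, Rmin. destruct Rle_dec; lra.
Qed.

Lemma K_bop : bop K 1.
Proof.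
  split; [lra|split; [|split]].
  - intros f hf. split.
    + intros x. apply (cont_comp cl (Kt f)). apply continuous_cl.
      apply (ex_derive_continuous (V := R_NormedModule)). eexists. apply Kt_derive. apply hf.
    + intros x. unfold K. now rewrite cl_cl.
  - intros f g a b [hf _] [hg _] x. unfold K. apply (is_RInt_unique (V := R_CompleteNormedModule)).
    apply (is_RInt_ext (fun x => a * (x * A 3 f x) + b * (x * A 3 g x))). intros s _; rewrite A_lin by auto; rring.
    apply (is_RInt_plus (V := R_NormedModule)); apply (is_RInt_scal (V := R_NormedModule));
    apply (RInt_correct (V := R_CompleteNormedModule)); apply ex_RInt_contT; now apply xA_cont.
  - intros f B [hf _] hB x. unfold K. assert (hx := cl_range x).
    assert (0 <= B) by (generalize (Rabs_pos (f 0)) (hB 0); lra).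
    eapply Rle_trans. apply abs_RInt_le_const with (M := B). lra.
    apply ex_RInt_contT; now apply xA_cont.
    intros s hs. rewrite Rabs_mult, Rabs_pos_eq by lra. assert (h1 := A_bound 3 f B hf hB s).
    generalize (Rabs_pos (A 3 f s)). nra. nra.
Qed.

(** * Maximum principle and resolvent of K *)

Lemma A_RInt f r : cont1 f -> r ^ 4 * A 3 f r = RInt (fun x => x ^ 3 * f x) 0 r.
Proof.
  intros hf.
  assert (E := RInt_comp_lin (V := R_CompleteNormedModule) (fun x => x ^ 3 * f x) r 0 0 1).
  rewrite Rmult_0_r, Rplus_0_r, Rmult_1_r, Rplus_0_r in E. rewrite <- E.
  - unfold A. rewrite <- (RInt_scal (V := R_CompleteNormedModule)). 2: now apply A_ex.
    apply RInt_ext. intros s _. unfold scal; simpl; unfold mult; simpl. rewrite Rplus_0_r. ring.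
  - apply ex_RInt_contT. intros s. apply cont_mult; auto. apply cont_pow, continuous_id.
Qed.
Lemma A_derive f r : cont1 f -> is_derive (fun r => r ^ 4 * A 3 f r) r (r ^ 3 * f r).
Proof.
  intros hf. apply (is_derive_ext (fun r => RInt (fun x => x ^ 3 * f x) 0 r)).
  { intros t. symmetry. exact (A_RInt f t hf). }
  assert (c : forall s, continuous (fun x => x ^ 3 * f x) s).
  { intros s. apply cont_mult; auto. apply cont_pow, continuous_id. }
  apply (is_derive_RInt (fun x => x ^ 3 * f x) _ 0); [|exact (c r)].
  apply filter_forall. intros y. apply (RInt_correct (V := R_CompleteNormedModule)). now apply ex_RInt_contT.
Qed.

(** With u = K q the flux r^3 u_r equals - r^4 A 3 q r, with derivative - r^3 q. At a maximum the
    flux vanishes, so q < 0 just to the right would make u increase there. Positivity of u keeps the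
    maximum away from r = 1, and as only first derivatives occur the centre r = 0 is treated like
    other points. *)
Lemma K_max q r1 : inX q -> 0 <= r1 <= 1 -> (forall r, 0 <= r <= 1 -> K q r <= K q r1) -> 0 < K q r1 -> 0 <= q r1.
Proof.
  intros hq hr1 hmax hpos. destruct (Rle_dec 0 (q r1)) as [?|hneg]; auto. exfalso.
  assert (r1 < 1). { destruct (Req_dec r1 1) as [->|]. rewrite K_1 in hpos. lra. rewrite Rabs_R1; lra. lra. }
  destruct (proj1 (continuous_eps _ _) (proj1 hq r1) (- q r1)) as [d Hd]. lra.
  set (dl := Rmin (d / 2) ((1 - r1) / 2)).
  assert (hdl : 0 < dl) by (apply Rmin_pos; [generalize (cond_pos d)|]; lra).
  assert (hd1 : dl <= d / 2) by apply Rmin_l. assert (hd2 : dl <= (1 - r1) / 2) by apply Rmin_r.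
  assert (hd0 := cond_pos d).
  assert (hqn : forall x, r1 <= x <= r1 + dl -> q x < 0).
  { intros x hx. assert (a := Hd x ltac:(apply ball_R; apply Rabs_def1; lra)). apply Rabs_def2 in a. lra. }
  assert (P0 : r1 ^ 4 * A 3 q r1 = 0).
  { destruct (Req_dec r1 0) as [->|hr0]. ring.
    assert (D := K_derive q r1 hq ltac:(lra)).
    assert (Z : - (r1 * A 3 q r1) = 0).
    { apply is_derive_Reals in D.
      assert (pr : derivable_pt (K q) r1) by (eexists; exact D).
      rewrite <- (derive_pt_eq_0 _ _ _ pr D).
      apply (deriv_maximum (K q) 0 1 r1 pr); try lra. intros x h1 h2. apply hmax. lra. }
    assert (r1 * A 3 q r1 = 0) by lra. replace (r1 ^ 4 * A 3 q r1) with (r1 ^ 3 * (r1 * A 3 q r1)) by ring. rewrite H0. ring. }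
  assert (An : forall x, r1 < x <= r1 + dl -> A 3 q x < 0).
  { intros x hx. destruct (MVT_cor2 (fun r => r ^ 4 * A 3 q r) (fun r => r ^ 3 * q r) r1 x) as [c [hc1 hc2]]. lra.
    - intros c _. apply is_derive_Reals. apply A_derive, hq.
    - cbv beta in hc1. rewrite P0 in hc1. assert (q c < 0) by (apply hqn; lra).
      assert (0 < c ^ 3) by (apply pow_lt; lra). assert (0 < x ^ 4) by (apply pow_lt; lra).
      assert (0 < c ^ 3 * (x - r1)) by (apply Rmult_lt_0_compat; lra). nra. }
  destruct (MVT_cor2 (K q) (fun r => - (r * A 3 q r)) r1 (r1 + dl)) as [c [hc1 hc2]]. lra.
  - intros c hc. apply is_derive_Reals. apply K_derive; auto. lra.
  - assert (a := An c ltac:(lra)). assert (b := hmax (r1 + dl) ltac:(lra)). assert (0 < - (c * A 3 q c)) by nra. nra.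
Qed.

(** Compare with a maximum point r2 of K q. If K q is positive there, [K_max] gives q r2 >= 0, and K
    q r1 <= K q r2 forces q r1 >= q r2. Otherwise K q <= 0 everywhere and the positive value must
    come from ep q r1. No constant depends on ep, which is what allows ep to tend to 0. *)
Lemma accretive q ep r1 : inX q -> 0 < ep -> 0 <= r1 <= 1 ->
  (forall r, 0 <= r <= 1 -> K q r + ep * q r <= K q r1 + ep * q r1) -> 0 < K q r1 + ep * q r1 -> 0 <= q r1.
Proof.
  intros hq he hr1 hmax hpos.
  destruct (max_interval (K q) 0 1) as [r2 [hr2 H2]]. lra. intros. apply K_bop, hq.
  destruct (Rlt_dec 0 (K q r2)) as [h|h].
  - assert (a := K_max q r2 hq hr2 H2 h). specialize (hmax r2 hr2). specialize (H2 r1 hr1). nra.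
  - specialize (H2 r1 hr1). nra.
Qed.

Lemma inX_opp q : inX q -> inX (fun x => - q x).
Proof. intros [a b]. split. intros x. now apply cont_opp. intros x. now rewrite b. Qed.
Lemma K_opp q : inX q -> forall x, K (fun x => - q x) x = - K q x.
Proof.
  intros hq x. generalize (bop_minus K 1 _ _ K_bop (inX_const 0) hq x).
  replace (fun x => 0 - q x) with (fun x => - q x) by (apply functional_extensionality; intros; ring).
  intros ->. generalize (bop_minus K 1 _ _ K_bop hq hq x).
  generalize (proj1 (proj2 (proj2 K_bop)) (fun _ => 0) q 1 0 (inX_const 0) hq x).
  replace (K (fun _ : R => 0) x) with 0. intros; ring.
  unfold K. symmetry. rewrite (RInt_ext _ (fun _ => 0)). rewrite RInt_const. unfold scal; simpl; unfold mult; simpl. ring.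
  intros s _. unfold A. rewrite (RInt_ext _ (fun _ => 0)). rewrite RInt_const. unfold scal; simpl; unfold mult; simpl. ring.
  rring.
Qed.

(** At a positive maximum of K q, [K_max] gives q >= 0, hence K q <= K q + ep q <= B. The same for -
    q bounds |K q| by B, and ep q is a difference of two terms of size B. *)
Lemma resolvent_bound q ep B : inX q -> 0 < ep -> (forall x, Rabs (K q x + ep * q x) <= B) -> forall x, Rabs (q x) <= 2 / ep * B.
Proof.
  intros hq he hB.
  assert (H : forall q, inX q -> (forall x, Rabs (K q x + ep * q x) <= B) -> forall x, K q x <= B).
  { clear q hq hB. intros q hq hB.
    destruct (max_interval (K q) 0 1) as [r2 [hr2 H2]]. lra. intros. apply K_bop, hq.
    assert (K q r2 <= B).
    { destruct (Rlt_dec 0 (K q r2)) as [h|h].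
      - assert (a := K_max q r2 hq hr2 H2 h). specialize (hB r2). apply Rabs_le_between in hB. nra.
      - generalize (Rabs_pos (K q r2 + ep * q r2)) (hB r2). lra. }
    intros x. rewrite (proj2 (proj1 (proj2 K_bop) q hq) x). specialize (H2 (cl x) (cl_range x)). lra. }
  intros x. assert (a := H q hq hB x).
  assert (b := H (fun x => - q x) (inX_opp q hq)).
  assert (b' : K (fun x => - q x) x <= B).
  { apply b. intros y. rewrite K_opp by auto. replace (- K q y + ep * - q y) with (- (K q y + ep * q y)) by ring.
    rewrite Rabs_Ropp. auto. }
  rewrite K_opp in b' by auto. specialize (hB x). apply Rabs_le_between in hB.
  apply Rabs_le_between. split; apply Rmult_le_reg_l with ep; auto; field_simplify; lra.
Qed.

Lemma neumann S c g : bop S c -> c <= / 2 -> inX g -> exists q, inX q /\ forall x, q x = g x + S q x.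
Proof.
  intros HS hc hg. assert (HS' := HS). destruct HS' as [h0 [h1 [h2 h3]]].
  destruct (inX_bounded g hg) as [B [hB0 hB]].
  set (u := fun n => Nat.iter n (fun q x => g x + S q x) (fun _ => 0)).
  assert (uX : forall n, inX (u n)).
  { intros n. induction n as [|n IH]; simpl. apply inX_const.
    generalize (inX_lin g (S (u n)) 1 1 hg (h1 _ IH)). 
    replace (fun x => 1 * g x + 1 * S (u n) x) with (fun x => g x + S (u n) x) by (apply functional_extensionality; intros; ring). auto. }
  assert (S0 : forall x, S (fun _ => 0) x = 0).
  { intros x. assert (a := h3 (fun _ => 0) 0 (inX_const 0) ltac:(intros y; cbv beta; rewrite Rabs_R0; lra) x).
    rewrite Rmult_0_r in a. apply Rabs_le_between in a. lra. }
  assert (D : forall n x, Rabs (u (Datatypes.S n) x - u n x) <= B * (/ 2) ^ n).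
  { intros n. induction n as [|n IH]; intros x.
    - simpl. rewrite S0. replace (g x + 0 - 0) with (g x) by ring. rewrite Rmult_1_r. auto.
    - change (u (Datatypes.S (Datatypes.S n)) x) with (g x + S (u (Datatypes.S n)) x).
      change (u (Datatypes.S n) x) with (g x + S (u n) x) at 1.
      replace (g x + S (u (Datatypes.S n)) x - (g x + S (u n) x)) with (S (fun x => u (Datatypes.S n) x - u n x) x)
        by (rewrite (bop_minus S c) by auto; ring).
      eapply Rle_trans. apply h3. now apply inX_minus. exact IH.
      simpl. assert (0 <= B * (/2)^n) by (apply Rmult_le_pos; auto; apply pow_le; lra). nra. }
  assert (L : forall n x, Rabs (limf u x - u n x) <= 2 * B * (/ 2) ^ n).
  { intros n x. destruct (geom_cauchy (fun n => u n x) B (/2) ltac:(lra) (fun n => D n x)) as [_ G].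
    specialize (G n). unfold limf. replace (2 * B * (/2)^n) with (B * (/2)^n / (1 - /2)) by field. exact G. }
  exists (limf u).
  assert (lX : inX (limf u)).
  { split.
    - intros x. apply (limf_continuous u (/2) B). lra. apply filter_forall; auto.
      intros n. apply uX.
    - intros x. unfold limf. f_equal. apply Lim_seq_ext. intros n. apply uX. }
  split; auto. intros x.
  destruct (Req_dec (limf u x) (g x + S (limf u) x)) as [|hne]; auto. exfalso.
  set (de := Rabs (limf u x - (g x + S (limf u) x))). assert (0 < de) by (apply Rabs_pos_lt; lra).
  assert (E : forall n, de <= 2 * B * (/2) ^ n).
  { intros n. assert (a := L (Datatypes.S n) x).
    assert (b := h3 _ _ (inX_minus _ _ lX (uX n)) (L n) x). rewrite (bop_minus S c) in b by auto.
    change (u (Datatypes.S n) x) with (g x + S (u n) x) in a.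
    unfold de. replace (limf u x - (g x + S (limf u) x)) with ((limf u x - (g x + S (u n) x)) - (S (limf u) x - S (u n) x)) by ring.
    eapply Rle_trans. apply Rabs_triang. rewrite Rabs_Ropp. simpl in a.
    assert (0 <= B * (/2)^n) by (apply Rmult_le_pos; auto; apply pow_le; lra). nra. }
  assert (Lz : is_lim_seq (fun n => 2 * B * (/2)^n) 0).
  { replace (Finite 0) with (Rbar_mult (2 * B) 0) by (simpl; f_equal; ring).
    apply is_lim_seq_scal_l. apply is_lim_seq_geom. rewrite Rabs_pos_eq; lra. }
  assert (F := is_lim_seq_le (fun _ => de) _ de 0 E (is_lim_seq_const de) Lz). simpl in F. lra.
Qed.

(** [resolvent_bound] with B = 0 is uniqueness, which makes the chosen solution linear in f; with
    general B it bounds the norm. *)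
Lemma resolvent_of_solvable ep : 0 < ep -> (forall f, inX f -> exists q, inX q /\ forall x, K q x + ep * q x = f x) ->
  exists T, bop T (2 / ep) /\ (forall f, inX f -> forall x, K (T f) x + ep * T f x = f x).
Proof.
  intros he H.
  assert (H' : forall f, exists q, inX f -> inX q /\ forall x, K q x + ep * q x = f x).
  { intros f. destruct (excluded_middle_informative (inX f)) as [h|h].
    destruct (H f h) as [q hq]. exists q; auto. exists f; tauto. }
  exists (fun f => proj1_sig (constructive_indefinite_description _ (H' f))).
  assert (HT : forall f, inX f -> let q := proj1_sig (constructive_indefinite_description _ (H' f)) in inX q /\ forall x, K q x + ep * q x = f x).
  { intros f. exact (proj2_sig (constructive_indefinite_description _ (H' f))). }
  set (T := fun f => proj1_sig (constructive_indefinite_description _ (H' f))) in *.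
  change (forall f, inX f -> inX (T f) /\ (forall x, K (T f) x + ep * T f x = f x)) in HT.
  assert (U : forall q, inX q -> (forall x, K q x + ep * q x = 0) -> forall x, q x = 0).
  { intros q hq hz x. assert (a := resolvent_bound q ep 0 hq he ltac:(intros; rewrite hz, Rabs_R0; lra) x).
    rewrite Rmult_0_r in a. apply Rabs_le_between in a. lra. }
  split; [split; [|split; [|split]]|].
  - apply Rlt_le, Rdiv_lt_0_compat; lra.
  - intros f hf. now apply HT.
  - intros f g a b hf hg x. assert (hl := inX_lin f g a b hf hg).
    destruct (HT _ hf) as [f1 f2], (HT _ hg) as [g1 g2], (HT _ hl) as [l1 l2].
    apply Rminus_diag_uniq.
    apply (U (fun x => T (fun x => a * f x + b * g x) x - (a * T f x + b * T g x))).
    + apply inX_minus; auto. now apply inX_lin.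
    + intros y. rewrite (bop_minus K 1); auto using K_bop, inX_lin.
      rewrite (proj1 (proj2 (proj2 K_bop))) by auto.
      replace (K (T (fun x => a * f x + b * g x)) y - (a * K (T f) y + b * K (T g) y) + ep * (T (fun x => a * f x + b * g x) y - (a * T f y + b * T g y)))
        with ((K (T (fun x => a * f x + b * g x)) y + ep * T (fun x => a * f x + b * g x) y) - a * (K (T f) y + ep * T f y) - b * (K (T g) y + ep * T g y)) by ring.
      rewrite l2, f2, g2. ring.
  - intros f B hf hB x. destruct (HT _ hf) as [f1 f2]. apply resolvent_bound; auto. intros y. now rewrite f2.
  - intros f hf. now apply HT.
Qed.

(** At eps = 4 the operator K / 4 has norm at most 1/4, so a Neumann series starts the induction.
    The ratio 3/4 is the smallest one for which the step eps n - eps (n+1), multiplied by the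
    resolvent norm 2 / eps n, does not exceed 1/2. *)
Definition eps (n : nat) : R := 4 * (3 / 4) ^ n.
Lemma eps_pos n : 0 < eps n.
Proof. unfold eps. apply Rmult_lt_0_compat. lra. apply pow_lt. lra. Qed.
Lemma eps_S n : eps (S n) = 3 / 4 * eps n.
Proof. unfold eps. simpl. ring. Qed.

(** Method of continuity: K + eps (n+1) is K + eps n minus a small multiple of the identity.
    Applying the resolvent T at eps n leaves q = T f + (eps n - eps (n+1)) T q, which [neumann]
    solves. *)
Lemma resolvent_ex n : exists T, bop T (2 / eps n) /\ (forall f, inX f -> forall x, K (T f) x + eps n * T f x = f x).
Proof.
  induction n as [|n [T [HT HK]]]; apply resolvent_of_solvable; try apply eps_pos; intros f hf.
  - destruct (neumann _ _ (fun x => / 4 * f x) (bop_scal K 1 (- / 4) K_bop)) as [q [h1 h2]].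
    + rewrite Rabs_Ropp, Rabs_pos_eq; lra.
    + generalize (inX_lin f f (/4) 0 hf hf). replace (fun x => / 4 * f x + 0 * f x) with (fun x => / 4 * f x); auto.
      apply functional_extensionality; intros; ring.
    + exists q. split; auto. intros x. specialize (h2 x). unfold eps. simpl. lra.
  - assert (he := eps_pos n).
    destruct (neumann _ _ (T f) (bop_scal T _ (eps n - eps (S n)) HT)) as [q [h1 h2]].
    + rewrite eps_S. rewrite Rabs_pos_eq by lra. right. field. lra.
    + now apply HT.
    + exists q. split; auto. intros x.
      assert (E : q = (fun x => 1 * T f x + (eps n - eps (S n)) * T q x)).
      { apply functional_extensionality. intros y. rewrite (h2 y) at 1. ring. }
      assert (a := HK f hf x). assert (b := HK q h1 x).
      assert (c : K q x = K (T f) x + (eps n - eps (S n)) * K (T q) x).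
      { rewrite E at 1. rewrite (proj1 (proj2 (proj2 K_bop))). ring. now apply HT. now apply HT. }
      rewrite c. specialize (h2 x).
      replace (eps (S n) * q x) with (eps n * q x - (eps n - eps (S n)) * q x) by ring.
      rewrite <- b at 2. rewrite h2 at 1. rewrite <- a. ring.
Qed.

Definition Res (n : nat) := proj1_sig (constructive_indefinite_description _ (resolvent_ex n)).
Lemma Res_bop n : bop (Res n) (2 / eps n).
Proof. apply (proj2_sig (constructive_indefinite_description _ (resolvent_ex n))). Qed.
Lemma Res_eq n f : inX f -> forall x, K (Res n f) x + eps n * Res n f x = f x.
Proof. apply (proj2_sig (constructive_indefinite_description _ (resolvent_ex n))). Qed.

(** * Evolution equations on the unit ball *)

Lemma XT_const c : XT (fun _ _ => c).
Proof. split; auto. intros p. apply continuous_const. Qed.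
Lemma XT_plus u v : XT u -> XT v -> XT (fun r t => u r t + v r t).
Proof. intros [a b] [c d]. split. intros p. now apply cont_plus. intros; now rewrite b, d. Qed.
Lemma XT_mult u v : XT u -> XT v -> XT (fun r t => u r t * v r t).
Proof. intros [a b] [c d]. split. intros p. now apply cont_mult. intros; now rewrite b, d. Qed.
Lemma XT_comp u f : cont1 f -> XT u -> XT (fun r t => f (u r t)).
Proof. intros hf [a b]. split. intros p. now apply cont_comp. intros; now rewrite b. Qed.
Lemma XT_scal c u : XT u -> XT (fun r t => c * u r t).
Proof. intros. apply XT_mult; auto. apply XT_const. Qed.
Lemma XT_minus u v : XT u -> XT v -> XT (fun r t => u r t - v r t).
Proof. intros [a b] [c d]. split. intros p. now apply cont_minus. intros; now rewrite b, d. Qed.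
Lemma XT_t : XT (fun _ t => t).
Proof. split; auto. intros p. apply continuous_snd. Qed.
Lemma XT_cl : XT (fun r _ => cl r).
Proof.
  split; intros. intros p. apply (cont_comp (fun p : R * R => fst p) cl). apply continuous_fst. apply continuous_cl.
  now rewrite cl_cl.
Qed.

Lemma XT_bounded u T : XT u -> exists B, 0 <= B /\ forall r t, Rabs t <= T -> Rabs (u r t) <= B.
Proof.
  intros [h1 h2]. destruct (Rle_dec 0 T) as [hT|hT].
  - destruct (max_rect (fun r t => Rabs (u r t)) 0 1 (-T) T) as [m [n [_ [_ H]]]]; try lra.
    + intros. apply cont_abs. apply h1.
    + exists (Rabs (u m n)). split. apply Rabs_pos. intros r t ht. rewrite h2. apply H. apply cl_range.
      now apply Rabs_le_between.
  - exists 0. split. lra. intros r t ht. generalize (Rabs_pos t). lra.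
Qed.

Definition P0x (f : R * R -> R) := XT (fun r t => f (r, t)).
Definition D2x (f g : R * R -> R) := forall r t, is_derive (fun s => f (r, s)) t (g (r, t)).
Lemma base_P0x : base P0x.
Proof.
  split; unfold P0x; intros.
  - apply XT_const.
  - now apply XT_plus.
  - now apply XT_mult.
  - apply (XT_comp (fun r t => f (r, t))); auto. intros x. apply sf_continuous.
Qed.
Lemma derivation_D2x : derivation D2x.
Proof.
  split; unfold D2x; intros.
  - apply is_derive_c.
  - now apply is_derive_plus'.
  - now apply is_derive_mult'.
  - apply (is_derive_comp' (sf H 0)). apply sfP. auto.
Qed.
#[local] Hint Resolve base_P0x derivation_D2x : core.
Definition Cx k (u : R -> R -> R) := Cl P0x D2x D2x 0 k (fun p => u (fst p) (snd p)).

Lemma Cx_XT k u : Cx k u -> XT u.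
Proof. intros H. exact (Cl_base _ _ _ _ _ _ H). Qed.
Lemma Cx_S k u v : XT u -> (forall r t, is_derive (u r) t (v r t)) -> Cx k v -> Cx (S k) u.
Proof.
  intros hu hd hv. apply Cl_eq. split; [exact hu|split; [discriminate|]].
  intros k' [= <-]. eexists. split; [|exact hv]. exact hd.
Qed.
Lemma Cx_D k u : Cx (S k) u -> exists v, (forall r t, is_derive (u r) t (v r t)) /\ Cx k v.
Proof.
  intros H. destruct (Cl_D2 _ _ _ _ _ _ H) as [g [h1 h2]]. exists (fun r t => g (r, t)). split. exact h1.
  unfold Cx. replace (fun p => g (fst p, snd p)) with g; auto. apply functional_extensionality. now intros [a b].
Qed.
Lemma Cx_0 u : XT u -> Cx 0 u.
Proof. intros hu. apply Cl_eq. split; [exact hu|split; discriminate]. Qed.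

Lemma Cx_minus k u v : Cx k u -> Cx k v -> Cx k (fun r t => u r t - v r t).
Proof.
  intros hu hv. exact (Cl_minus P0x D2x D2x base_P0x derivation_D2x derivation_D2x 0 k
    (fun p => u (fst p) (snd p)) (fun p => v (fst p) (snd p)) hu hv).
Qed.

Lemma Cx_lift T C u k : bop T C -> Cx k u -> Cx k (lift T u).
Proof.
  intros HT. revert u. induction k as [|k IH]; intros u hu.
  - apply Cx_0. eapply lift_XT; eauto. now apply Cx_XT in hu.
  - assert (hx := Cx_XT _ _ hu). destruct (Cx_D _ _ hu) as [v [h1 h2]].
    apply (Cx_S _ _ (lift T v)). eapply lift_XT; eauto. eapply lift_derive; eauto. now apply Cx_XT in h2. auto.
Qed.
Lemma Cx_t k : Cx k (fun _ t => t).
Proof.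
  destruct k. apply Cx_0, XT_t. apply (Cx_S _ _ (fun _ _ => 1)). apply XT_t. intros; apply is_derive_i.
  exact (Cl_const _ _ _ base_P0x derivation_D2x derivation_D2x 0 k 1).
Qed.
Lemma Cx_cl k : Cx k (fun r _ => cl r).
Proof.
  destruct k. apply Cx_0, XT_cl. apply (Cx_S _ _ (fun _ _ => 0)). apply XT_cl. intros; apply is_derive_c.
  exact (Cl_const _ _ _ base_P0x derivation_D2x derivation_D2x 0 k 0).
Qed.
Definition Fe (e : expr) (u : R -> R -> R) : R -> R -> R := fun r t => eval e t (cl r) (u r t).
Lemma Cx_Fe e k u : Cx k u -> Cx k (Fe e u).
Proof.
  intros hu. apply (eval_class P0x D2x D2x base_P0x derivation_D2x derivation_D2x 0 k e
    (fun p => snd p) (fun p => cl (fst p)) (fun p => u (fst p) (snd p))); auto. apply Cx_t. apply Cx_cl.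
Qed.
Lemma Fe_XT e u : XT u -> XT (Fe e u).
Proof. intros hu. apply (Cx_XT 0). apply Cx_Fe. now apply Cx_0. Qed.

Definition dk (u : R -> R -> R) (k : nat) : R -> R -> R := fun r t => Derive_n (u r) k t.
Lemma Cx_dk u : (forall k, Cx k u) -> forall k m, Cx m (dk u k).
Proof.
  intros H k. induction k as [|k IH]; intros m. exact (H m).
  destruct (Cx_D _ _ (IH (S m))) as [v [h1 h2]]. replace (dk u (S k)) with v; auto.
  apply functional_extensionality; intros r; apply functional_extensionality; intros t.
  symmetry. apply is_derive_unique. apply h1.
Qed.
Lemma dk_XT u k : (forall k, Cx k u) -> XT (dk u k).
Proof. intros H. apply (Cx_XT 0). now apply Cx_dk. Qed.
Lemma dk_derive u k r t : (forall k, Cx k u) -> is_derive (dk u k r) t (dk u (S k) r t).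
Proof.
  intros H. destruct (Cx_D _ _ (Cx_dk u H k 1%nat)) as [v [h1 _]]. apply Derive_correct. eexists. apply h1.
Qed.

(** For t < 0 the derivatives vanish because u does so nearby, and continuity carries this to t = 0.
    It gives the estimates of every time derivative zero initial values. *)
Lemma dk_zero u k r t : (forall k, Cx k u) -> (forall r t, t <= 0 -> u r t = 0) -> t <= 0 -> dk u k r t = 0.
Proof.
  intros H hz ht.
  assert (Z : forall s, s < 0 -> dk u k r s = 0).
  { clear t ht. induction k as [|k IH]; intros s hs. apply hz; lra.
    apply is_derive_unique. apply (is_derive_ext_loc (fun _ => 0)); [|apply is_derive_c].
    exists (mkposreal (-s) ltac:(lra)). intros y hy. change (Rabs (y - s) < - s) in hy. apply Rabs_def2 in hy.
    symmetry. apply IH. lra. }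
  destruct (Rlt_dec t 0) as [h|h]; auto. replace t with 0 by lra.
  assert (c := XT_slice_t _ r (dk_XT u k H) 0).
  destruct (Req_dec (dk u k r 0) 0) as [|hn]; auto. exfalso.
  destruct (proj1 (continuous_eps _ _) c (Rabs (dk u k r 0))) as [d Hd]. now apply Rabs_pos_lt.
  assert (hd := cond_pos d). specialize (Hd (- (d / 2))). rewrite Z in Hd by lra.
  rewrite Rminus_0_l, Rabs_Ropp in Hd. apply (Rlt_irrefl (Rabs (dk u k r 0))). apply Hd.
  change (Rabs (- (d / 2) - 0) < d). rewrite Rminus_0_r, Rabs_Ropp, Rabs_pos_eq; lra.
Qed.

Lemma derive_left_max (W : R -> R) (l a t : R) : a < t -> is_derive W t l -> (forall s, a <= s <= t -> W s <= W t) -> 0 <= l.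
Proof.
  intros hat hd hm. destruct (Rle_dec 0 l) as [|hl]; auto. exfalso.
  destruct (proj1 (is_derive_eps _ _ _) hd (- l / 2)) as [d [h0 Hd]]. lra.
  set (s := t - Rmin (d / 2) (t - a)).
  assert (0 < Rmin (d / 2) (t - a)) by (apply Rmin_pos; lra).
  assert (Rmin (d/2) (t - a) <= d / 2) by apply Rmin_l. assert (Rmin (d/2) (t - a) <= t - a) by apply Rmin_r.
  assert (e : s - t = - Rmin (d / 2) (t - a)) by (unfold s; ring).
  specialize (Hd s). rewrite e, Rabs_Ropp, Rabs_pos_eq in Hd by lra. specialize (Hd ltac:(lra)).
  apply Rabs_le_between in Hd. specialize (hm s ltac:(lra)). nra.
Qed.

(* At a positive spatial maximum of z the resolvent equation forces p >= 0, so z_t <= f there. *)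
Lemma evolution_bound ep (z p f : R -> R -> R) b rho T : 0 < ep -> XT z -> XT p ->
  (forall r t, z r t = lift K p r t + ep * p r t) ->
  (forall r t, is_derive (z r) t (- p r t + f r t)) -> 0 <= b -> 0 <= rho -> 
  (forall r t, 0 <= t <= T -> Rabs (f r t) <= b * Rabs (z r t) + rho) -> (forall r, z r 0 = 0) ->
  forall r t, 0 <= t <= T -> z r t <= rho * exp ((b + 1) * t).
Proof.
  intros he hz hp hzp hd hb hr hf h0 r t ht.
  (* The exponent b + 1 exceeds the growth rate b by 1: at a positive maximum of W the inequality 0
     <= - p + f - (b + 1) z then leaves z <= rho. *)
  set (W := fun r t => exp (- ((b + 1) * t)) * z r t).
  destruct (max_rect W 0 1 0 T) as [rs [ts [hrs [hts Hm]]]]; try lra.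
  { intros x y _ _. unfold W. apply cont_mult. cc. apply hz. }
  assert (hW : W rs ts <= rho).
  { destruct (Rle_dec (W rs ts) rho) as [|hn]; auto. exfalso.
    assert (ts <> 0). { intros ->. unfold W in hn. rewrite h0 in hn. lra. }
    assert (he1 := exp_pos (- ((b + 1) * ts))).
    assert (he2 : exp (- ((b + 1) * ts)) <= 1).
    { assert (q := exp_increasing (- ((b + 1) * ts)) 0 ltac:(nra)). rewrite exp_0 in q. lra. }
    assert (zp : 0 < z rs ts). { unfold W in hn. apply Rmult_lt_reg_l with (exp (- ((b + 1) * ts))); lra. }
    assert (P : 0 <= p rs ts).
    { apply (accretive (fun x => p x ts) ep rs); auto.
      - now apply XT_slice.
      - intros x hx. specialize (Hm x ts hx hts). unfold W in Hm. apply Rmult_le_reg_l in Hm; auto.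
        rewrite !hzp in Hm. exact Hm.
      - generalize zp. rewrite hzp. auto. }
    assert (D : 0 <= exp (- ((b + 1) * ts)) * ((- p rs ts + f rs ts) - (b + 1) * z rs ts)).
    { apply (derive_left_max (W rs) _ 0 ts). lra.
      - unfold W. eapply is_derive_val. apply is_derive_mult'. 2: apply hd.
        apply (is_derive_comp' exp (fun t => - ((b + 1) * t))). apply is_derive_exp.
        apply is_derive_opp'. apply (is_derive_scal' (fun y => y)). apply is_derive_i. cbv beta. ring.
      - intros s hs. apply Hm; lra. }
    assert (D' : 0 <= (- p rs ts + f rs ts) - (b + 1) * z rs ts).
    { apply Rmult_le_reg_l with (exp (- ((b + 1) * ts))); auto. lra. }
    assert (F := hf rs ts hts). apply Rabs_le_between in F. rewrite (Rabs_pos_eq (z rs ts)) in F by lra.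
    assert (z rs ts <= rho) by lra. apply hn. unfold W. nra. }
  assert (hc : W (cl r) t <= rho). { eapply Rle_trans. apply Hm; auto. apply cl_range. auto. }
  rewrite (proj2 hz). unfold W in hc. rewrite exp_Ropp in hc. assert (e := exp_pos ((b + 1) * t)).
  apply Rmult_le_reg_l with (/ exp ((b + 1) * t)). now apply Rinv_0_lt_compat.
  eapply Rle_trans. exact hc. right. field. lra.
Qed.

Lemma lift_K_opp p : XT p -> forall r t, lift K (fun r t => - p r t) r t = - lift K p r t.
Proof. intros hp r t. unfold lift. apply (K_opp (fun x => p x t)). now apply XT_slice. Qed.

Lemma evolution_bound_abs ep (z p f : R -> R -> R) b rho T : 0 < ep -> XT z -> XT p ->
  (forall r t, z r t = lift K p r t + ep * p r t) ->
  (forall r t, is_derive (z r) t (- p r t + f r t)) -> 0 <= b -> 0 <= rho -> 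
  (forall r t, 0 <= t <= T -> Rabs (f r t) <= b * Rabs (z r t) + rho) -> (forall r, z r 0 = 0) ->
  forall r t, 0 <= t <= T -> Rabs (z r t) <= rho * exp ((b + 1) * t).
Proof.
  intros he hz hp hzp hd hb hr hf h0 r t ht. apply Rabs_le_between. split.
  - assert (a : - z r t <= rho * exp ((b + 1) * t)); [|lra].
    apply (evolution_bound ep (fun r t => - z r t) (fun r t => - p r t) (fun r t => - f r t) b rho T); auto.
    + apply (XT_comp z (fun x => - x)); auto. intros x. cc.
    + apply (XT_comp p (fun x => - x)); auto. intros x. cc.
    + intros. rewrite lift_K_opp by auto. rewrite hzp. ring.
    + intros. eapply is_derive_val. apply is_derive_opp'. apply hd. ring.
    + intros. rewrite !Rabs_Ropp. auto.
    + intros. rewrite h0. ring.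
  - apply (evolution_bound ep z p f b rho T); auto.
Qed.

Definition Int (g : R -> R -> R) : R -> R -> R := fun r t => RInt (g r) 0 t.
Lemma Int_derive g r t : XT g -> is_derive (Int g r) t (g r t).
Proof.
  intros hg. apply (is_derive_RInt (g r) _ 0); [|exact (XT_slice_t g r hg t)].
  apply filter_forall. intros y. apply (RInt_correct (V := R_CompleteNormedModule)).
  apply ex_RInt_contT. exact (XT_slice_t g r hg).
Qed.
Lemma Int_XT g : XT g -> XT (Int g).
Proof.
  intros hg. assert (hg' := hg). destruct hg' as [h1 h2]. split.
  (* Rescaling to [0, 1] turns the moving end point into a parameter of the integrand, which gives
     joint continuity. *)
  - intros p. apply (continuous_ext (fun p : R * R => snd p * RInt (fun s => g (fst p) (snd p * s)) 0 1)).
    + intros [r t]. simpl. unfold Int.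
      assert (E := RInt_comp_lin (V := R_CompleteNormedModule) (g r) t 0 0 1).
      rewrite Rmult_0_r, Rplus_0_r, Rmult_1_r, Rplus_0_r in E. rewrite <- E.
      * rewrite <- (RInt_scal (V := R_CompleteNormedModule)).
        -- apply RInt_ext. intros s _. rewrite Rplus_0_r. reflexivity.
        -- apply ex_RInt_contT. intros s. apply (cont_comp (fun s => t * s) (g r)). cc. apply (XT_slice_t g r hg).
      * apply ex_RInt_contT. exact (XT_slice_t g r hg).
    + apply cont_mult. apply continuous_snd.
      apply (continuous_RInt_par (fun (p : R * R) s => g (fst p) (snd p * s))). lra.
      intros u s _. apply (continuous_comp2 g (fun q : (R * R) * R => fst (fst q)) (fun q => snd (fst q) * snd q)).
      apply h1. apply (continuous_comp fst fst). apply continuous_fst. apply continuous_fst.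
      apply cont_mult. apply (continuous_comp fst snd). apply continuous_fst. apply continuous_snd. apply continuous_snd.
  - intros r t. unfold Int. apply RInt_ext. intros; apply h2.
Qed.

Lemma RInt_dominated (g Phi phi : R -> R) t : 0 <= t -> cont1 g -> cont1 phi -> (forall s, is_derive Phi s (phi s)) ->
  (forall s, 0 <= s <= t -> Rabs (g s) <= phi s) -> Rabs (RInt g 0 t) <= Phi t - Phi 0.
Proof.
  intros ht hg hphi hd hle. eapply Rle_trans. apply abs_RInt_le; auto. now apply ex_RInt_contT.
  rewrite <- (is_RInt_unique (V := R_CompleteNormedModule) phi 0 t (Phi t - Phi 0)).
  - apply RInt_le; auto. apply ex_RInt_contT. intros s. now apply cont_abs. now apply ex_RInt_contT.
    intros x hx. apply hle. lra.
  - apply (is_RInt_derive (V := R_CompleteNormedModule)); auto.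
Qed.

(** Points are triples (n, (r, t)): the index n of the regularization is part of the point, so the
    classes [Cf] express bounds on time derivatives that are uniform in n and r. *)
Definition P0f (f : nat * (R * R) -> R) := forall T, exists M, forall n r t, Rabs t <= T -> Rabs (f (n, (r, t))) <= M.
Definition D2f (f g : nat * (R * R) -> R) := forall n r t, is_derive (fun s => f (n, (r, s))) t (g (n, (r, t))).
Lemma base_P0f : base P0f.
Proof.
  split; unfold P0f.
  - intros c T. exists (Rabs c). intros; lra.
  - intros f g hf hg T. destruct (hf T) as [a ha], (hg T) as [b hb]. exists (a + b). intros.
    eapply Rle_trans. apply Rabs_triang. apply Rplus_le_compat; auto.
  - intros f g hf hg T. destruct (hf T) as [a ha], (hg T) as [b hb]. exists (a * b). intros.
    rewrite Rabs_mult. apply Rmult_le_compat; auto using Rabs_pos.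
  - intros H f hf T. destruct (hf T) as [a ha]. destruct (smf_bounded H 0 a) as [b hb]. exists b. auto.
Qed.
Lemma derivation_D2f : derivation D2f.
Proof.
  split; unfold D2f; intros.
  - apply is_derive_c.
  - now apply is_derive_plus'.
  - now apply is_derive_mult'.
  - apply (is_derive_comp' (sf H 0)). apply sfP. auto.
Qed.
Definition Cf k (u : nat -> R -> R -> R) := Cl P0f D2f D2f 0 k (fun p => u (fst p) (fst (snd p)) (snd (snd p))).
Definition bddf (u : nat -> R -> R -> R) := forall T, exists M, forall n r t, Rabs t <= T -> Rabs (u n r t) <= M.
Lemma Cf_bdd k u : Cf k u -> bddf u.
Proof. intros H. exact (Cl_base _ _ _ _ _ _ H). Qed.
Lemma Cf_S k u v : bddf u -> (forall n r t, is_derive (u n r) t (v n r t)) -> Cf k v -> Cf (S k) u.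
Proof.
  intros hu hd hv. apply Cl_eq. split; [exact hu|split; [discriminate|]].
  intros k' [= <-]. eexists. split; [|exact hv]. exact hd.
Qed.
Lemma Cf_D k u : Cf (S k) u -> exists v, (forall n r t, is_derive (u n r) t (v n r t)) /\ Cf k v.
Proof.
  intros H. destruct (Cl_D2 _ _ _ _ _ _ H) as [g [h1 h2]]. exists (fun n r t => g (n, (r, t))). split. exact h1.
  unfold Cf. replace (fun p => g (fst p, (fst (snd p), snd (snd p)))) with g; auto.
  apply functional_extensionality. now intros [n [a b]].
Qed.
Lemma Cf_0 u : bddf u -> Cf 0 u.
Proof. intros hu. apply Cl_eq. split; [exact hu|split; discriminate]. Qed.
Lemma Cf_le j k u : (j <= k)%nat -> Cf k u -> Cf j u.
Proof. intros h. apply Cl_le; auto. Qed.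
Lemma Cf_plus k u v : Cf k u -> Cf k v -> Cf k (fun n r t => u n r t + v n r t).
Proof. exact (Cl_plus P0f D2f D2f base_P0f derivation_D2f derivation_D2f 0 k _ _). Qed.
Lemma Cf_mult k u v : Cf k u -> Cf k v -> Cf k (fun n r t => u n r t * v n r t).
Proof. exact (Cl_mult P0f D2f D2f base_P0f derivation_D2f derivation_D2f 0 k _ _). Qed.
Lemma Cf_const k c : Cf k (fun _ _ _ => c).
Proof. exact (Cl_const P0f D2f D2f base_P0f derivation_D2f derivation_D2f 0 k c). Qed.
Lemma Cf_eval e k u : Cf k u -> Cf k (fun n r t => eval e t (cl r) (u n r t)).
Proof.
  intros hu. apply (eval_class P0f D2f D2f base_P0f derivation_D2f derivation_D2f 0 k e
    (fun p => snd (snd p)) (fun p => cl (fst (snd p))) (fun p => u (fst p) (fst (snd p)) (snd (snd p)))); auto.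
  - change (Cf k (fun _ _ t => t)). assert (b : bddf (fun _ _ t => t)) by (intros T; exists T; auto).
    destruct k. now apply Cf_0. apply (Cf_S _ _ (fun _ _ _ => 1)); auto. intros; apply is_derive_i. apply Cf_const.
  - change (Cf k (fun _ r _ => cl r)). assert (b : bddf (fun _ r _ => cl r)).
    { intros T; exists 1; intros n r t _. apply Rabs_le. generalize (cl_range r). lra. }
    destruct k. now apply Cf_0. apply (Cf_S _ _ (fun _ _ _ => 0)); auto. intros; apply is_derive_c. apply Cf_const.
Qed.

(** Landau-type inequality: one mean value over a step h for f, another for its derivative g. With h
    small it transfers smallness from f to g at the price of a bound on k. *)
Lemma interpolation (f g k : R -> R) a b t h : 0 < h -> (forall s, is_derive f s (g s)) -> (forall s, is_derive g s (k s)) ->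
  (forall s, t <= s <= t + h -> Rabs (f s) <= a) -> (forall s, t <= s <= t + h -> Rabs (k s) <= b) ->
  Rabs (g t) <= 2 * a / h + b * h.
Proof.
  intros hh hf hg ha hb.
  destruct (mvt f g t (t + h)) as [c [hc E]]; auto.
  rewrite Rmin_left, Rmax_right in hc by lra.
  destruct (mvt g k t c) as [c' [hc' E']]; auto.
  rewrite Rmin_left, Rmax_right in hc' by lra.
  assert (b0 := hb c' ltac:(lra)). assert (a1 := ha t ltac:(lra)). assert (a2 := ha (t + h) ltac:(lra)).
  assert (G : Rabs (g c) <= 2 * a / h).
  { apply Rmult_le_reg_r with h; auto. replace (2 * a / h * h) with (2 * a) by (field; lra).
    replace (Rabs (g c) * h) with (Rabs (f (t + h) - f t)).
    - unfold Rminus. eapply Rle_trans. apply Rabs_triang. rewrite Rabs_Ropp. lra.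
    - rewrite E, Rabs_mult. rewrite (Rabs_pos_eq (t + h - t)) by lra. ring. }
  replace (g t) with (g c - (g c - g t)) by ring. unfold Rminus at 1.
  eapply Rle_trans. apply Rabs_triang. rewrite Rabs_Ropp. apply Rplus_le_compat; auto.
  rewrite E', Rabs_mult. rewrite (Rabs_pos_eq (c - t)) by lra. generalize (Rabs_pos (k c')). nra.
Qed.

Lemma geom_lim0 C q : 0 <= q < 1 -> is_lim_seq (fun n => C * q ^ n) 0.
Proof.
  intros hq. replace (Finite 0) with (Rbar_mult C 0) by (simpl; f_equal; ring).
  apply is_lim_seq_scal_l. apply is_lim_seq_geom. rewrite Rabs_pos_eq; lra.
Qed.

(** * The regularized equations and their limit *)

Section Evolution.
Context (e : expr) (L : R).
Hypotheses (hL : 0 <= L)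
  (Hlip : forall t r y z, Rabs (eval e t (cl r) y - eval e t (cl r) z) <= L * Rabs (y - z))
  (Hzero : forall r t, t <= 0 -> eval e t (cl r) 0 = 0).

(** For fixed n this is a Lipschitz vector field on a Banach space, because [Res n] is bounded. Its
    constant L + 2 / eps n is not uniform in n, so Picard iteration serves for existence only and
    the uniform estimates come from [evolution_bound_abs]. *)
Definition vfield n (u : R -> R -> R) : R -> R -> R := fun r t => Fe e u r t - lift (Res n) u r t.

Lemma vfield_XT n u : XT u -> XT (vfield n u).
Proof. intros hu. apply XT_minus. now apply Fe_XT. eapply lift_XT; eauto. apply Res_bop. Qed.
Lemma vfield_lip n u v B t : XT u -> XT v -> (forall x, Rabs (u x t - v x t) <= B) ->
  forall r, Rabs (vfield n u r t - vfield n v r t) <= (L + 2 / eps n) * B.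
Proof.
  intros hu hv hB r. unfold vfield.
  replace (Fe e u r t - lift (Res n) u r t - (Fe e v r t - lift (Res n) v r t))
    with ((Fe e u r t - Fe e v r t) - (lift (Res n) u r t - lift (Res n) v r t)) by ring.
  eapply Rle_trans. apply Rabs_triang. rewrite Rabs_Ropp, Rmult_plus_distr_r. apply Rplus_le_compat.
  - eapply Rle_trans. apply Hlip. apply Rmult_le_compat_l; auto.
  - unfold lift. rewrite <- (bop_minus (Res n) (2 / eps n) (fun x => u x t) (fun x => v x t) (Res_bop n) (XT_slice u t hu) (XT_slice v t hv)).
    apply (Res_bop n); auto. apply inX_minus; now apply XT_slice.
Qed.
Lemma vfield_0 n u t : t <= 0 -> XT u -> (forall r, u r t = 0) -> forall r, vfield n u r t = 0.
Proof.
  intros ht hu h0 r. unfold vfield, Fe, lift.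
  assert (a := proj2 (proj2 (proj2 (Res_bop n))) (fun x => u x t) 0 (XT_slice u t hu) ltac:(intros x; cbv beta; rewrite h0, Rabs_R0; lra) r).
  rewrite Rmult_0_r in a. apply Rabs_le_between in a. rewrite h0, Hzero by auto. lra.
Qed.

Definition picard n i : R -> R -> R := Nat.iter i (fun u => Int (vfield n u)) (fun _ _ => 0).
Lemma picard_XT n i : XT (picard n i).
Proof. induction i as [|i IH]; simpl. apply XT_const. apply Int_XT. now apply vfield_XT. Qed.
Lemma picard_zero n i r t : t <= 0 -> picard n i r t = 0.
Proof.
  revert r t. induction i as [|i IH]; intros r t ht; simpl; auto. unfold Int.
  rewrite (RInt_ext _ (fun _ => 0)). rewrite RInt_const. unfold scal; simpl; unfold mult; simpl. ring.
  intros s hs. rewrite Rmax_left in hs by lra. apply vfield_0. lra. apply picard_XT. intros; apply IH. lra.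
Qed.

(** In the norm weighted by exp (- 2 L1 t) the Picard map contracts by 1/2 on all of [0, T], so a
    single iteration reaches every T. *)
Lemma picard_step n T : 0 <= T -> exists C, 0 <= C /\
  forall i r t, t <= T -> Rabs (picard n (S i) r t - picard n i r t) <= C * (/2) ^ i.
Proof.
  intros hT. set (L1 := L + 2 / eps n).
  assert (hL1 : 0 < L1). { unfold L1. assert (0 < 2 / eps n) by (apply Rdiv_lt_0_compat; [lra|apply eps_pos]). lra. }
  destruct (XT_bounded (vfield n (picard n 0)) T (vfield_XT _ _ (picard_XT n 0))) as [B [hB0 hB]].
  assert (D : forall i r t, 0 <= t <= T -> Rabs (picard n (S i) r t - picard n i r t) <= B * T * (/2) ^ i * exp (2 * L1 * t)).
  { intros i. induction i as [|i IH]; intros r t ht.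
    - simpl. unfold Int. rewrite Rminus_0_r, Rmult_1_r.
      eapply Rle_trans. apply (RInt_dominated (vfield n (fun _ _ => 0) r) (fun t => B * t) (fun _ => B)); try lra.
      + apply (XT_slice_t _ r). apply vfield_XT, XT_const.
      + intros s. cc.
      + intros s. eapply is_derive_val. apply (is_derive_scal' (fun y => y)). apply is_derive_i. ring.
      + intros s hs. apply hB. rewrite Rabs_pos_eq; lra.
      + assert (1 <= exp (2 * L1 * t)).
        { assert (a := exp_ineq1_le (2 * L1 * t)). assert (0 <= L1 * t) by (apply Rmult_le_pos; lra). lra. }
        assert (B * t <= B * T) by nra. assert (0 <= B * T) by nra. nra.
    - change (picard n (S (S i)) r t) with (Int (vfield n (picard n (S i))) r t).
      change (picard n (S i) r t) with (Int (vfield n (picard n i)) r t) at 1. unfold Int.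
      set (u := picard n (S i)) in *. set (v := picard n i) in *.
      assert (hu : XT (vfield n u)) by apply vfield_XT, picard_XT. assert (hv : XT (vfield n v)) by apply vfield_XT, picard_XT.
      replace (RInt (vfield n u r) 0 t - RInt (vfield n v r) 0 t) with (RInt (fun s => vfield n u r s - vfield n v r s) 0 t).
      2: { apply (RInt_minus (V := R_CompleteNormedModule)); apply ex_RInt_contT; now apply (XT_slice_t _ r). }
      set (c := B * T * (/2)^i) in *.
      assert (hc : 0 <= c). { unfold c. apply Rmult_le_pos. nra. apply pow_le. lra. }
      eapply Rle_trans. apply (RInt_dominated _ (fun t => c / 2 * exp (2 * L1 * t)) (fun t => L1 * (c * exp (2 * L1 * t)))); try lra.
      + intros s. apply cont_minus; now apply (XT_slice_t _ r).
      + intros s. cc.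
      + intros s. eapply is_derive_val. apply (is_derive_scal' (fun t => exp (2 * L1 * t))).
        apply (is_derive_comp' exp (fun t => 2 * L1 * t)). apply is_derive_exp. apply (is_derive_scal' (fun y => y)). apply is_derive_i. field.
      + intros s hs. apply vfield_lip; try apply picard_XT. intros x. apply IH. lra.
      + rewrite Rmult_0_r, exp_0. simpl. fold c. assert (ee := exp_pos (2 * L1 * t)). unfold c in *. nra. }
  exists (B * T * exp (2 * L1 * T)). split.
  { apply Rmult_le_pos. nra. left; apply exp_pos. }
  intros i r t ht.
  assert (hp : 0 <= (/2)^i) by (apply pow_le; lra).
  destruct (Rle_dec 0 t) as [h|h].
  - eapply Rle_trans. apply D. lra. assert (exp (2 * L1 * t) <= exp (2 * L1 * T)).
    { destruct (Req_dec t T) as [->|]. lra. left. apply exp_increasing. nra. }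
    assert (0 <= B * T * (/2)^i) by (apply Rmult_le_pos; nra). nra.
  - rewrite !picard_zero by lra. rewrite Rminus_0_r, Rabs_R0.
    apply Rmult_le_pos; auto. apply Rmult_le_pos. nra. left; apply exp_pos.
Qed.

Lemma half_pow_small C de : (forall i, de <= C * (/ 2) ^ i) -> de <= 0.
Proof.
  intros H.
  assert (Lz : is_lim_seq (fun n => C * (/2)^n) 0).
  { replace (Finite 0) with (Rbar_mult C 0) by (simpl; f_equal; ring).
    apply is_lim_seq_scal_l. apply is_lim_seq_geom. rewrite Rabs_pos_eq; lra. }
  exact (is_lim_seq_le (fun _ => de) _ de 0 H (is_lim_seq_const de) Lz).
Qed.

Lemma approx_ex n : exists y, XT y /\ (forall r t, is_derive (y r) t (Fe e y r t - lift (Res n) y r t)) /\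
  (forall r t, t <= 0 -> y r t = 0).
Proof.
  set (u := fun i (p : R * R) => picard n i (fst p) (snd p)).
  set (y := fun r t => limf u (r, t)).
  assert (Hl : forall T, 0 <= T -> exists C, 0 <= C /\ forall i r t, t <= T -> Rabs (y r t - picard n i r t) <= C * (/2)^i).
  { intros T hT. destruct (picard_step n T hT) as [C [hC HC]]. exists (2 * C). split. lra. intros i r t ht.
    destruct (geom_cauchy (fun i => u i (r, t)) C (/2) ltac:(lra)) as [_ G]. { intros j. apply HC; auto. }
    specialize (G i). unfold y, limf. replace (2 * C * (/2)^i) with (C * (/2)^i / (1 - /2)) by field. exact G. }
  assert (yX : XT y).
  { split.
    - intros p. apply (continuous_ext (limf u)). intros [r t]; reflexivity.
      destruct (picard_step n (Rabs (snd p) + 1)) as [C [hC HC]]. generalize (Rabs_pos (snd p)); lra.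
      apply (limf_continuous u (/2) C). lra.
      + exists (mkposreal 1 Rlt_0_1). intros [r t] [_ ht] i. apply HC. change (Rabs (t - snd p) < 1) in ht. simpl.
        apply Rabs_def2 in ht. generalize (Rle_abs (snd p)). lra.
      + intros i. apply picard_XT.
    - intros r t. unfold y, limf. f_equal. apply Lim_seq_ext. intros i. unfold u. simpl. apply picard_XT. }
  assert (E : forall r t, y r t = Int (vfield n y) r t).
  { intros r t. apply Rminus_diag_uniq. destruct (Req_dec (y r t - Int (vfield n y) r t) 0) as [|hne]; auto. exfalso.
    apply Rabs_pos_lt in hne.
    destruct (Hl (Rabs t) (Rabs_pos t)) as [C [hC HC]].
    set (L1 := L + 2 / eps n).
    assert (hL1 : 0 < L1). { unfold L1. assert (0 < 2 / eps n) by (apply Rdiv_lt_0_compat; [lra|apply eps_pos]). lra. }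
    assert (Rabs (y r t - Int (vfield n y) r t) <= 0); [|lra].
    apply (half_pow_small (C + Rabs t * L1 * C)). intros i.
    assert (a := HC (S i) r t (Rle_abs t)).
    assert (b : Rabs (Int (vfield n (picard n i)) r t - Int (vfield n y) r t) <= Rabs t * L1 * C * (/2)^i).
    { unfold Int.
      assert (hu : XT (vfield n (picard n i))) by apply vfield_XT, picard_XT. assert (hv : XT (vfield n y)) by now apply vfield_XT.
      replace (RInt (vfield n (picard n i) r) 0 t - RInt (vfield n y r) 0 t) with (RInt (fun s => vfield n (picard n i) r s - vfield n y r s) 0 t).
      2: { apply (RInt_minus (V := R_CompleteNormedModule)); apply ex_RInt_contT; now apply (XT_slice_t _ r). }
      assert (cc1 : cont1 (fun s => vfield n (picard n i) r s - vfield n y r s)).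
      { intros s. apply cont_minus; now apply (XT_slice_t _ r). }
      assert (bd : forall s, s <= Rabs t -> Rabs (vfield n (picard n i) r s - vfield n y r s) <= L1 * (C * (/2)^i)).
      { intros s hs. apply vfield_lip; auto. apply picard_XT. intros x. rewrite Rabs_minus_sym. now apply HC. }
      replace (Rabs t * L1 * C * (/2)^i) with (Rabs t * (L1 * (C * (/2)^i))) by ring.
      destruct (Rle_dec 0 t).
      - rewrite (Rabs_pos_eq t) in * by lra. replace t with (t - 0) at 2 by ring. apply abs_RInt_le_const; auto.
        now apply ex_RInt_contT. intros s hs. apply bd. lra.
      - rewrite <- opp_RInt_swap by now apply ex_RInt_contT. unfold opp; simpl. rewrite Rabs_Ropp.
        rewrite (Rabs_left t) in * by lra. replace (- t) with (0 - t) by ring. apply abs_RInt_le_const. lra.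
        now apply ex_RInt_contT. intros s hs. apply bd. lra. }
    change (picard n (S i) r t) with (Int (vfield n (picard n i)) r t) in a.
    replace (y r t - Int (vfield n y) r t) with ((y r t - Int (vfield n (picard n i)) r t) + (Int (vfield n (picard n i)) r t - Int (vfield n y) r t)) by ring.
    eapply Rle_trans. apply Rabs_triang. simpl in a. assert (0 <= (/2)^i) by (apply pow_le; lra).
    assert (0 <= C * (/2)^i) by nra. lra. }
  exists y. split; [|split]; auto.
  - intros r t. apply (is_derive_ext (Int (vfield n y) r)). intros; now rewrite E.
    apply (Int_derive (vfield n y)). now apply vfield_XT.
  - intros r t ht. unfold y, limf. rewrite (Lim_seq_ext _ (fun _ => 0)). now rewrite Lim_seq_const.
    intros i. unfold u. simpl. now apply picard_zero.
Qed.

Definition ya n := proj1_sig (constructive_indefinite_description _ (approx_ex n)).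
Lemma ya_spec n : XT (ya n) /\ (forall r t, is_derive (ya n r) t (Fe e (ya n) r t - lift (Res n) (ya n) r t)) /\
  (forall r t, t <= 0 -> ya n r t = 0).
Proof. exact (proj2_sig (constructive_indefinite_description _ (approx_ex n))). Qed.

Lemma ya_smooth n k : Cx k (ya n).
Proof.
  destruct (ya_spec n) as [h1 [h2 _]]. induction k as [|k IH]. now apply Cx_0.
  apply (Cx_S _ _ (fun r t => Fe e (ya n) r t - lift (Res n) (ya n) r t)); auto. apply Cx_minus.
  - now apply Cx_Fe.
  - exact (Cx_lift _ _ _ k (Res_bop n) IH).
Qed.

Definition yk n k := dk (ya n) k.
Definition qk n k := lift (Res n) (yk n k).
(** Along y_t = F (y) - q this is the k-th time derivative of F (y): [Fk_0] for k = 0, then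
    [Fk_derive]. *)
Definition Fk n k := fun r t => yk n (S k) r t + qk n k r t.

Lemma yk_XT n k : XT (yk n k).
Proof. apply dk_XT. intros; apply ya_smooth. Qed.
Lemma qk_XT n k : XT (qk n k).
Proof. eapply lift_XT. apply Res_bop. apply yk_XT. Qed.
Lemma yk_derive n k r t : is_derive (yk n k r) t (yk n (S k) r t).
Proof. apply dk_derive. intros; apply ya_smooth. Qed.
Lemma qk_derive n k r t : is_derive (qk n k r) t (qk n (S k) r t).
Proof. eapply lift_derive. apply Res_bop. apply yk_XT. apply yk_XT. intros; apply yk_derive. Qed.
Lemma Fk_derive n k r t : is_derive (Fk n k r) t (Fk n (S k) r t).
Proof. apply is_derive_plus'. apply yk_derive. apply qk_derive. Qed.
Lemma yk_zero n k r t : t <= 0 -> yk n k r t = 0.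
Proof. apply dk_zero. intros; apply ya_smooth. intros; now apply (ya_spec n). Qed.
Lemma qk_zero n k r t : t <= 0 -> qk n k r t = 0.
Proof.
  intros ht. unfold qk, lift.
  assert (a := proj2 (proj2 (proj2 (Res_bop n))) (fun x => yk n k x t) 0 (XT_slice _ t (yk_XT n k)) ltac:(intros x; cbv beta; rewrite yk_zero, Rabs_R0; lra) r).
  rewrite Rmult_0_r in a. apply Rabs_le_between in a. lra.
Qed.
Lemma yk_qk n k r t : yk n k r t = lift K (qk n k) r t + eps n * qk n k r t.
Proof. symmetry. apply (Res_eq n (fun x => yk n k x t)). apply XT_slice, yk_XT. Qed.
Lemma Fk_0 n r t : Fk n 0 r t = Fe e (ya n) r t.
Proof.
  assert (E1 := is_derive_unique _ _ _ (yk_derive n 0 r t)).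
  assert (E2 := is_derive_unique _ _ _ (proj1 (proj2 (ya_spec n)) r t)).
  change (Derive (ya n r) t = yk n 1 r t) in E1. unfold Fk. rewrite <- E1, E2.
  change (qk n 0 r t) with (lift (Res n) (ya n) r t). ring.
Qed.
Lemma yk_class m : forall i, (forall j, (j <= i + m)%nat -> bddf (fun n => yk n j)) -> Cf m (fun n => yk n i).
Proof.
  induction m as [|m IH]; intros i H.
  - apply Cf_0. apply H. lia.
  - apply (Cf_S _ _ (fun n => yk n (S i))). apply H; lia. intros; apply yk_derive.
    apply IH. intros j hj. apply H. lia.
Qed.

(* The derivative of highest order enters linearly, the remainder w involves only bounded lower-order ones. *)
Lemma Fk_affine k : (forall j, (j <= k)%nat -> bddf (fun n => yk n j)) -> forall i, (i <= k)%nat ->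
  exists w, Cf (k - i) w /\ forall n r t, Fk n (S i) r t = eval (dy e) t (cl r) (yk n 0 r t) * yk n (S i) r t + w n r t.
Proof.
  intros Hb. assert (Y0 : Cf k (fun n => yk n 0)) by (apply yk_class; auto).
  intros i. induction i as [|i IH]; intros hi.
  - exists (fun n r t => eval (dt e) t (cl r) (yk n 0 r t)). split.
    + rewrite Nat.sub_0_r. now apply Cf_eval.
    + intros n r t. rewrite <- (is_derive_unique _ _ _ (Fk_derive n 0 r t)).
      apply is_derive_unique. apply (is_derive_ext (fun s => eval e s (cl r) (yk n 0 r s))).
      { intros s. symmetry. apply Fk_0. }
      eapply is_derive_val. apply (eval_derive e (cl r) (yk n 0 r)). apply yk_derive. ring.
  - destruct IH as [w [hw E]]. lia.
    replace (k - i)%nat with (S (k - S i)) in hw by lia.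
    destruct (Cf_D _ _ hw) as [w' [hd hw']].
    exists (fun n r t => (eval (dt (dy e)) t (cl r) (yk n 0 r t) + eval (dy (dy e)) t (cl r) (yk n 0 r t) * yk n 1 r t) * yk n (S i) r t + w' n r t).
    split.
    + apply Cf_plus; auto. apply Cf_mult.
      * apply Cf_plus. apply (Cf_le _ k). lia. now apply Cf_eval.
        apply Cf_mult. apply (Cf_le _ k). lia. now apply Cf_eval.
        apply yk_class. intros j hj. apply Hb. lia.
      * apply yk_class. intros j hj. apply Hb. lia.
    + intros n r t. rewrite <- (is_derive_unique _ _ _ (Fk_derive n (S i) r t)).
      apply is_derive_unique.
      apply (is_derive_ext (fun s => eval (dy e) s (cl r) (yk n 0 r s) * yk n (S i) r s + w n r s)).
      { intros s. symmetry. apply E. }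
      eapply is_derive_val. apply is_derive_plus'. apply is_derive_mult'.
      apply (eval_derive (dy e) (cl r) (yk n 0 r)). apply yk_derive. apply yk_derive. apply hd. cbv beta. ring.
Qed.

Lemma yk_bounded_step k : (exists b rho : R -> R, forall T n r t, 0 <= t <= T -> Rabs (Fk n k r t) <= Rabs (b T) * Rabs (yk n k r t) + Rabs (rho T)) ->
  bddf (fun n => yk n k).
Proof.
  intros [b [rho H]] T. exists (Rabs (rho T) * exp ((Rabs (b T) + 1) * T)). intros n r t ht.
  destruct (Rle_dec t 0) as [h|h].
  - rewrite yk_zero, Rabs_R0 by auto. apply Rmult_le_pos. apply Rabs_pos. left; apply exp_pos.
  - assert (htT : t <= T) by (rewrite Rabs_pos_eq in ht; lra).
    eapply Rle_trans. apply (evolution_bound_abs (eps n) (yk n k) (qk n k) (Fk n k) (Rabs (b T)) (Rabs (rho T)) T); auto using eps_pos, yk_XT, qk_XT, Rabs_pos.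
    + intros. apply yk_qk.
    + intros. eapply is_derive_val. apply yk_derive. unfold Fk. ring.
    + intros. apply yk_zero. lra.
    + lra.
    + apply Rmult_le_compat_l. apply Rabs_pos. assert (0 <= Rabs (b T)) by apply Rabs_pos.
      destruct (Req_dec t T) as [->|]. lra. left. apply exp_increasing. nra.
Qed.

Lemma bddf_choice u : bddf u -> exists M : R -> R, forall T n r t, Rabs t <= T -> Rabs (u n r t) <= M T.
Proof.
  intros H. exists (fun T => proj1_sig (constructive_indefinite_description _ (H T))).
  intros T. exact (proj2_sig (constructive_indefinite_description _ (H T))).
Qed.

(** Induction on the order: the Lipschitz bound settles k = 0, and for higher orders the
    coefficients of the affine form in [Fk_affine] are already bounded uniformly in n. Every
    derivative starts from 0 at t = 0 by [yk_zero], as the maximum principle requires. *)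
Lemma yk_bounded k : bddf (fun n => yk n k).
Proof.
  enough (forall j, (j <= k)%nat -> bddf (fun n => yk n j)) by auto.
  induction k as [|k IH]; intros j hj.
  - replace j with 0%nat by lia. apply yk_bounded_step.
    assert (B : bddf (fun _ : nat => Fe e (fun _ _ => 0))).
    { intros T. destruct (XT_bounded _ T (Fe_XT e _ (XT_const 0))) as [B [_ hB]]. exists B. auto. }
    destruct (bddf_choice _ B) as [M hM]. exists (fun _ => L), M. intros T n r t ht.
    rewrite Fk_0. assert (ht' : Rabs t <= T) by (rewrite Rabs_pos_eq; lra).
    replace (Fe e (ya n) r t) with ((Fe e (ya n) r t - Fe e (fun _ _ => 0) r t) + Fe e (fun _ _ => 0) r t) by ring.
    eapply Rle_trans. apply Rabs_triang. apply Rplus_le_compat.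
    + rewrite (Rabs_pos_eq L) by auto. unfold Fe. eapply Rle_trans. apply Hlip.
      rewrite Rminus_0_r. apply Rle_refl.
    + eapply Rle_trans. now apply (hM T 0%nat). apply Rle_abs.
  - destruct (Nat.eq_dec j (S k)) as [->|]; [|apply IH; lia]. apply yk_bounded_step.
    destruct (Fk_affine k IH k (Nat.le_refl k)) as [w [hw E]].
    destruct (bddf_choice _ (Cf_bdd _ _ hw)) as [rho hrho].
    assert (hb : bddf (fun n r t => eval (dy e) t (cl r) (yk n 0 r t))).
    { apply (Cf_bdd 0). apply Cf_eval. apply Cf_0. apply IH. lia. }
    destruct (bddf_choice _ hb) as [b hb']. exists b, rho. intros T n r t ht. rewrite E.
    assert (ht' : Rabs t <= T) by (rewrite Rabs_pos_eq; lra).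
    eapply Rle_trans. apply Rabs_triang. apply Rplus_le_compat.
    + rewrite Rabs_mult. apply Rmult_le_compat_r. apply Rabs_pos. eapply Rle_trans. now apply (hb' T). apply Rle_abs.
    + eapply Rle_trans. now apply (hrho T). apply Rle_abs.
Qed.

(** The norm bound of [Res n] grows with n; instead the equation expresses the quantity as [Fk n k]
    minus [yk n (S k)], both of which are bounded. *)
Lemma qk_bounded k : bddf (fun n => qk n k).
Proof.
  assert (E : forall n r t, qk n k r t = Fk n k r t - yk n (S k) r t) by (intros; unfold Fk; ring).
  assert (HF : bddf (fun n => Fk n k)).
  { destruct k as [|k].
    - intros T. destruct (Cf_bdd 0 _ (Cf_eval e 0 _ (Cf_0 _ (yk_bounded 0))) T) as [M hM]. exists M. intros. rewrite Fk_0. now apply hM.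
    - destruct (Fk_affine k (fun j _ => yk_bounded j) k (Nat.le_refl k)) as [w [hw E']].
      assert (hb : Cf 0 (fun n r t => eval (dy e) t (cl r) (yk n 0 r t) * yk n (S k) r t + w n r t)).
      { apply Cf_plus. apply Cf_mult. apply Cf_eval. apply Cf_0, yk_bounded. apply Cf_0, yk_bounded. apply (Cf_le _ (k - k)); auto. lia. }
      intros T. destruct (Cf_bdd _ _ hb T) as [M hM]. exists M. intros. rewrite E'. now apply hM. }
  intros T. destruct (HF T) as [a ha], (yk_bounded (S k) T) as [b hb]. exists (a + b). intros n r t ht. rewrite E.
  unfold Rminus. eapply Rle_trans. apply Rabs_triang. rewrite Rabs_Ropp. apply Rplus_le_compat; auto.
Qed.

(* The difference y_(n+1) - y_n, corrected by (eps (n+1) - eps n) q_n, equals (K + eps (n+1)) (q_(n+1) - q_n):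
   this puts it in the form required by the maximum principle. *)
Lemma ya_cauchy T : 0 <= T -> exists C, 0 <= C /\ forall n r t, Rabs t <= T -> Rabs (yk (S n) 0 r t - yk n 0 r t) <= C * (3/4) ^ n.
Proof.
  intros hT. destruct (qk_bounded 0 T) as [M0 h0], (qk_bounded 1 T) as [M1 h1].
  assert (M0p : 0 <= M0) by (eapply Rle_trans; [apply Rabs_pos|apply (h0 0%nat 0 0); rewrite Rabs_R0; lra]).
  assert (M1p : 0 <= M1) by (eapply Rle_trans; [apply Rabs_pos|apply (h1 0%nat 0 0); rewrite Rabs_R0; lra]).
  assert (eT := exp_pos ((L + 1) * T)).
  (* Here L M0 comes from the Lipschitz bound through the correction term, M1 from the time
     derivative of the correction, and the last M0 from removing the correction at the end. *)
  exists ((L * M0 + M1) * exp ((L + 1) * T) + M0). split. { apply Rplus_le_le_0_compat; auto. apply Rmult_le_pos; nra. }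
  intros n r t ht. assert (hp : 0 <= (3/4)^n) by (apply pow_le; lra).
  destruct (Rle_dec t 0) as [hs|hs].
  { rewrite !yk_zero by auto. rewrite Rminus_0_r, Rabs_R0. apply Rmult_le_pos; auto.
    apply Rplus_le_le_0_compat; auto. apply Rmult_le_pos; nra. }
  set (de := eps (S n) - eps n).
  assert (hde : Rabs de = (3/4)^n).
  { unfold de, eps. simpl. replace (4 * (3/4 * (3/4)^n) - 4 * (3/4)^n) with (- (3/4)^n) by field. rewrite Rabs_Ropp. now apply Rabs_pos_eq. }
  rewrite Rabs_pos_eq in ht by lra.
  assert (B : Rabs (yk (S n) 0 r t - yk n 0 r t - de * qk n 0 r t) <= ((3/4)^n * (L * M0 + M1)) * exp ((L + 1) * t)).
  { apply (evolution_bound_abs (eps (S n)) (fun r t => yk (S n) 0 r t - yk n 0 r t - de * qk n 0 r t)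
      (fun r t => qk (S n) 0 r t - qk n 0 r t) (fun r t => Fk (S n) 0 r t - Fk n 0 r t - de * qk n 1 r t) L ((3/4)^n * (L * M0 + M1)) T); auto using eps_pos.
    - apply XT_minus. apply XT_minus; apply yk_XT. apply XT_scal. apply qk_XT.
    - apply XT_minus; apply qk_XT.
    - intros x s. unfold lift.
      rewrite (bop_minus K 1 (fun x => qk (S n) 0 x s) (fun x => qk n 0 x s) K_bop (XT_slice _ s (qk_XT (S n) 0)) (XT_slice _ s (qk_XT n 0)) x).
      rewrite (yk_qk (S n)), (yk_qk n). unfold lift, de. ring.
    - intros x s. eapply is_derive_val. apply is_derive_minus'. apply is_derive_minus'; apply yk_derive.
      apply is_derive_scal'. apply qk_derive. unfold Fk. ring.
    - apply Rmult_le_pos; auto. nra.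
    - intros x s hs'. rewrite !Fk_0. assert (hs2 : Rabs s <= T) by (rewrite Rabs_pos_eq; lra).
      assert (a := h0 n x s hs2). assert (b := h1 n x s hs2).
      assert (c : Rabs (Fe e (ya (S n)) x s - Fe e (ya n) x s) <= L * Rabs (ya (S n) x s - ya n x s)) by apply Hlip.
      assert (d : Rabs (ya (S n) x s - ya n x s) <= Rabs (yk (S n) 0 x s - yk n 0 x s - de * qk n 0 x s) + (3/4)^n * M0).
      { replace (ya (S n) x s - ya n x s) with ((yk (S n) 0 x s - yk n 0 x s - de * qk n 0 x s) + de * qk n 0 x s) by (unfold yk, dk; simpl; ring).
        eapply Rle_trans. apply Rabs_triang. apply Rplus_le_compat_l. rewrite Rabs_mult, hde. now apply Rmult_le_compat_l. }
      unfold Rminus at 1. eapply Rle_trans. apply Rabs_triang. rewrite Rabs_Ropp, Rabs_mult, hde.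
      assert ((3/4)^n * Rabs (qk n 1 x s) <= (3/4)^n * M1) by now apply Rmult_le_compat_l.
      assert (L * Rabs (ya (S n) x s - ya n x s) <= L * (Rabs (yk (S n) 0 x s - yk n 0 x s - de * qk n 0 x s) + (3/4)^n * M0)) by now apply Rmult_le_compat_l.
      lra.
    - intros x. rewrite !yk_zero, qk_zero by lra. ring.
    - lra. }
  replace (yk (S n) 0 r t - yk n 0 r t) with ((yk (S n) 0 r t - yk n 0 r t - de * qk n 0 r t) + de * qk n 0 r t) by ring.
  eapply Rle_trans. apply Rabs_triang. rewrite Rmult_plus_distr_r. apply Rplus_le_compat.
  - eapply Rle_trans. exact B. 
    assert (exp ((L + 1) * t) <= exp ((L + 1) * T)).
    { destruct (Req_dec t T) as [->|]. lra. left. apply exp_increasing. nra. }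
    assert (0 <= (3/4)^n * (L * M0 + M1)) by (apply Rmult_le_pos; nra). nra.
  - rewrite Rabs_mult, hde, Rmult_comm. apply Rmult_le_compat_r; auto. apply h0. rewrite Rabs_pos_eq; lra.
Qed.

(** [interpolation] between the order k and the bounded order k + 2, with step h = sqrt q ^ n,
    balances q ^ n / h against h. Each derivative costs a square root of the rate, which stays below
    1. *)
Lemma yk_cauchy k : exists q, 0 < q < 1 /\ forall T, 0 <= T -> exists C, 0 <= C /\
  forall n r t, Rabs t <= T -> Rabs (yk (S n) k r t - yk n k r t) <= C * q ^ n.
Proof.
  induction k as [|k [q [hq IH]]].
  - exists (3/4). split. lra. exact ya_cauchy.
  - assert (s0 : 0 < sqrt q) by (apply sqrt_lt_R0; lra).
    assert (ss : sqrt q * sqrt q = q) by (apply sqrt_sqrt; lra).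
    assert (s1 : sqrt q < 1). { destruct (Rlt_dec (sqrt q) 1); auto. assert (1 <= sqrt q * sqrt q) by nra. lra. }
    (* The interpolation looks ahead by a step of at most 1, so the bounds are taken up to T + 1. *)
    exists (sqrt q). split. auto. intros T hT. destruct (IH (T + 1)) as [C [hC HC]]. lra.
    destruct (yk_bounded (S (S k)) (T + 1)) as [M hM].
    assert (M0p : 0 <= M) by (eapply Rle_trans; [apply Rabs_pos|apply (hM 0%nat 0 0); rewrite Rabs_R0; lra]).
    exists (2 * C + 2 * M). split. lra. intros n r t ht.
    set (hh := sqrt q ^ n).
    assert (hh0 : 0 < hh) by (apply pow_lt; lra).
    assert (hh1 : hh <= 1). { unfold hh. rewrite <- (pow1 n). apply pow_incr. lra. }
    assert (E : q ^ n = hh * hh). { unfold hh. rewrite <- Rpow_mult_distr. now rewrite ss. }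
    apply Rabs_le_between in ht.
    replace ((2 * C + 2 * M) * hh) with (2 * (C * (hh * hh)) / hh + (2 * M) * hh) by (field; lra).
    apply (interpolation (fun s => yk (S n) k r s - yk n k r s) (fun s => yk (S n) (S k) r s - yk n (S k) r s)
       (fun s => yk (S n) (S (S k)) r s - yk n (S (S k)) r s)); auto.
    + intros s. apply is_derive_minus'; apply yk_derive.
    + intros s. apply is_derive_minus'; apply yk_derive.
    + intros s hs. rewrite <- E. apply HC. apply Rabs_le. lra.
    + intros s hs. unfold Rminus. eapply Rle_trans. apply Rabs_triang. rewrite Rabs_Ropp.
      assert (hsT : Rabs s <= T + 1) by (apply Rabs_le; lra).
      generalize (hM (S n) r s hsT) (hM n r s hsT). lra.
Qed.

Definition yl k : R -> R -> R := fun r t => limf (fun n (p : R * R) => yk n k (fst p) (snd p)) (r, t).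

Lemma yl_conv k : exists q, 0 < q < 1 /\ forall T, 0 <= T -> exists C, 0 <= C /\
  forall n r t, Rabs t <= T -> Rabs (yl k r t - yk n k r t) <= C * q ^ n.
Proof.
  destruct (yk_cauchy k) as [q [hq H]]. exists q. split; auto. intros T hT. destruct (H T hT) as [C [hC HC]].
  exists (C / (1 - q)). split. apply Rdiv_le_0_compat; lra. intros n r t ht.
  destruct (geom_cauchy (fun n => yk n k r t) C q ltac:(lra) (fun n => HC n r t ht)) as [_ G].
  eapply Rle_trans. apply G. right. field. lra.
Qed.

Lemma yl_XT k : XT (yl k).
Proof.
  split.
  - intros p. apply (continuous_ext (limf (fun n (p : R * R) => yk n k (fst p) (snd p)))). intros [r t]; reflexivity.
    destruct (yk_cauchy k) as [q [hq H]]. destruct (H (Rabs (snd p) + 1)) as [C [hC HC]]. generalize (Rabs_pos (snd p)); lra.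
    apply (limf_continuous _ q C). lra.
    + exists (mkposreal 1 Rlt_0_1). intros [r t] [_ ht] i. apply HC. change (Rabs (t - snd p) < 1) in ht. simpl.
      replace t with ((t - snd p) + snd p) by ring. eapply Rle_trans. apply Rabs_triang. lra.
    + intros i. apply yk_XT.
  - intros r t. unfold yl, limf. f_equal. apply Lim_seq_ext. intros i. simpl. apply yk_XT.
Qed.

Lemma yl_derive k r t : is_derive (yl k r) t (yl (S k) r t).
Proof.
  destruct (yl_conv k) as [q [hq H]], (yl_conv (S k)) as [q' [hq' H']].
  assert (hT : 0 <= Rabs t + 1) by (generalize (Rabs_pos t); lra).
  destruct (H _ hT) as [C [hC HC]], (H' _ hT) as [C' [hC' HC']].
  assert (near : forall s, Rabs (s - t) < 1 -> Rabs s <= Rabs t + 1).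
  { intros s hs. replace s with ((s - t) + t) by ring. eapply Rle_trans. apply Rabs_triang. lra. }
  apply (is_derive_lim (fun n => yk n k r) (fun n => yk n (S k) r) (yl k r) (yl (S k) r) t 1). lra.
  - intros; apply yk_derive.
  - intros s hs. apply (is_lim_seq_ext (fun n => yl k r s - (yl k r s - yk n k r s))). intros; ring.
    replace (Finite (yl k r s)) with (Finite (yl k r s - 0)) by (f_equal; ring).
    apply is_lim_seq_minus'. apply is_lim_seq_const. apply is_lim_seq_abs_0.
    apply (is_lim_seq_le_le (fun _ => 0) _ (fun n => C * q ^ n)).
    + intros n. split. apply Rabs_pos. apply HC. now apply near.
    + apply is_lim_seq_const.
    + apply geom_lim0. lra.
  - intros ep hep. assert (G := geom_lim0 C' q' ltac:(lra)). apply is_lim_seq_spec in G.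
    destruct (G (mkposreal ep hep)) as [N HN]. exists N. intros n hn s hs.
    specialize (HN n hn). simpl in HN. rewrite Rminus_0_r in HN.
    rewrite Rabs_minus_sym. eapply Rle_trans. apply HC'. now apply near. generalize (Rle_abs (C' * q' ^ n)). lra.
  - apply (XT_slice_t _ r (yl_XT (S k))).
Qed.

Lemma yl_zero r t : t <= 0 -> yl 0 r t = 0.
Proof.
  intros ht. unfold yl, limf. rewrite (Lim_seq_ext _ (fun _ => 0)). now rewrite Lim_seq_const.
  intros n. simpl. now apply yk_zero.
Qed.

(** The limit is taken in y = K q + eps q after replacing q inside K by F (y) - y_t, whose two terms
    converge uniformly in r; the term eps n q vanishes because q is bounded. *)
Lemma yl_eq r t : yl 0 r t = lift K (fun r t => Fe e (yl 0) r t - yl 1 r t) r t.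
Proof.
  destruct (yl_conv 0) as [q [hq H]], (yl_conv 1) as [q' [hq' H']].
  destruct (H _ (Rabs_pos t)) as [C [hC HC]], (H' _ (Rabs_pos t)) as [C' [hC' HC']].
  destruct (qk_bounded 0 (Rabs t)) as [M hM].
  set (Q := fun r t => Fe e (yl 0) r t - yl 1 r t).
  assert (hQ : XT Q). { apply XT_minus. apply Fe_XT, yl_XT. apply yl_XT. }
  assert (B : forall n, Rabs (yl 0 r t - lift K Q r t) <= C * q ^ n + (L * C * q ^ n + C' * q' ^ n) + 4 * M * (3/4) ^ n).
  { intros n.
    assert (D : forall x, Rabs (qk n 0 x t - Q x t) <= L * C * q ^ n + C' * q' ^ n).
    { intros x. replace (qk n 0 x t) with (Fk n 0 x t - yk n 1 x t) by (unfold Fk; ring). rewrite Fk_0. unfold Q.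
      replace (Fe e (ya n) x t - yk n 1 x t - (Fe e (yl 0) x t - yl 1 x t)) with
        ((Fe e (ya n) x t - Fe e (yl 0) x t) + (yl 1 x t - yk n 1 x t)) by ring.
      eapply Rle_trans. apply Rabs_triang. apply Rplus_le_compat; [|apply HC'; lra].
      eapply Rle_trans. apply Hlip. rewrite Rmult_assoc. apply Rmult_le_compat_l; auto.
      rewrite Rabs_minus_sym. apply (HC n x t). lra. }
    assert (D2 := proj2 (proj2 (proj2 K_bop)) _ _ (inX_minus _ _ (XT_slice _ t (qk_XT n 0)) (XT_slice _ t hQ)) D r).
    assert (Eb := bop_minus K 1 (fun x => qk n 0 x t) (fun x => Q x t) K_bop (XT_slice _ t (qk_XT n 0)) (XT_slice _ t hQ) r).
    cbv beta in D2, Eb. rewrite Eb in D2.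
    assert (E := yk_qk n 0 r t). unfold lift in E |- *.
    replace (yl 0 r t - K (fun x => Q x t) r) with ((yl 0 r t - yk n 0 r t) + (K (fun x => qk n 0 x t) r - K (fun x => Q x t) r) + eps n * qk n 0 r t)
      by (rewrite E; ring).
    eapply Rle_trans. apply Rabs_triang. apply Rplus_le_compat.
    - eapply Rle_trans. apply Rabs_triang. apply Rplus_le_compat. apply HC; lra. lra.
    - rewrite Rabs_mult. rewrite Rabs_pos_eq by (left; apply eps_pos). unfold eps.
      assert (a := hM n r t (Rle_refl _)). assert (0 <= (3/4)^n) by (apply pow_le; lra). nra. }
  assert (Z : is_lim_seq (fun n => C * q ^ n + (L * C * q ^ n + C' * q' ^ n) + 4 * M * (3/4) ^ n) 0).
  { replace (Finite 0) with (Finite (0 + (0 + 0) + 0)) by (f_equal; ring).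
    apply is_lim_seq_plus'. apply is_lim_seq_plus'. apply geom_lim0; lra. apply is_lim_seq_plus'; apply geom_lim0; lra. apply geom_lim0; lra. }
  assert (F := is_lim_seq_le _ _ (Rabs (yl 0 r t - lift K Q r t)) 0 B (is_lim_seq_const _) Z). simpl in F.
  apply Rminus_diag_uniq. assert (hp := Rabs_pos (yl 0 r t - lift K Q r t)).
  destruct (Req_dec (yl 0 r t - lift K Q r t) 0) as [|hn]; auto. apply Rabs_pos_lt in hn. lra.
Qed.

Lemma evolution_ex : exists Y : nat -> R -> R -> R, (forall k, XT (Y k)) /\
  (forall k r t, is_derive (Y k r) t (Y (S k) r t)) /\ (forall r t, t <= 0 -> Y 0%nat r t = 0) /\
  (forall r t, Y 0%nat r t = lift K (fun r t => Fe e (Y 0%nat) r t - Y 1%nat r t) r t).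
Proof.
  exists yl. split; [exact yl_XT|split; [exact yl_derive|split]].
  intros; now apply yl_zero. exact yl_eq.
Qed.
End Evolution.

(** * Spatial regularity *)

Notation cl1 := (clamp (-1) 1).
(** Regularity on the closed strip |r| <= 1. Composition with the clamp expresses continuity up to
    the sides; one-sided r-derivatives at the sides are avoided, as [D1c] speaks of the interior
    only and the derivative itself is then asked to extend continuously. *)
Definition P0c (f : R * R -> R) := forall p : R * R, continuous (fun p : R * R => f (cl1 (fst p), snd p)) p.
Definition D1c (f g : R * R -> R) := forall r t, -1 < r < 1 -> is_derive (fun x => f (x, t)) r (g (r, t)).
Definition D2c (f g : R * R -> R) := forall r t, -1 <= r <= 1 -> is_derive (fun s => f (r, s)) t (g (r, t)).
Lemma base_P0c : base P0c.
Proof.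
  split; unfold P0c; intros.
  - apply continuous_const.
  - now apply cont_plus.
  - now apply cont_mult.
  - apply (cont_comp (fun p => f (cl1 (fst p), snd p))); auto. apply sf_continuous.
Qed.
Lemma derivation_D1c : derivation D1c.
Proof.
  split; unfold D1c; intros.
  - apply is_derive_c.
  - apply is_derive_plus'; auto.
  - apply is_derive_mult'; auto.
  - apply (is_derive_comp' (sf H 0)). apply sfP. auto.
Qed.
Lemma derivation_D2c : derivation D2c.
Proof.
  split; unfold D2c; intros.
  - apply is_derive_c.
  - apply is_derive_plus'; auto.
  - apply is_derive_mult'; auto.
  - apply (is_derive_comp' (sf H 0)). apply sfP. auto.
Qed.
Definition Cc j k (u : R -> R -> R) := Cl P0c D1c D2c j k (fun p => u (fst p) (snd p)).

Lemma Cc_ext j k u v : (forall r t, -1 <= r <= 1 -> u r t = v r t) -> Cc j k u -> Cc j k v.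
Proof.
  intros E hu. apply Cl_eq in hu. destruct hu as [h0 [h1 h2]]. apply Cl_eq. split; [|split].
  - intros p. apply (continuous_ext (fun p : R * R => u (cl1 (fst p)) (snd p))).
    intros [r t]. simpl. apply E. apply clamp_range. lra. apply h0.
  - intros j' ->. destruct (h1 _ eq_refl) as [g [hg hg']]. exists g. split; auto. intros r t hr.
    apply (is_derive_ext_loc (fun x => u x t)); [|apply hg; auto].
    exists (mkposreal (Rmin (1 - r) (r + 1)) ltac:(apply Rmin_pos; lra)). intros y hy.
    change (Rabs (y - r) < Rmin (1 - r) (r + 1)) in hy. simpl.
    assert (a := Rlt_le_trans _ _ _ hy (Rmin_l _ _)). assert (b := Rlt_le_trans _ _ _ hy (Rmin_r _ _)).
    apply Rabs_def2 in a. apply Rabs_def2 in b. apply E. lra.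
  - intros k' ->. destruct (h2 _ eq_refl) as [g [hg hg']]. exists g. split; auto. intros r t hr.
    apply (is_derive_ext (fun s => u r s)); [|apply hg; auto]. intros s. simpl. apply E. auto.
Qed.

Lemma Cc_D j u v : (forall k, Cc j k u) -> (forall r t, -1 <= r <= 1 -> is_derive (u r) t (v r t)) -> forall k, Cc j k v.
Proof.
  intros H hd k. destruct (Cl_D2 _ _ _ _ _ _ (H (S k))) as [g [h1 h2]].
  apply (Cc_ext _ _ (fun r t => g (r, t))).
  - intros r t hr. rewrite <- (is_derive_unique _ _ _ (hd r t hr)). symmetry. apply is_derive_unique. exact (h1 r t hr).
  - unfold Cc. replace (fun p => g (fst p, snd p)) with g; auto. apply functional_extensionality. now intros [a b].
Qed.
Lemma Cc_minus j k u v : Cc j k u -> Cc j k v -> Cc j k (fun r t => u r t - v r t).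
Proof. exact (Cl_minus P0c D1c D2c base_P0c derivation_D1c derivation_D2c j k _ _). Qed.
Lemma Cc_mult j k u v : Cc j k u -> Cc j k v -> Cc j k (fun r t => u r t * v r t).
Proof. exact (Cl_mult P0c D1c D2c base_P0c derivation_D1c derivation_D2c j k _ _). Qed.
Lemma Cc_const j k c : Cc j k (fun _ _ => c).
Proof. exact (Cl_const P0c D1c D2c base_P0c derivation_D1c derivation_D2c j k c). Qed.
Lemma Cc_r j k : Cc j k (fun r _ => r).
Proof.
  revert j. induction k as [|k IH]; intros j.
  - destruct j; apply Cl_eq; (split; [intros p; apply (cont_comp fst); [apply continuous_fst|apply continuous_clamp]|split]); try discriminate.
    intros j' [= <-]. exists (fun _ => 1). split. intros r t hr. exact (is_derive_i r). exact (Cc_const j 0 1).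
  - apply Cl_eq; (split; [intros p; apply (cont_comp fst); [apply continuous_fst|apply continuous_clamp]|split]).
    + intros j' ->. exists (fun _ => 1). split. intros r t hr. exact (is_derive_i r). exact (Cc_const j' (S k) 1).
    + intros k' [= <-]. exists (fun _ => 0). split. intros r t hr. exact (is_derive_c r t). exact (Cc_const j k 0).
Qed.
Lemma Cc_t j k : Cc j k (fun _ t => t).
Proof.
  revert k. induction j as [|j IH]; intros k; apply Cl_eq; (split; [intros p; simpl; apply continuous_snd|split]); try discriminate.
  - intros k' ->. exists (fun _ => 1). split. intros r t hr. exact (is_derive_i t). exact (Cc_const 0 k' 1).
  - intros j' [= <-]. exists (fun _ => 0). split. intros r t hr. exact (is_derive_c t r). exact (Cc_const j k 0).
  - intros k' ->. exists (fun _ => 1). split. intros r t hr. exact (is_derive_i t). exact (Cc_const (S j) k' 1).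
Qed.
Lemma Cc_eval e j k u : Cc j k u -> Cc j k (fun r t => eval e t r (u r t)).
Proof.
  intros hu. exact (eval_class P0c D1c D2c base_P0c derivation_D1c derivation_D2c j k e
    (fun p => snd p) (fun p => fst p) (fun p => u (fst p) (snd p)) (Cc_t j k) (Cc_r j k) hu).
Qed.

Lemma XT_P0c u : XT u -> P0c (fun p => u (fst p) (snd p)).
Proof.
  intros hu p. apply (continuous_comp2 u (fun p : R * R => cl1 (fst p)) snd). apply hu.
  apply (cont_comp fst). apply continuous_fst. apply continuous_clamp. apply continuous_snd.
Qed.
Lemma Cx_Cc k u : Cx k u -> Cc 0 k u.
Proof.
  revert u. induction k as [|k IH]; intros u hu; assert (hx := Cx_XT _ _ hu); apply Cl_eq;
    (split; [now apply XT_P0c|split]); try discriminate.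
  intros k' [= <-]. destruct (Cx_D _ _ hu) as [v [h1 h2]].
  exists (fun p => v (fst p) (snd p)). split. intros r t _. apply h1. now apply IH.
Qed.

Lemma P0c_interior f r t : P0c f -> -1 < r < 1 -> continuous f (r, t).
Proof.
  intros hf hr. apply (continuous_ext_loc _ (fun p : R * R => f (cl1 (fst p), snd p))); [|apply hf].
  exists (mkposreal (Rmin (1 - r) (r + 1)) ltac:(apply Rmin_pos; lra)). intros [y s] [hy _].
  change (Rabs (y - r) < Rmin (1 - r) (r + 1)) in hy. simpl.
  assert (a := Rlt_le_trans _ _ _ hy (Rmin_l _ _)). assert (b := Rlt_le_trans _ _ _ hy (Rmin_r _ _)).
  apply Rabs_def2 in a. apply Rabs_def2 in b. rewrite clamp_id; auto. lra.
Qed.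

Definition Ap p (w : R -> R -> R) : R -> R -> R := fun r t => A p (fun x => w x t) r.

Lemma mult_unit_range r s : -1 <= r <= 1 -> 0 <= s <= 1 -> -1 <= r * s <= 1.
Proof. intros. split; nra. Qed.
Lemma mult_unit_range' r s : -1 < r < 1 -> 0 <= s <= 1 -> -1 < r * s < 1.
Proof. intros. split; nra. Qed.

(** Differentiating w (r s) in r yields a factor s, so the derivative of [Ap p] is [Ap (S p)] of the
    derivative, and the induction runs over all p. *)
Lemma Ap_class n : forall j k, (j + k <= n)%nat -> forall p w, Cc j k w -> Cc j k (Ap p w).
Proof.
  induction n as [|n IH]; intros j k hn p w hw; assert (h0 := Cl_base _ _ _ _ _ _ hw); apply Cl_eq.
  all: assert (HP : P0c (fun q => Ap p w (fst q) (snd q))) by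
   (intros q; apply (continuous_ext (fun q : R * R => RInt (fun s => s ^ p * w (cl1 (cl1 (fst q) * s)) (snd q)) 0 1));
    [intros [r t]; simpl; apply RInt_ext; intros s; rewrite Rmin_left, Rmax_right by lra; intros hs;
       rewrite (clamp_id (-1) 1 (_ * _)); [reflexivity|apply mult_unit_range; [apply clamp_range|]; lra]
    |apply (continuous_RInt_par (fun (q : R * R) s => s ^ p * w (cl1 (cl1 (fst q) * s)) (snd q))); [lra|];
     intros u s _; apply (cont_mult (fun z : (R * R) * R => snd z ^ p)); [apply cont_pow, continuous_snd|];
     apply (continuous_comp (fun z : (R * R) * R => (cl1 (fst (fst z)) * snd z, snd (fst z))) (fun z : R * R => w (cl1 (fst z)) (snd z))); [|apply h0];
     apply continuous_pair; [apply (cont_mult (fun z : (R * R) * R => cl1 (fst (fst z))));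
        [apply (cont_comp (fun z : (R * R) * R => fst (fst z))); [apply (continuous_comp fst fst); apply continuous_fst|apply continuous_clamp]|apply continuous_snd]
       |apply (continuous_comp fst snd); [apply continuous_fst|apply continuous_snd]]]).
  all: split; [exact HP|split; intros l ->]; try lia.
  - destruct (Cl_D1 _ _ _ _ _ _ hw) as [g [hg hg']].
    exists (fun q => Ap (S p) (fun r t => g (r, t)) (fst q) (snd q)). split.
    + intros r t hr. unfold Ap, A. simpl.
      apply (is_derive_RInt_par (fun r s => s ^ p * w (r * s) t) (fun r s => s * s ^ p * g (r * s, t)) r 0 1 (Rmin (1 - r) (r + 1))); try lra.
      * apply Rmin_pos; lra.
      * intros x s hx hs.
        assert (a := Rlt_le_trans _ _ _ hx (Rmin_l _ _)). assert (b := Rlt_le_trans _ _ _ hx (Rmin_r _ _)).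
        apply Rabs_def2 in a. apply Rabs_def2 in b.
        eapply is_derive_val. apply is_derive_scal'. apply (is_derive_comp' (fun x => w x t) (fun x => x * s)).
        apply (hg (x * s) t). apply mult_unit_range'; lra.
        apply is_derive_mult'. apply is_derive_i. apply is_derive_c. cbv beta. ring.
      * intros x s hx hs.
        assert (a := Rlt_le_trans _ _ _ hx (Rmin_l _ _)). assert (b := Rlt_le_trans _ _ _ hx (Rmin_r _ _)).
        apply Rabs_def2 in a. apply Rabs_def2 in b.
        apply (cont_mult (fun z : R * R => snd z ^ p)). apply cont_pow, continuous_snd.
        apply (continuous_comp (fun z : R * R => (fst z * snd z, t)) (fun z : R * R => w (fst z) (snd z))).
        apply continuous_pair. apply (cont_mult fst snd). apply continuous_fst. apply continuous_snd. apply continuous_const.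
        apply (P0c_interior (fun z : R * R => w (fst z) (snd z))); auto. simpl. apply mult_unit_range'; lra.
      * intros s hs.
        apply (cont_mult (fun z : R * R => snd z * snd z ^ p)). apply cont_mult. apply continuous_snd. apply cont_pow, continuous_snd.
        apply (continuous_comp (fun z : R * R => (fst z * snd z, t)) g).
        apply continuous_pair. apply (cont_mult fst snd). apply continuous_fst. apply continuous_snd. apply continuous_const.
        apply P0c_interior. exact (Cl_base _ _ _ _ _ _ hg'). simpl. apply mult_unit_range'; lra.
    + apply (IH l k). lia. unfold Cc. replace (fun q => g (fst q, snd q)) with g; auto. apply functional_extensionality. now intros [a b].
  - destruct (Cl_D2 _ _ _ _ _ _ hw) as [g [hg hg']]. assert (hgb := Cl_base _ _ _ _ _ _ hg').
    exists (fun q => Ap p (fun r t => g (r, t)) (fst q) (snd q)). split.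
    + intros r t hr. unfold Ap, A. simpl.
      apply (is_derive_ext (fun t => RInt (fun s => s ^ p * w (cl1 (r * s)) t) 0 1)).
      { intros x. apply RInt_ext. intros s. rewrite Rmin_left, Rmax_right by lra. intros hs. rewrite clamp_id; auto. apply mult_unit_range; lra. }
      rewrite (RInt_ext (fun s => s ^ p * g (r * s, t)) (fun s => s ^ p * g (cl1 (r * s), t))).
      2: { intros s. rewrite Rmin_left, Rmax_right by lra. intros hs. rewrite clamp_id; auto. apply mult_unit_range; lra. }
      apply (is_derive_RInt_par (fun t s => s ^ p * w (cl1 (r * s)) t) (fun t s => s ^ p * g (cl1 (r * s), t)) t 0 1 1); try lra.
      * intros x s hx hs. apply is_derive_scal'. apply (hg (cl1 (r * s)) x). apply clamp_range. lra.
      * intros x s hx hs. apply (cont_mult (fun z : R * R => snd z ^ p)). apply cont_pow, continuous_snd.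
        apply (continuous_comp (fun z : R * R => (r * snd z, fst z)) (fun z : R * R => w (cl1 (fst z)) (snd z))); [|apply h0].
        apply continuous_pair. apply cont_mult. apply continuous_const. apply continuous_snd. apply continuous_fst.
      * intros s hs. apply (cont_mult (fun z : R * R => snd z ^ p)). apply cont_pow, continuous_snd.
        apply (continuous_comp (fun z : R * R => (r * snd z, fst z)) (fun z : R * R => g (cl1 (fst z), snd z))); [|apply hgb].
        apply continuous_pair. apply cont_mult. apply continuous_const. apply continuous_snd. apply continuous_fst.
    + apply (IH j l). lia. unfold Cc. replace (fun q => g (fst q, snd q)) with g; auto. apply functional_extensionality. now intros [a b].
Qed.

(** The r-derivative of K w is - r A 3 w, which is as regular as w, so [K] gains one r-derivative.
    The sequence [W] lists successive time derivatives, and [K] commutes with them. *)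
Lemma K_class j (W : nat -> R -> R -> R) : (forall m, XT (W m)) -> (forall m r t, is_derive (W m r) t (W (S m) r t)) ->
  (forall m k, Cc j k (W m)) -> forall k m, Cc (S j) k (lift K (W m)).
Proof.
  intros hX hd hC.
  assert (S1 : forall m r t, -1 < r < 1 -> is_derive (fun x => lift K (W m) x t) r (-1 * r * Ap 3 (W m) r t)).
  { intros m r t hr. eapply is_derive_val. apply (K_derive (fun x => W m x t) r); auto. apply (XT_slice _ t (hX m)). unfold Ap. ring. }
  assert (S2 : forall m k, Cc j k (fun r t => -1 * r * Ap 3 (W m) r t)).
  { intros m k. apply (Cc_mult j k (fun r t => -1 * r)). apply (Cc_mult j k (fun _ _ => -1)). apply Cc_const. apply Cc_r.
    apply (Ap_class (j + k)); auto. }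
  intros k. induction k as [|k IH]; intros m; apply Cl_eq; (split; [apply XT_P0c; exact (lift_XT K 1 _ K_bop (hX m))|split]); try discriminate.
  - intros j' [= <-]. exists (fun p => -1 * fst p * Ap 3 (W m) (fst p) (snd p)). split.
    intros r t hr. exact (S1 m r t hr). exact (S2 m 0%nat).
  - intros j' [= <-]. exists (fun p => -1 * fst p * Ap 3 (W m) (fst p) (snd p)). split.
    intros r t hr. exact (S1 m r t hr). exact (S2 m (S k)).
  - intros k' [= <-]. exists (fun p => lift K (W (S m)) (fst p) (snd p)). split.
    + intros r t hr. exact (lift_derive K 1 (W m) (W (S m)) K_bop (hX m) (hX (S m)) (hd m) r t).
    + apply IH.
Qed.

(** All numbers of t-derivatives are carried along at once, because y_t stands on the right-hand
    side of the fixed-point equation. Evenness of the nonlinearity in r allows [cl r], which has a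
    corner at 0, to be replaced by [r] on [-1, 1]. *)
Lemma solution_class e (Y : nat -> R -> R -> R) : (forall k, XT (Y k)) ->
  (forall k r t, is_derive (Y k r) t (Y (S k) r t)) ->
  (forall r t, Y 0%nat r t = lift K (fun r t => Fe e (Y 0%nat) r t - Y 1%nat r t) r t) ->
  (forall t r y, eval e t (- r) y = eval e t r y) ->
  forall j k, Cc j k (Y 0%nat).
Proof.
  intros hX hd hK hev.
  assert (hCx : forall k m, Cx k (Y m)).
  { intros k. induction k as [|k IH]; intros m. apply Cx_0, hX. apply (Cx_S _ _ (Y (S m))); auto. }
  set (Q := fun r t => Fe e (Y 0%nat) r t - Y 1%nat r t).
  assert (hQ : forall k, Cx k Q). { intros k. apply Cx_minus; auto. now apply Cx_Fe. }
  intros j. induction j as [|j IH]; intros k.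
  - apply Cx_Cc. auto.
  - assert (C1 : forall k, Cc j k (Y 1%nat)). { apply (Cc_D j (Y 0%nat)); auto. }
    assert (CQ : forall m k, Cc j k (dk Q m)).
    { intros m. induction m as [|m IHm].
      - intros l. apply (Cc_minus j l (Fe e (Y 0%nat)) (Y 1%nat)); auto.
        apply (Cc_ext _ _ (fun r t => eval e t r (Y 0%nat r t))).
        + intros r t hr. unfold Fe. destruct (Rle_dec 0 r).
          * rewrite cl_id; auto. lra.
          * rewrite <- cl_opp, cl_id by lra. now rewrite hev.
        + apply Cc_eval. auto.
      - apply (Cc_D j (dk Q m)); auto. intros; now apply dk_derive. }
    assert (G := K_class j (dk Q) (fun m => dk_XT Q m hQ) (fun m r t => dk_derive Q m r t hQ) CQ k 0%nat).
    apply (Cc_ext _ _ _ _ (fun r t _ => eq_sym (hK r t))). exact G.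
Qed.

(** * Extension beyond r = 1 *)

(* Coefficients of the q-binomial expansion of prod_j (1 - z / 2^j), an entire function vanishing at all 2^m. *)
Fixpoint qb (k : nat) : R :=
  match k with O => 1 | S k' => - (qb k' * (/2) ^ k') / (1 - (/2) ^ (S k')) end.

Lemma half_pow k : 0 < (/2) ^ k <= 1.
Proof. split. apply pow_lt; lra. rewrite <- (pow1 k). apply pow_incr. lra. Qed.
Lemma half_pow_S k : (/2) ^ S k <= /2.
Proof. simpl. generalize (half_pow k). lra. Qed.
Lemma half_pow_2 k : (/2) ^ k * 2 ^ k = 1.
Proof. rewrite <- Rpow_mult_distr. replace (/2 * 2) with 1 by field. apply pow1. Qed.

Lemma eventually_geometric N : forall a : nat -> R, (forall k, 0 <= a k) -> (forall k, (N <= k)%nat -> a (S k) <= /2 * a k) ->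
  exists C, 0 <= C /\ forall k, a k <= C * (/2) ^ k.
Proof.
  induction N as [|N IH]; intros a ha H.
  - exists (a 0%nat). split; auto. intros k. induction k as [|k IHk]; simpl. lra. specialize (H k ltac:(lia)). nra.
  - destruct (IH (fun k => a (S k))) as [C [hC HC]]; auto. intros k hk. apply H. lia.
    exists (a 0%nat + 2 * C). split. generalize (ha 0%nat). lra. intros [|k]; simpl. generalize (ha 0%nat). lra.
    specialize (HC k). generalize (ha 0%nat) (half_pow k). nra.
Qed.

Lemma qb_ratio k : Rabs (qb (S k)) <= 2 * (/2) ^ k * Rabs (qb k).
Proof.
  simpl qb. unfold Rdiv. rewrite Rabs_mult, Rabs_Ropp, Rabs_mult.
  assert (a := half_pow k). assert (b := half_pow_S k). simpl in b. rewrite (Rabs_pos_eq ((/2)^k)) by lra.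
  assert (0 < / (1 - / 2 * (/2) ^ k) <= 2).
  { split. apply Rinv_0_lt_compat. lra. apply Rle_trans with (/ / 2). apply Rinv_le_contravar; lra. rewrite Rinv_inv; lra. }
  rewrite (Rabs_pos_eq (/ _)) by lra. generalize (Rabs_pos (qb k)). intros.
  assert (0 <= Rabs (qb k) * (/2)^k) by nra. nra.
Qed.
Lemma qb_decay m : exists C, 0 <= C /\ forall k, Rabs (qb k) * (2 ^ k) ^ m <= C * (/2) ^ k.
Proof.
  (* From k = m + 2 on, the ratio bound 2^(m + 1 - k) of consecutive terms is at most 1/2. *)
  apply (eventually_geometric (m + 2)).
  - intros k. apply Rmult_le_pos. apply Rabs_pos. apply pow_le, pow_le. lra.
  - intros k hk. assert (a := qb_ratio k).
    assert (E : (2 ^ S k) ^ m = 2 ^ m * (2 ^ k) ^ m) by (simpl; apply Rpow_mult_distr).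
    rewrite E. assert (p1 : 0 < 2 ^ m) by (apply pow_lt; lra). assert (p2 : 0 < (2 ^ k) ^ m) by (apply pow_lt, pow_lt; lra).
    assert (B : 2 * (/2) ^ k * 2 ^ m <= /2).
    { replace k with (m + 2 + (k - m - 2))%nat by lia. rewrite !pow_add.
      replace (2 * ((/2)^m * (/2)^2 * (/2)^(k-m-2)) * 2^m) with (2 * (/2)^2 * ((/2)^m * 2^m) * (/2)^(k-m-2)) by ring.
      rewrite half_pow_2. generalize (half_pow (k-m-2)). simpl. lra. }
    replace (/ 2 * (Rabs (qb k) * (2 ^ k) ^ m)) with ((/2 * Rabs (qb k)) * (2 ^ k) ^ m) by ring.
    rewrite <- Rmult_assoc. apply Rmult_le_compat_r. lra.
    apply Rle_trans with (2 * (/ 2) ^ k * Rabs (qb k) * 2 ^ m). apply Rmult_le_compat_r; lra.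
    replace (2 * (/ 2) ^ k * Rabs (qb k) * 2 ^ m) with (2 * (/ 2) ^ k * 2 ^ m * Rabs (qb k)) by ring.
    apply Rmult_le_compat_r; auto. apply Rabs_pos.
Qed.

Lemma ex_series_decay (a : nat -> R) C : (forall k, Rabs (a k) <= C * (/2) ^ k) -> ex_series a.
Proof.
  intros H. apply (ex_series_le (V := R_CompleteNormedModule) a (fun k => C * (/2)^k)). exact H.
  apply (ex_series_scal (V := R_NormedModule) C). apply ex_series_geom. rewrite Rabs_pos_eq; lra.
Qed.

Lemma qb_ex m : ex_series (fun k => qb k * (2 ^ k) ^ m).
Proof.
  destruct (qb_decay m) as [C [_ H]]. apply (ex_series_decay _ C). intros k. rewrite Rabs_mult.
  rewrite (Rabs_pos_eq ((2^k)^m)). auto. apply pow_le, pow_le. lra.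
Qed.

(** With f (z) the sum of qb k z^k, the recurrence reads f (z) = (1 - z) f (z/2). At z = 1 this
    gives f (1) = 0, and then f (2^(m+1)) is a multiple of f (2^m). *)
Lemma qb_zero m : Series (fun k => qb k * (2 ^ k) ^ m) = 0.
Proof.
  assert (E1 : forall k, qb (S k) * (1 - (/2) ^ S k) = - (qb k * (/2) ^ k)).
  { intros k. assert (b := half_pow_S k). change (qb (S k)) with (- (qb k * (/2) ^ k) / (1 - (/2) ^ (S k))).
    revert b. generalize ((/2) ^ S k) ((/2) ^ k). intros u w b. field. lra. }
  assert (S0 : ex_series (fun k => qb k * (/2)^k)).
  { destruct (qb_decay 0) as [C [hC H]]. apply (ex_series_decay _ C). intros k. specialize (H k). simpl in H.
    rewrite Rabs_mult, (Rabs_pos_eq ((/2)^k)) by (generalize (half_pow k); lra).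
    generalize (half_pow k) (Rabs_pos (qb k)). nra. }
  induction m as [|m IH].
  - rewrite Series_incr_1 by apply qb_ex.
    rewrite (Series_ext _ (fun k => qb (S k))) by (intros; simpl; ring).
    assert (X : ex_series (fun k => qb (S k))).
    { apply (ex_series_ext (fun k => qb (S k) * (2 ^ S k) ^ 0)). intros; simpl; rring.
      apply (ex_series_incr_1 (fun k => qb k * (2^k)^0)). apply qb_ex. }
    assert (Y : ex_series (fun k => qb (S k) * (/2)^S k)) by (apply (ex_series_incr_1 (fun k => qb k * (/2)^k)); auto).
    rewrite (Series_ext _ (fun k => qb (S k) * (/2)^S k + - (qb k * (/2)^k))).
    2: { intros k. rewrite <- E1. ring. }
    rewrite Series_plus; auto. 2: now apply (ex_series_opp (V := R_NormedModule)).
    rewrite Series_opp. rewrite (Series_incr_1 (fun k => qb k * (/2)^k)) by auto. simpl. ring.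
  - assert (X := qb_ex (S m)). assert (Y := qb_ex m).
    assert (X' : ex_series (fun k => qb (S k) * (2 ^ S k) ^ S m)) by (apply (ex_series_incr_1 (fun k => qb k * (2^k)^S m)); auto).
    assert (Y' : ex_series (fun k => qb (S k) * (2 ^ S k) ^ m)) by (apply (ex_series_incr_1 (fun k => qb k * (2^k)^m)); auto).
    assert (D : Series (fun k => qb (S k) * (2 ^ S k) ^ S m) - Series (fun k => qb (S k) * (2 ^ S k) ^ m) = - (2 ^ S m) * Series (fun k => qb k * (2^k)^m)).
    { rewrite <- Series_minus by auto. rewrite <- Series_scal_l. apply Series_ext. intros k.
      replace (qb (S k) * (2 ^ S k) ^ S m - qb (S k) * (2 ^ S k) ^ m) with ((2 ^ S k) ^ S m * (qb (S k) * (1 - (/2)^S k))).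
      - rewrite E1. replace ((2 ^ S k) ^ S m) with (2 ^ S m * ((2 ^ k) * (2 ^ k) ^ m)).
        + assert (H := half_pow_2 k). replace (2 ^ S m * (2 ^ k * (2 ^ k) ^ m) * - (qb k * (/ 2) ^ k)) with (- (2 ^ S m * ((2^k)^m * qb k * ((/2)^k * 2^k)))) by ring.
          rewrite H. ring.
        + change (2 ^ S k) with (2 * 2 ^ k). rewrite Rpow_mult_distr. reflexivity.
      - assert (H := half_pow_2 (S k)). change ((2 ^ S k) ^ S m) with (2 ^ S k * (2 ^ S k) ^ m).
        replace (2 ^ S k * (2 ^ S k) ^ m * (qb (S k) * (1 - (/ 2) ^ S k))) with (qb (S k) * (2 ^ S k) ^ m * (2 ^ S k - (/2)^S k * 2 ^ S k)) by ring.
        rewrite H. ring. }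
    rewrite IH in D. rewrite Series_incr_1 by auto.
    assert (G := Series_incr_1 _ Y). rewrite IH in G. simpl (2 ^ 0) in *. rewrite !pow1 in *. lra.
Qed.

(** Division by 1 + 2^k makes two consecutive moments add up to a moment of [qb], which is 0; hence
    the moments alternate in sign. *)
Definition sa0 (k : nat) : R := qb k / (1 + 2 ^ k).
Lemma sa0_le k : Rabs (sa0 k) <= Rabs (qb k).
Proof.
  unfold sa0, Rdiv. rewrite Rabs_mult. assert (0 < 2 ^ k) by (apply pow_lt; lra).
  assert (0 < / (1 + 2 ^ k) <= 1).
  { split. apply Rinv_0_lt_compat; lra. apply Rle_trans with (/ 1). apply Rinv_le_contravar; lra. rewrite Rinv_1; lra. }
  rewrite (Rabs_pos_eq (/ (1 + 2 ^ k))) by lra. generalize (Rabs_pos (qb k)). nra.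
Qed.
Lemma sa0_decay m : exists C, 0 <= C /\ forall k, Rabs (sa0 k) * (2 ^ k) ^ m <= C * (/2) ^ k.
Proof.
  destruct (qb_decay m) as [C [hC H]]. exists C. split; auto. intros k. eapply Rle_trans; [|apply H].
  apply Rmult_le_compat_r. apply pow_le, pow_le; lra. apply sa0_le.
Qed.
Lemma sa0_ex m : ex_series (fun k => sa0 k * (2 ^ k) ^ m).
Proof.
  destruct (sa0_decay m) as [C [_ H]]. apply (ex_series_decay _ C). intros k. rewrite Rabs_mult.
  rewrite (Rabs_pos_eq ((2^k)^m)). auto. apply pow_le, pow_le. lra.
Qed.
Definition sA : R := Series (fun k => sa0 k * (2 ^ k) ^ 0).
Lemma sa0_moment m : Series (fun k => sa0 k * (2 ^ k) ^ m) = (-1) ^ m * sA.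
Proof.
  induction m as [|m IH]. unfold sA. ring.
  assert (E : Series (fun k => sa0 k * (2 ^ k) ^ S m) + Series (fun k => sa0 k * (2 ^ k) ^ m) = 0).
  { rewrite <- Series_plus by apply sa0_ex. rewrite <- (qb_zero m). apply Series_ext. intros k. unfold sa0. simpl.
    assert (0 < 2 ^ k) by (apply pow_lt; lra). field. lra. }
  rewrite IH in E. change ((-1) ^ S m) with (-1 * (-1) ^ m). lra.
Qed.

(** This permits the normalization in [se]. The first three terms 1/2 - 2/3 + 4/15 add up to 1/10;
    the rest is bounded by 8/189 times the powers of 1/4, in total 32/567. *)
Lemma sA_pos : 0 < sA.
Proof.
  unfold sA. rewrite (Series_ext _ sa0) by (intros; simpl; ring).
  assert (X : ex_series sa0).
  { apply (ex_series_ext (fun k => sa0 k * (2 ^ k) ^ 0)). intros; simpl; rring. apply sa0_ex. }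
  rewrite (Series_incr_n sa0 3) by (auto; lia). simpl sum_f_R0.
  assert (B : forall k, Rabs (qb (3 + k)) <= 8 / 21 * (/4) ^ k).
  { intros k. induction k as [|k IH].
    - simpl. rewrite Rabs_left; lra.
    - rewrite Nat.add_succ_r. eapply Rle_trans. apply qb_ratio.
      assert ((/2) ^ (3 + k) <= /8). { rewrite pow_add. generalize (half_pow k). simpl. lra. }
      assert (0 < (/2) ^ (3 + k)) by (apply pow_lt; lra). generalize (Rabs_pos (qb (3+k))). simpl ((/4) ^ S k). nra. }
  assert (B' : forall k, Rabs (sa0 (3 + k)) <= 8 / 189 * (/4) ^ k).
  { intros k. unfold sa0, Rdiv. rewrite Rabs_mult.
    assert (1 <= 2 ^ k) by (apply pow_R1_Rle; lra).
    assert (E : 2 ^ (3 + k) = 8 * 2 ^ k) by (rewrite pow_add; simpl; ring). rewrite E.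
    assert (0 < / (1 + 8 * 2 ^ k) <= / 9). { split. apply Rinv_0_lt_compat; lra. apply Rinv_le_contravar; lra. }
    rewrite (Rabs_pos_eq (/ _)) by lra. specialize (B k). generalize (Rabs_pos (qb (3 + k))). nra. }
  assert (G : ex_series (fun k => 8 / 189 * (/4)^k)).
  { apply (ex_series_scal (V := R_NormedModule) (8/189)). apply ex_series_geom. rewrite Rabs_pos_eq; lra. }
  assert (T : Rabs (Series (fun k => sa0 (3 + k))) <= 8 / 189 * (4 / 3)).
  { eapply Rle_trans. apply Series_Rabs.
    - apply (ex_series_le (V := R_CompleteNormedModule) (fun k => Rabs (sa0 (3+k))) (fun k => 8 / 189 * (/4)^k)); auto.
      intros k. unfold norm; simpl. unfold abs; simpl. rewrite Rabs_Rabsolu. apply B'.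
    - replace (8 / 189 * (4/3)) with (Series (fun k => 8 / 189 * (/4)^k)).
      + apply Series_le; auto. intros k. split. apply Rabs_pos. apply B'.
      + rewrite Series_scal_l, Series_geom by (rewrite Rabs_pos_eq; lra). field. }
  apply Rabs_le_between in T.
  assert (V : sa0 0 + sa0 1 + sa0 2 = 1 / 10) by (unfold sa0; simpl; field).
  lra.
Qed.

(** Seeley's weights: all moments at the nodes - 2^k equal 1 ([se_moment]), so the sum of se k f (-
    2^k x) matches every derivative of f at 0, and [se_decay] keeps the series convergent after any
    number of differentiations. *)
Definition se (k : nat) : R := sa0 k / sA.
Lemma se_decay m : exists C, 0 <= C /\ forall k, Rabs (se k * (- 2 ^ k) ^ m) <= C * (/2) ^ k.
Proof.
  destruct (sa0_decay m) as [C [hC H]]. assert (a := sA_pos). exists (C / sA). split. now apply Rdiv_le_0_compat.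
  intros k. unfold se, Rdiv. rewrite Rabs_mult, Rabs_mult, <- RPow_abs, Rabs_Ropp, (Rabs_pos_eq (2^k)) by (apply pow_le; lra).
  rewrite (Rabs_pos_eq (/ sA)) by (left; now apply Rinv_0_lt_compat).
  replace (Rabs (sa0 k) * / sA * (2 ^ k) ^ m) with (Rabs (sa0 k) * (2 ^ k) ^ m * / sA) by ring.
  replace (C * / sA * (/ 2) ^ k) with (C * (/2)^k * / sA) by ring.
  apply Rmult_le_compat_r. left; now apply Rinv_0_lt_compat. apply H.
Qed.
Lemma se_moment m : Series (fun k => se k * (- 2 ^ k) ^ m) = 1.
Proof.
  assert (a := sA_pos).
  rewrite (Series_ext _ (fun k => ((-1) ^ m / sA) * (sa0 k * (2 ^ k) ^ m))).
  - rewrite Series_scal_l, sa0_moment. 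
    replace ((-1) ^ m / sA * ((-1) ^ m * sA)) with (((-1) * (-1)) ^ m) by (rewrite Rpow_mult_distr; field; lra).
    replace (-1 * -1) with 1 by ring. apply pow1.
  - intros k. unfold se. replace (- 2 ^ k) with ((-1) * 2 ^ k) by ring. rewrite Rpow_mult_distr. field. lra.
Qed.

(** * Smoothness on open sets of the plane *)

Definition P0u (U : R * R -> Prop) (f : R * R -> R) := forall p, U p -> continuous f p.
Definition D1u (U : R * R -> Prop) (f g : R * R -> R) := forall r t, U (r, t) -> is_derive (fun x => f (x, t)) r (g (r, t)).
Definition D2u (U : R * R -> Prop) (f g : R * R -> R) := forall r t, U (r, t) -> is_derive (fun s => f (r, s)) t (g (r, t)).
Lemma base_P0u U : base (P0u U).
Proof.
  split; unfold P0u; intros.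
  - apply continuous_const.
  - apply cont_plus; auto.
  - apply cont_mult; auto.
  - apply (cont_comp f); auto. apply sf_continuous.
Qed.
Lemma derivation_D1u U : derivation (D1u U).
Proof.
  split; unfold D1u; intros.
  - apply is_derive_c.
  - apply is_derive_plus'; auto.
  - apply is_derive_mult'; auto.
  - apply (is_derive_comp' (sf H 0)). apply sfP. auto.
Qed.
Lemma derivation_D2u U : derivation (D2u U).
Proof.
  split; unfold D2u; intros.
  - apply is_derive_c.
  - apply is_derive_plus'; auto.
  - apply is_derive_mult'; auto.
  - apply (is_derive_comp' (sf H 0)). apply sfP. auto.
Qed.
Definition CU U j k (f : R * R -> R) := Cl (P0u U) (D1u U) (D2u U) j k f.

Lemma open_slice1 (U : R * R -> Prop) r t : open U -> U (r, t) -> locally r (fun x => U (x, t)).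
Proof.
  intros hU h. destruct (hU _ h) as [d Hd]. exists d. intros y hy. apply Hd. split. exact hy. apply ball_center.
Qed.
Lemma open_slice2 (U : R * R -> Prop) r t : open U -> U (r, t) -> locally t (fun s => U (r, s)).
Proof.
  intros hU h. destruct (hU _ h) as [d Hd]. exists d. intros y hy. apply Hd. split. apply ball_center. exact hy.
Qed.

Lemma CU_ext U j k f g : open U -> (forall p, U p -> f p = g p) -> CU U j k f -> CU U j k g.
Proof.
  intros hU E hf. apply Cl_eq in hf. destruct hf as [h0 [h1 h2]]. apply Cl_eq. split; [|split].
  - intros p hp. apply (continuous_ext_loc _ f); [|apply h0; auto].
    exact (filter_imp U _ E (hU p hp)).
  - intros j' ->. destruct (h1 _ eq_refl) as [d [hd hd']]. exists d. split; auto. intros r t hr.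
    apply (is_derive_ext_loc (fun x => f (x, t))); [|apply hd; auto].
    generalize (open_slice1 U r t hU hr). apply filter_imp. intros; auto.
  - intros k' ->. destruct (h2 _ eq_refl) as [d [hd hd']]. exists d. split; auto. intros r t hr.
    apply (is_derive_ext_loc (fun s => f (r, s))); [|apply hd; auto].
    generalize (open_slice2 U r t hU hr). apply filter_imp. intros; auto.
Qed.
Lemma CU_plus U j k f g : CU U j k f -> CU U j k g -> CU U j k (fun p => f p + g p).
Proof. exact (Cl_plus _ _ _ (base_P0u U) (derivation_D1u U) (derivation_D2u U) j k f g). Qed.
Lemma CU_minus U j k f g : CU U j k f -> CU U j k g -> CU U j k (fun p => f p - g p).
Proof. exact (Cl_minus _ _ _ (base_P0u U) (derivation_D1u U) (derivation_D2u U) j k f g). Qed.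
Lemma CU_mult U j k f g : CU U j k f -> CU U j k g -> CU U j k (fun p => f p * g p).
Proof. exact (Cl_mult _ _ _ (base_P0u U) (derivation_D1u U) (derivation_D2u U) j k f g). Qed.
Lemma CU_const U j k c : CU U j k (fun _ => c).
Proof. exact (Cl_const _ _ _ (base_P0u U) (derivation_D1u U) (derivation_D2u U) j k c). Qed.
Lemma CU_comp U j k H f : CU U j k f -> CU U j k (fun p => sf H 0 (f p)).
Proof. exact (Cl_comp _ _ _ (base_P0u U) (derivation_D1u U) (derivation_D2u U) j k H f). Qed.
Lemma CU_fst U j k : CU U j k fst.
Proof.
  apply (Cl_le _ _ _ _ (S j) _ (S k)); auto.
  revert j. induction k as [|k IH]; intros j; apply Cl_eq; (split; [intros p _; apply continuous_fst|split]).
  - intros j' [= <-]. exists (fun _ => 1). split. intros r t _. exact (is_derive_i r). exact (CU_const U j 1 1).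
  - intros k' [= <-]. exists (fun _ => 0). split. intros r t _. exact (is_derive_c r t). exact (CU_const U (S j) 0 0).
  - intros j' [= <-]. exists (fun _ => 1). split. intros r t _. exact (is_derive_i r). exact (CU_const U j (S (S k)) 1).
  - intros k' [= <-]. exists (fun _ => 0). split. intros r t _. exact (is_derive_c r t). exact (CU_const U (S j) (S k) 0).
Qed.
Definition sm (U : R * R -> Prop) (f : R -> R -> R) : Prop :=
  forall (l : list bool) x y, U (x, y) ->
    ex_derive (fun x' => Dl l f x' y) x /\ ex_derive (fun y' => Dl l f x y') y /\
    continuous (fun p : R * R => Dl l f (fst p) (snd p)) (x, y).

Lemma CU_pdx U j k f : open U -> CU U (S j) k (fun p => f (fst p) (snd p)) -> CU U j k (fun p => pdx f (fst p) (snd p)).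
Proof.
  intros hU hf. destruct (Cl_D1 _ _ _ _ _ _ hf) as [g [hg hg']]. apply (CU_ext U j k g); auto.
  intros [r t] hp. symmetry. apply is_derive_unique. exact (hg r t hp).
Qed.
Lemma CU_pdt U j k f : open U -> CU U j (S k) (fun p => f (fst p) (snd p)) -> CU U j k (fun p => pdt f (fst p) (snd p)).
Proof.
  intros hU hf. destruct (Cl_D2 _ _ _ _ _ _ hf) as [g [hg hg']]. apply (CU_ext U j k g); auto.
  intros [r t] hp. symmetry. apply is_derive_unique. exact (hg r t hp).
Qed.

Lemma CU_sm U f : open U -> (forall j k, CU U j k (fun p => f (fst p) (snd p))) -> sm U f.
Proof.
  intros hU H l.
  assert (HC : forall j k, CU U j k (fun p => Dl l f (fst p) (snd p))).
  { induction l as [|[|] l IH]; intros j k; simpl; auto. now apply CU_pdx. now apply CU_pdt. }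
  intros x y hp. split; [|split].
  - destruct (Cl_D1 _ _ _ _ _ _ (HC 1%nat 0%nat)) as [g [hg _]]. eexists. exact (hg x y hp).
  - destruct (Cl_D2 _ _ _ _ _ _ (HC 0%nat 1%nat)) as [g [hg _]]. eexists. exact (hg x y hp).
  - exact (Cl_base _ _ _ _ _ _ (HC 0%nat 0%nat) (x, y) hp).
Qed.

Lemma Dl_snoc l b f : Dl (l ++ b :: nil) f = Dl l (if b then pdx f else pdt f).
Proof. induction l as [|c l IH]; simpl. now destruct b. now rewrite IH. Qed.

Lemma sm_pd U f : sm U f -> sm U (pdx f) /\ sm U (pdt f).
Proof.
  intros H. split; intros l.
  - rewrite <- (Dl_snoc l true f). apply H.
  - rewrite <- (Dl_snoc l false f). apply H.
Qed.

Lemma sm_CU U f : sm U f -> forall j k, CU U j k (fun p => f (fst p) (snd p)).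
Proof.
  assert (H : forall n j k, (j + k <= n)%nat -> forall f, sm U f -> CU U j k (fun p => f (fst p) (snd p))).
  { intros n. induction n as [|n IH]; intros j k hn g hg; apply Cl_eq;
      (split; [intros [x y] hp; apply (hg nil x y hp)|split; intros l ->]); try lia.
    - exists (fun p => pdx g (fst p) (snd p)). split.
      intros r t hp. apply Derive_correct. apply (hg nil r t hp). apply IH. lia. exact (proj1 (sm_pd U g hg)).
    - exists (fun p => pdt g (fst p) (snd p)). split.
      intros r t hp. apply Derive_correct. apply (hg nil r t hp). apply IH. lia. exact (proj2 (sm_pd U g hg)). }
  intros hf j k. apply (H (j + k)%nat); auto.
Qed.

Lemma sm_ext U f g : open U -> (forall r t, U (r, t) -> f r t = g r t) -> sm U f -> sm U g.
Proof.
  intros hU E hf. apply CU_sm; auto. intros j k. apply (CU_ext U j k (fun p => f (fst p) (snd p))); auto.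
  intros [r t] hp. now apply E. now apply sm_CU.
Qed.

Lemma continuous_Series {U : UniformSpace} (a : nat -> U -> R) C x :
  locally x (fun y => forall k, Rabs (a k y) <= C * (/2) ^ k) -> (forall k, continuous (a k) x) ->
  continuous (fun y => Series (fun k => a k y)) x.
Proof.
  intros hl hc. apply (limf_continuous (fun n y => sum_n (fun k => a k y) n) (/2) C); [lra| |].
  - revert hl. apply filter_imp. intros y hy n. rewrite sum_Sn. unfold plus; simpl.
    replace (sum_n (fun k => a k y) n + a (S n) y - sum_n (fun k => a k y) n) with (a (S n) y) by ring.
    eapply Rle_trans. apply hy. simpl. assert (b := half_pow n).
    assert (0 <= C). { specialize (hy 0%nat). simpl in hy. generalize (Rabs_pos (a 0%nat y)). lra. } nra.
  - intros n. induction n as [|n IH].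
    + apply (continuous_ext (a 0%nat)). intros; now rewrite sum_O. auto.
    + apply (continuous_ext (fun y => sum_n (fun k => a k y) n + a (S n) y)). intros; now rewrite sum_Sn. now apply cont_plus.
Qed.

Lemma is_derive_Series (a b : nat -> R -> R) t0 dl C : 0 < dl ->
  (forall k t, Rabs (t - t0) < dl -> is_derive (a k) t (b k t)) ->
  (forall k t, Rabs (t - t0) < dl -> Rabs (a k t) <= C * (/2) ^ k) ->
  (forall k t, Rabs (t - t0) < dl -> Rabs (b k t) <= C * (/2) ^ k) ->
  (forall k, continuous (b k) t0) ->
  is_derive (fun t => Series (fun k => a k t)) t0 (Series (fun k => b k t0)).
Proof.
  intros hdl hd ha hb hc.
  assert (hC : 0 <= C).
  { specialize (hb 0%nat t0 ltac:(rewrite Rminus_eq_0, Rabs_R0; auto)). simpl in hb. generalize (Rabs_pos (b 0%nat t0)). lra. }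
  assert (G : forall (c : nat -> R -> R), (forall k t, Rabs (t - t0) < dl -> Rabs (c k t) <= C * (/2) ^ k) -> forall t, Rabs (t - t0) < dl ->
     is_lim_seq (fun n => sum_n (fun k => c k t) n) (Series (fun k => c k t)) /\ forall n, Rabs (Series (fun k => c k t) - sum_n (fun k => c k t) n) <= 2 * C * (/2)^n).
  { intros c Hc t ht. destruct (geom_cauchy (fun n => sum_n (fun k => c k t) n) C (/2)) as [g1 g2]; [lra| |].
    - intros n. rewrite sum_Sn. unfold plus; simpl.
      replace (sum_n (fun k => c k t) n + c (S n) t - sum_n (fun k => c k t) n) with (c (S n) t) by ring.
      eapply Rle_trans. apply Hc; auto. simpl. assert (q := half_pow n). nra.
    - split. exact g1. intros n. eapply Rle_trans. apply g2. right. field. }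
  apply (is_derive_lim (fun n t => sum_n (fun k => a k t) n) (fun n t => sum_n (fun k => b k t) n)
    (fun t => Series (fun k => a k t)) (fun t => Series (fun k => b k t)) t0 dl); auto.
  - intros n t ht. induction n as [|n IH].
    + apply (is_derive_ext (a 0%nat)). intros; now rewrite sum_O. rewrite sum_O. auto.
    + apply (is_derive_ext (fun t => sum_n (fun k => a k t) n + a (S n) t)). intros; now rewrite sum_Sn.
      rewrite sum_Sn. apply is_derive_plus'; auto.
  - intros t ht. apply (G a ha t ht).
  - intros ep hep. assert (Z := geom_lim0 (2 * C) (/2) ltac:(lra)). apply is_lim_seq_spec in Z.
    destruct (Z (mkposreal ep hep)) as [N HN]. exists N. intros n hn s hs.
    specialize (HN n hn). simpl in HN. rewrite Rminus_0_r in HN.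
    rewrite Rabs_minus_sym. eapply Rle_trans. apply (proj2 (G b hb s hs)). generalize (Rle_abs (2 * C * (/2) ^ n)). lra.
  - apply (continuous_Series b C); auto. exists (mkposreal dl hdl). intros y hy k. apply hb. exact hy.
Qed.

(** Mean value theorem with the intermediate point tending to x0. It glues the two halves of the
    extension at 0. *)
Lemma derive_at_gap (f g : R -> R) x0 dl : 0 < dl -> (forall x, Rabs (x - x0) < dl -> x <> x0 -> is_derive f x (g x)) ->
  continuous f x0 -> continuous g x0 -> is_derive f x0 (g x0).
Proof.
  intros hdl hd hf hg. apply is_derive_eps. intros ep hep.
  destruct (proj1 (continuous_eps _ _) hg ep hep) as [d Hd].
  exists (Rmin dl d). split. apply Rmin_pos; auto. apply cond_pos. intros s hs.
  assert (h1 := Rlt_le_trans _ _ _ hs (Rmin_l _ _)). assert (h2 := Rlt_le_trans _ _ _ hs (Rmin_r _ _)).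
  destruct (Req_dec s x0) as [->|hn].
  { replace (f x0 - f x0 - (x0 - x0) * g x0) with 0 by ring. rewrite Rabs_R0. apply Rmult_le_pos. lra. apply Rabs_pos. }
  destruct (MVT_gen f x0 s g) as [c [hc1 hc2]].
  - intros x hx. apply hd. assert (a := between_abs x0 s x ltac:(lra)). lra.
    intros ->. unfold Rmin, Rmax in hx. destruct Rle_dec; lra.
  - intros x hx. apply continuity_pt_filterlim. destruct (Req_dec x x0) as [->|hx']; auto.
    apply (ex_derive_continuous (V := R_NormedModule)). exists (g x). apply hd; auto.
    assert (a := between_abs x0 s x ltac:(lra)). lra.
  - rewrite hc2. replace (g c * (s - x0) - (s - x0) * g x0) with ((g c - g x0) * (s - x0)) by ring.
    rewrite Rabs_mult. apply Rmult_le_compat_r. apply Rabs_pos. left. apply Hd.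
    apply between_abs in hc1. change (Rabs (c - x0) < d). lra.
Qed.

(** Boundedness on the half-line belongs to the class because the extension evaluates f at 2^k |x|
    for all k. *)
Definition P0b (f : R * R -> R) := (forall p : R * R, continuous (fun p : R * R => f (Rmax 0 (fst p), snd p)) p) /\
  forall T, exists M, forall x t, 0 <= x -> Rabs t <= T -> Rabs (f (x, t)) <= M.
Definition D1b (f g : R * R -> R) := forall x t, 0 < x -> is_derive (fun z => f (z, t)) x (g (x, t)).
Definition D2b (f g : R * R -> R) := forall x t, 0 <= x -> is_derive (fun s => f (x, s)) t (g (x, t)).
Definition Cb j k (f : R * R -> R) := Cl P0b D1b D2b j k f.
Lemma base_P0b : base P0b.
Proof.
  split; unfold P0b; intros.
  - split. intros p; apply continuous_const. intros T. exists (Rabs c). intros; lra.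
  - destruct H as [a b], H0 as [c d]. split. intros p. now apply cont_plus.
    intros T. destruct (b T) as [M hM], (d T) as [N hN]. exists (M + N). intros.
    eapply Rle_trans. apply Rabs_triang. apply Rplus_le_compat; auto.
  - destruct H as [a b], H0 as [c d]. split. intros p. now apply cont_mult.
    intros T. destruct (b T) as [M hM], (d T) as [N hN]. exists (M * N). intros.
    rewrite Rabs_mult. apply Rmult_le_compat; auto using Rabs_pos.
  - destruct H0 as [a b]. split. intros p. apply (cont_comp (fun p => f (Rmax 0 (fst p), snd p))); auto. apply sf_continuous.
    intros T. destruct (b T) as [M hM]. destruct (smf_bounded H 0 M) as [B hB]. exists B. auto.
Qed.
Lemma derivation_D1b : derivation D1b.
Proof.
  split; unfold D1b; intros.
  - apply is_derive_c.
  - apply is_derive_plus'; auto.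
  - apply is_derive_mult'; auto.
  - apply (is_derive_comp' (sf H 0)). apply sfP. auto.
Qed.
Lemma derivation_D2b : derivation D2b.
Proof.
  split; unfold D2b; intros.
  - apply is_derive_c.
  - apply is_derive_plus'; auto.
  - apply is_derive_mult'; auto.
  - apply (is_derive_comp' (sf H 0)). apply sfP. auto.
Qed.

(* Seeley extension across 0 (m = 0) of a function on [0, oo); [extS m] acts on m-th derivatives. *)
Definition extS (m : nat) (f : R -> R) (x : R) : R :=
  f (Rmax 0 x) + Series (fun k => se k * (- 2 ^ k) ^ m * f (2 ^ k * Rmax 0 (- x))) - f 0.
Definition Ext m (f : R * R -> R) : R * R -> R := fun p => extS m (fun x => f (x, snd p)) (fst p).

Lemma continuous_Rmax0 {U : UniformSpace} (f : U -> R) x : continuous f x -> continuous (fun y => Rmax 0 (f y)) x.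
Proof.
  intros hf. apply (cont_comp f (Rmax 0)); auto. apply lip1_continuous. intros a b.
  unfold Rmax. repeat destruct Rle_dec; unfold Rabs; repeat destruct Rcase_abs; lra.
Qed.
Lemma arg_pos k x : 0 <= 2 ^ k * Rmax 0 (- x).
Proof. apply Rmult_le_pos. apply pow_le; lra. apply Rmax_l. Qed.

Lemma term_bound f m T : P0b f -> exists C, forall k x t, Rabs t <= T -> Rabs (se k * (- 2 ^ k) ^ m * f (2 ^ k * Rmax 0 (- x), t)) <= C * (/2) ^ k.
Proof.
  intros [_ hb]. destruct (hb T) as [M hM]. destruct (se_decay m) as [C [hC HC]]. exists (C * M). intros k x t ht.
  rewrite Rabs_mult. replace (C * M * (/2)^k) with (C * (/2)^k * M) by ring.
  apply Rmult_le_compat; auto using Rabs_pos. apply hM; auto. apply arg_pos.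
Qed.
Lemma term_continuous f m k : P0b f -> forall p : R * R, continuous (fun p : R * R => se k * (- 2 ^ k) ^ m * f (2 ^ k * Rmax 0 (- fst p), snd p)) p.
Proof.
  intros [hc _] p. apply cont_mult. apply continuous_const.
  apply (continuous_ext (fun p : R * R => f (Rmax 0 (2 ^ k * Rmax 0 (- fst p)), snd p))).
  { intros q. rewrite (Rmax_right 0); auto. apply arg_pos. }
  apply (continuous_comp (fun p : R * R => (2 ^ k * Rmax 0 (- fst p), snd p)) (fun p : R * R => f (Rmax 0 (fst p), snd p))); auto.
  apply continuous_pair; [|apply continuous_snd]. apply cont_mult. apply continuous_const.
  apply continuous_Rmax0. apply cont_opp. apply continuous_fst.
Qed.

Lemma Ext_continuous m f : P0b f -> forall p, continuous (Ext m f) p.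
Proof.
  intros hf p. unfold Ext, extS. apply cont_minus. apply cont_plus.
  - apply hf.
  - destruct (term_bound f m (Rabs (snd p) + 1) hf) as [C HC].
    apply (continuous_Series (fun k (p : R * R) => se k * (- 2 ^ k) ^ m * f (2 ^ k * Rmax 0 (- fst p), snd p)) C).
    + exists (mkposreal 1 Rlt_0_1). intros [x t] [_ ht] k. apply HC. change (Rabs (t - snd p) < 1) in ht. simpl.
      replace t with ((t - snd p) + snd p) by ring. eapply Rle_trans. apply Rabs_triang. rewrite Rplus_comm. apply Rplus_le_compat_l. left. exact ht.
    + intros k. now apply term_continuous.
  - apply (continuous_ext (fun p : R * R => f (Rmax 0 0, snd p))). intros; now rewrite Rmax_left by lra.
    apply (continuous_comp (fun p : R * R => (0, snd p)) (fun p : R * R => f (Rmax 0 (fst p), snd p))); [|apply hf].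
    apply continuous_pair. apply continuous_const. apply continuous_snd.
Qed.

(** For x >= 0 every node sits at 0, so the series is f 0 times a moment equal to 1 and cancels the
    last term. *)
Lemma Ext_pos m f x t : 0 <= x -> Ext m f (x, t) = f (x, t).
Proof.
  intros hx. unfold Ext, extS. simpl. rewrite (Rmax_right 0 x), (Rmax_left 0 (- x)) by lra.
  rewrite (Series_ext _ (fun k => f (0, t) * (se k * (- 2 ^ k) ^ m))).
  - rewrite Series_scal_l, se_moment. ring.
  - intros k. rewrite Rmult_0_r. ring.
Qed.

Lemma Ext_D2 m f g : P0b f -> P0b g -> D2b f g -> forall x t, is_derive (fun s => Ext m f (x, s)) t (Ext m g (x, t)).
Proof.
  intros hf hg hd x t. unfold Ext, extS. simpl.
  apply is_derive_minus'. apply is_derive_plus'. apply hd. apply Rmax_l. 2: apply hd; lra.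
  destruct (term_bound f m (Rabs t + 1) hf) as [C1 H1], (term_bound g m (Rabs t + 1) hg) as [C2 H2].
  assert (near : forall s, Rabs (s - t) < 1 -> Rabs s <= Rabs t + 1).
  { intros s hs. replace s with ((s - t) + t) by ring. eapply Rle_trans. apply Rabs_triang. lra. }
  apply (is_derive_Series (fun k s => se k * (- 2 ^ k) ^ m * f (2 ^ k * Rmax 0 (- x), s)) (fun k s => se k * (- 2 ^ k) ^ m * g (2 ^ k * Rmax 0 (- x), s)) t 1 (Rmax C1 C2)).
  - lra.
  - intros k s _. apply is_derive_scal'. apply hd. apply arg_pos.
  - intros k s hs. eapply Rle_trans. apply H1; auto. apply Rmult_le_compat_r. generalize (half_pow k); lra. apply Rmax_l.
  - intros k s hs. eapply Rle_trans. apply H2; auto. apply Rmult_le_compat_r. generalize (half_pow k); lra. apply Rmax_r.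
  - intros k. apply (continuous_slice (fun p : R * R => se k * (- 2 ^ k) ^ m * g (2 ^ k * Rmax 0 (- fst p), snd p)) x t). now apply term_continuous.
Qed.

(** To the left of 0 the chain rule contributes a factor - 2^k to each term, which is the passage
    from m to S m. At 0 [derive_at_gap] applies, both extensions being continuous. *)
Lemma Ext_D1 m f g : P0b f -> P0b g -> D1b f g -> forall x t, is_derive (fun z => Ext m f (z, t)) x (Ext (S m) g (x, t)).
Proof.
  intros hf hg hd.
  assert (off : forall x t, x <> 0 -> is_derive (fun z => Ext m f (z, t)) x (Ext (S m) g (x, t))).
  { intros x t hx. destruct (Rlt_dec 0 x) as [hp|hp].
    - rewrite Ext_pos by lra. apply (is_derive_ext_loc (fun z => f (z, t))); [|apply hd; auto].
      exists (mkposreal x hp). intros y hy. change (Rabs (y - x) < x) in hy. apply Rabs_def2 in hy.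
      symmetry. apply Ext_pos. lra.
    - assert (hn : x < 0) by lra. unfold Ext. simpl.
      apply (is_derive_ext_loc (fun z => f (0, t) + Series (fun k => se k * (- 2 ^ k) ^ m * f (2 ^ k * - z, t)) - f (0, t))).
      + exists (mkposreal (- x) ltac:(lra)). intros y hy. change (Rabs (y - x) < - x) in hy. apply Rabs_def2 in hy. simpl in y.
        unfold extS. rewrite (Rmax_left 0 y), (Rmax_right 0 (- y)) by lra. reflexivity.
      + apply (is_derive_val _ _ (0 + Series (fun k => se k * (- 2 ^ k) ^ S m * g (2 ^ k * - x, t)) - 0)).
        2: { unfold extS. rewrite (Rmax_left 0 x), (Rmax_right 0 (- x)) by lra. ring. }
        apply is_derive_minus'. 2: apply is_derive_c. apply is_derive_plus'. apply is_derive_c.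
        destruct (term_bound f m (Rabs t) hf) as [C1 H1], (term_bound g (S m) (Rabs t) hg) as [C2 H2].
        assert (nb : forall z, Rabs (z - x) < - x -> z < 0) by (intros z hz; apply Rabs_def2 in hz; lra).
        apply (is_derive_Series (fun k z => se k * (- 2 ^ k) ^ m * f (2 ^ k * - z, t)) (fun k z => se k * (- 2 ^ k) ^ S m * g (2 ^ k * - z, t)) x (- x) (Rmax C1 C2)).
        * lra.
        * intros k z hz. assert (hz' := nb z hz). eapply is_derive_val. apply is_derive_scal'.
          apply (is_derive_comp' (fun y => f (y, t)) (fun z => 2 ^ k * - z)). apply hd.
          apply Rmult_lt_0_compat. apply pow_lt; lra. lra.
          apply is_derive_scal'. apply (is_derive_opp' (fun y => y)). apply is_derive_i. simpl. ring.
        * intros k z hz. specialize (H1 k z t (Rle_refl _)). rewrite (Rmax_right 0 (- z)) in H1 by (generalize (nb z hz); lra).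
          eapply Rle_trans. apply H1. apply Rmult_le_compat_r. generalize (half_pow k); lra. apply Rmax_l.
        * intros k z hz. specialize (H2 k z t (Rle_refl _)). rewrite (Rmax_right 0 (- z)) in H2 by (generalize (nb z hz); lra).
          eapply Rle_trans. apply H2. apply Rmult_le_compat_r. generalize (half_pow k); lra. apply Rmax_r.
        * intros k. apply (continuous_ext_loc _ (fun z => se k * (- 2 ^ k) ^ S m * g (2 ^ k * Rmax 0 (- z), t))).
          -- exists (mkposreal (- x) ltac:(lra)). intros y hy. assert (a := nb y hy). rewrite (Rmax_right 0 (- y)) by lra. reflexivity.
          -- apply (continuous_slice' (fun p : R * R => se k * (- 2 ^ k) ^ S m * g (2 ^ k * Rmax 0 (- fst p), snd p)) x t). now apply term_continuous. }
  intros x t. destruct (Req_dec x 0) as [->|hx]; auto.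
  apply (derive_at_gap (fun z => Ext m f (z, t)) (fun z => Ext (S m) g (z, t)) 0 1); try lra; auto.
  - apply (continuous_slice' (Ext m f)). now apply Ext_continuous.
  - apply (continuous_slice' (Ext (S m) g)). now apply Ext_continuous.
Qed.

Lemma Ext_class n : forall j k, (j + k <= n)%nat -> forall m f, Cb j k f -> CU (fun _ => True) j k (Ext m f).
Proof.
  induction n as [|n IH]; intros j k hn m f hf; assert (h0 := Cl_base _ _ _ _ _ _ hf); apply Cl_eq;
    (split; [intros p _; now apply Ext_continuous|split; intros l ->]); try lia.
  - destruct (Cl_D1 _ _ _ _ _ _ hf) as [g [hg hg']]. exists (Ext (S m) g). split.
    intros r t _. apply Ext_D1; auto. exact (Cl_base _ _ _ _ _ _ hg'). apply IH; auto. lia.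
  - destruct (Cl_D2 _ _ _ _ _ _ hf) as [g [hg hg']]. exists (Ext m g). split.
    intros r t _. apply Ext_D2; auto. exact (Cl_base _ _ _ _ _ _ hg'). apply IH; auto. lia.
Qed.

Lemma inv1_range x : 0 <= x -> 0 < / (1 + x) <= 1.
Proof.
  intros hx. split. apply Rinv_0_lt_compat; lra.
  apply Rle_trans with (/ 1). apply Rinv_le_contravar; lra. rewrite Rinv_1; lra.
Qed.
Lemma inv1_continuous (p : R * R) : continuous (fun p : R * R => / (1 + Rmax 0 (fst p))) p.
Proof.
  apply (cont_comp (fun p : R * R => 1 + Rmax 0 (fst p)) Rinv).
  - apply cont_plus. apply continuous_const. apply continuous_Rmax0, continuous_fst.
  - apply continuous_Rinv. generalize (Rmax_l 0 (fst p)). lra.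
Qed.
Lemma Cb_inv1 j : forall k, Cb j k (fun p => / (1 + fst p)).
Proof.
  assert (h0 : P0b (fun p => / (1 + fst p))).
  { split. exact inv1_continuous. intros T. exists 1. intros x t hx _. simpl. generalize (inv1_range x hx).
    intros. rewrite Rabs_pos_eq; lra. }
  assert (hz : forall j k, Cb j k (fun _ => 0)).
  { intros. exact (Cl_const _ _ _ base_P0b derivation_D1b derivation_D2b _ _ 0). }
  induction j as [|j IH]; intros k; apply Cl_eq; (split; [exact h0|split]); try discriminate.
  - intros k' ->. exists (fun _ => 0). split. intros x t _. exact (is_derive_c (/ (1 + x)) t). apply hz.
  - intros j' [= <-]. exists (fun p => -1 * (/ (1 + fst p) * / (1 + fst p))). split.
    + intros x t hx. simpl. eapply is_derive_val. apply is_derive_inv. apply is_derive_plus'. apply is_derive_c. apply is_derive_i.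
      lra. simpl. field. lra.
    + apply (Cl_scal _ _ _ base_P0b derivation_D1b derivation_D2b).
      apply (Cl_mult _ _ _ base_P0b derivation_D1b derivation_D2b); apply IH.
  - intros k' ->. exists (fun _ => 0). split. intros x t _. exact (is_derive_c (/ (1 + x)) t). apply hz.
Qed.

(** The half-line x >= 0 corresponds to r in (0, 1], inside a compact interval on which u is
    continuous; this yields the bounds in [P0b]. *)
Lemma Cb_of_Cc n : forall j k, (j + k <= n)%nat -> forall u : R * R -> R, Cl P0c D1c D2c j k u -> Cb j k (fun p => u (/ (1 + fst p), snd p)).
Proof.
  induction n as [|n IH]; intros j k hn u hu; assert (h0 := Cl_base _ _ _ _ _ _ hu); apply Cl_eq.
  all: assert (HP : P0b (fun p => u (/ (1 + fst p), snd p))) by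
    (split;
     [intros p; apply (continuous_ext (fun p : R * R => u (cl1 (/ (1 + Rmax 0 (fst p))), snd p)));
       [intros [x t]; simpl; rewrite clamp_id; [reflexivity|generalize (inv1_range (Rmax 0 x) (Rmax_l 0 x)); lra]
       |apply (continuous_comp (fun p : R * R => (/ (1 + Rmax 0 (fst p)), snd p)) (fun p : R * R => u (cl1 (fst p), snd p))); [|apply h0];
        apply continuous_pair; [apply inv1_continuous|apply continuous_snd]]
     |intros T; destruct (Rle_dec 0 T);
       [destruct (max_rect (fun r t => Rabs (u (cl1 r, t))) 0 1 (-T) T) as [m [q [_ [_ Hm]]]];
         [lra|lra|intros; apply (cont_abs (fun p : R * R => u (cl1 (fst p), snd p))); apply h0
         |exists (Rabs (u (cl1 m, q))); intros x t hx ht; simpl; assert (a := inv1_range x hx);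
          apply Rabs_le_between in ht; specialize (Hm (/ (1 + x)) t ltac:(lra) ht); rewrite (clamp_id (-1) 1 (/ (1 + x))) in Hm; lra]
       |exists 0; intros x t _ ht; generalize (Rabs_pos t); lra]]).
  all: split; [exact HP|split; intros l ->]; try lia.
  - destruct (Cl_D1 _ _ _ _ _ _ hu) as [g [hg hg']].
    exists (fun p => g (/ (1 + fst p), snd p) * (-1 * (/ (1 + fst p) * / (1 + fst p)))). split.
    + intros x t hx. simpl. assert (a := inv1_range x ltac:(lra)).
      apply (is_derive_comp' (fun r => u (r, t)) (fun x => / (1 + x))). apply hg. split. lra.
      rewrite <- Rinv_1. apply Rinv_lt_contravar; lra.
      eapply is_derive_val. apply is_derive_inv. apply is_derive_plus'. apply is_derive_c. apply is_derive_i. lra. simpl. field. lra.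
    + apply (Cl_mult _ _ _ base_P0b derivation_D1b derivation_D2b). apply IH; auto. lia.
      apply (Cl_scal _ _ _ base_P0b derivation_D1b derivation_D2b).
      apply (Cl_mult _ _ _ base_P0b derivation_D1b derivation_D2b); apply Cb_inv1.
  - destruct (Cl_D2 _ _ _ _ _ _ hu) as [g [hg hg']].
    exists (fun p => g (/ (1 + fst p), snd p)). split.
    + intros x t hx. simpl. apply hg. generalize (inv1_range x hx). lra.
    + apply IH; auto. lia.
Qed.

Lemma CU_Rinv j : forall k, CU (fun p => 0 < fst p) j k (fun p => / fst p).
Proof.
  assert (h0 : P0u (fun p => 0 < fst p) (fun p => / fst p)).
  { intros p hp. cbv beta in hp. apply (cont_comp fst Rinv). apply continuous_fst. apply continuous_Rinv. exact (Rgt_not_eq _ _ hp). }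
  induction j as [|j IH]; intros k; apply Cl_eq; (split; [exact h0|split]); try discriminate.
  - intros k' ->. exists (fun _ => 0). split. intros x t _. exact (is_derive_c (/ x) t). exact (CU_const _ 0 k' 0).
  - intros j' [= <-]. exists (fun p => -1 * (/ fst p * / fst p)). split.
    + intros x t hx. assert (hx' : 0 < x) by exact hx. simpl. eapply is_derive_val. apply is_derive_inv. apply is_derive_i. lra. simpl. field. lra.
    + apply (CU_mult _ j k (fun _ => -1)). apply CU_const. apply CU_mult; apply IH.
  - intros k' ->. exists (fun _ => 0). split. intros x t _. exact (is_derive_c (/ x) t). exact (CU_const _ (S j) k' 0).
Qed.

Lemma CU_inv_subst n : forall j k, (j + k <= n)%nat -> forall f, CU (fun _ => True) j k f ->
  CU (fun p => 0 < fst p) j k (fun p => f (/ fst p - 1, snd p)).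
Proof.
  induction n as [|n IH]; intros j k hn f hf; assert (h0 := Cl_base _ _ _ _ _ _ hf); apply Cl_eq.
  all: assert (HP : P0u (fun p => 0 < fst p) (fun p => f (/ fst p - 1, snd p))) by
    (intros p hp; cbv beta in hp; apply (continuous_comp (fun p : R * R => (/ fst p - 1, snd p)) f); [|apply h0; auto];
     apply continuous_pair; [apply cont_minus; [apply (cont_comp fst Rinv); [apply continuous_fst|apply continuous_Rinv; exact (Rgt_not_eq _ _ hp)]|apply continuous_const]|apply continuous_snd]).
  all: split; [exact HP|split; intros l ->]; try lia.
  - destruct (Cl_D1 _ _ _ _ _ _ hf) as [g [hg hg']].
    exists (fun p => g (/ fst p - 1, snd p) * (-1 * (/ fst p * / fst p))). split.
    + intros x t hx. assert (hx' : 0 < x) by exact hx. simpl. apply (is_derive_comp' (fun r => f (r, t)) (fun x => / x - 1)). apply hg. auto.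
      eapply is_derive_val. apply is_derive_minus'. apply is_derive_inv. apply is_derive_i. lra. apply is_derive_c. simpl. field. lra.
    + apply CU_mult. apply IH; auto. lia. apply (CU_mult _ l k (fun _ => -1)). apply CU_const. apply CU_mult; apply CU_Rinv.
  - destruct (Cl_D2 _ _ _ _ _ _ hf) as [g [hg hg']].
    exists (fun p => g (/ fst p - 1, snd p)). split.
    + intros x t hx. simpl. apply hg. auto.
    + apply IH; auto. lia.
Qed.

Lemma CU_of_Cc n : forall j k, (j + k <= n)%nat -> forall u : R * R -> R, Cl P0c D1c D2c j k u -> CU (fun p => -1 < fst p < 1) j k u.
Proof.
  induction n as [|n IH]; intros j k hn u hu; assert (h0 := Cl_base _ _ _ _ _ _ hu); apply Cl_eq;
    (split; [intros [r t] hp; apply P0c_interior; auto|split; intros l ->]); try lia.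
  - destruct (Cl_D1 _ _ _ _ _ _ hu) as [g [hg hg']]. exists g. split. intros r t hr. apply hg. exact hr. apply IH; auto. lia.
  - destruct (Cl_D2 _ _ _ _ _ _ hu) as [g [hg hg']]. exists g. split. intros r t hr. apply hg. simpl in hr. lra. apply IH; auto. lia.
Qed.

(* The coordinate x = 1/r - 1 maps (0, 1] to [0, oo), so that extending across r = 1 becomes extending across x = 0. *)
Definition exts (f : R -> R) (r : R) : R :=
  if Rle_dec r (1 / 2) then f r else extS 0 (fun x => f (/ (1 + x))) (/ r - 1).

Lemma exts_id f r : r <= 1 -> exts f r = f r.
Proof.
  intros hr. unfold exts. destruct Rle_dec as [|hn]; auto.
  assert (hr1 : 1 <= / r). { rewrite <- Rinv_1. apply Rinv_le_contravar; lra. }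
  assert (E := Ext_pos 0 (fun p => f (/ (1 + fst p))) (/ r - 1) 0 ltac:(lra)). unfold Ext in E. simpl in E.
  rewrite E. f_equal. field. lra.
Qed.

Lemma open_fst_gt a : open (fun p : R * R => a < fst p).
Proof. apply (open_comp fst (fun x => a < x)). intros; apply continuous_fst. apply open_gt. Qed.
Lemma open_fst_lt a : open (fun p : R * R => fst p < a).
Proof. apply (open_comp fst (fun x => x < a)). intros; apply continuous_fst. apply open_lt. Qed.
Lemma open_snd_lt a : open (fun p : R * R => snd p < a).
Proof. apply (open_comp snd (fun x => x < a)). intros; apply continuous_snd. apply open_lt. Qed.

(** Two overlapping charts: r in (-1, 1), where [exts] changes nothing, and r > 0, where it is
    [Ext 0] in the coordinate 1/r - 1. *)
Lemma exts_smooth y : (forall j k, Cc j k y) -> sm (fun p => -1 < fst p) (fun r t => exts (fun x => y x t) r).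
Proof.
  intros hy.
  assert (S1 : sm (fun p => -1 < fst p < 1) (fun r t => exts (fun x => y x t) r)).
  { assert (o : open (fun p : R * R => -1 < fst p < 1)) by (apply open_and; [apply open_fst_gt|apply open_fst_lt]).
    apply (sm_ext _ y); auto. intros r t hr. simpl in hr. rewrite exts_id; lra.
    apply CU_sm; auto. intros j k. apply (CU_of_Cc (j + k)); auto. apply hy. }
  assert (S2 : sm (fun p => 0 < fst p) (fun r t => exts (fun x => y x t) r)).
  { assert (o := open_fst_gt 0).
    apply (sm_ext _ (fun r t => Ext 0 (fun p => y (/ (1 + fst p)) (snd p)) (/ r - 1, t))); auto.
    - intros r t hr. simpl in hr. destruct (Rle_dec r (1/2)) as [h|h].
      + rewrite exts_id by lra. rewrite Ext_pos. simpl. f_equal. field. lra.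
        assert (1 <= / r). { rewrite <- Rinv_1. apply Rinv_le_contravar; lra. } lra.
      + unfold exts. destruct Rle_dec; [lra|]. reflexivity.
    - apply CU_sm; auto. intros j k.
      apply (CU_inv_subst (j + k) j k (Nat.le_refl _) (Ext 0 (fun p => y (/ (1 + fst p)) (snd p)))).
      apply (Ext_class (j + k)); auto. exact (Cb_of_Cc (j + k) j k (Nat.le_refl _) _ (hy j k)). }
  intros l r t hr. simpl in hr. destruct (Rlt_dec r 1) as [h|h].
  - apply (S1 l r t). simpl. lra.
  - apply (S2 l r t). simpl. lra.
Qed.

(** * Comparison principles *)

Lemma second_derivative_max (f g : R -> R) a b r l : a < r < b -> (forall x, a < x < b -> is_derive f x (g x)) ->
  is_derive g r l -> (forall x, a <= x <= b -> f x <= f r) -> g r = 0 /\ l <= 0.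
Proof.
  intros hr hf hg hm.
  assert (g0 : g r = 0).
  { assert (D := proj1 (is_derive_Reals _ _ _) (hf r hr)).
    assert (pr : derivable_pt f r) by (eexists; exact D).
    rewrite <- (derive_pt_eq_0 _ _ _ pr D). apply (deriv_maximum f a b r pr); try lra. intros x h1 h2. apply hm. lra. }
  split; auto. destruct (Rle_dec l 0) as [|hl]; auto. exfalso.
  destruct (proj1 (is_derive_eps _ _ _) hg (l / 2)) as [d [hd Hd]]. lra.
  set (s := r + Rmin (d / 2) ((b - r) / 2)).
  assert (0 < Rmin (d / 2) ((b - r) / 2)) by (apply Rmin_pos; lra).
  assert (Rmin (d/2) ((b - r)/2) <= d / 2) by apply Rmin_l. assert (Rmin (d/2) ((b - r)/2) <= (b - r)/2) by apply Rmin_r.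
  destruct (MVT_cor2 f g r s) as [c [hc1 hc2]]. unfold s; lra.
  { intros c hc. apply is_derive_Reals. apply hf. unfold s in hc. lra. }
  specialize (Hd c). rewrite Rabs_pos_eq in Hd by lra. specialize (Hd ltac:(unfold s in hc2; lra)).
  rewrite g0 in Hd. apply Rabs_le_between in Hd. assert (0 < g c) by nra.
  specialize (hm s ltac:(unfold s; lra)). nra.
Qed.

(** With the weight exp (- (C + 1) t) a positive maximum is contradictory: there W_r = 0, W_rr <= 0
    and W_t >= (C + 1) W. The inequality is demanded only where W > 0 and W_r = 0, so singular
    first-order coefficients and one-sided Lipschitz bounds are admissible. *)
Lemma cmp (W Wt Wr Wrr : R -> R -> R) rho ta tb C : 0 < rho -> 0 <= C ->
  (forall r t, 0 <= r <= rho -> ta <= t <= tb -> continuous (fun p : R * R => W (fst p) (snd p)) (r, t)) ->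
  (forall t, ta <= t <= tb -> W 0 t <= 0) -> (forall t, ta <= t <= tb -> W rho t <= 0) ->
  (forall r, 0 <= r <= rho -> W r ta <= 0) ->
  (forall r t, 0 < r < rho -> ta < t <= tb -> is_derive (W r) t (Wt r t)) ->
  (forall r t, 0 < r < rho -> ta < t <= tb -> is_derive (fun x => W x t) r (Wr r t)) ->
  (forall r t, 0 < r < rho -> ta < t <= tb -> is_derive (fun x => Wr x t) r (Wrr r t)) ->
  (forall r t, 0 < r < rho -> ta < t <= tb -> 0 < W r t -> Wr r t = 0 -> Wt r t <= Wrr r t + C * W r t) ->
  forall r t, 0 <= r <= rho -> ta <= t <= tb -> W r t <= 0.
Proof.
  intros hrho hC hc h0 h1 hi dT d1 d2 hp r t hr ht.
  set (V := fun r t => exp (- ((C + 1) * t)) * W r t).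
  destruct (max_rect V 0 rho ta tb) as [rs [ts [hrs [hts Hm]]]]; try lra.
  { intros x y hx hy. unfold V. apply cont_mult. cc. now apply hc. }
  assert (he : forall s, 0 < exp (- ((C + 1) * s))) by (intros; apply exp_pos).
  destruct (Rle_dec (W rs ts) 0) as [hn|hn].
  { specialize (Hm r t hr ht). unfold V in Hm. assert (a := he t). assert (b := he ts).
    destruct (Rle_dec (W r t) 0) as [|hx]; auto. exfalso.
    assert (0 < exp (- ((C + 1) * t)) * W r t) by (apply Rmult_lt_0_compat; lra).
    assert (exp (- ((C + 1) * ts)) * W rs ts <= 0) by nra. lra. }
  exfalso. assert (hW : 0 < W rs ts) by lra.
  assert (i1 : 0 < rs < rho).
  { assert (rs <> 0) by (intros ->; specialize (h0 ts hts); lra). assert (rs <> rho) by (intros ->; specialize (h1 ts hts); lra). lra. }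
  assert (i2 : ta < ts <= tb). { assert (ts <> ta) by (intros ->; specialize (hi rs hrs); lra). lra. }
  destruct (second_derivative_max (fun x => W x ts) (fun x => Wr x ts) 0 rho rs (Wrr rs ts)) as [z1 z2]; auto.
  { intros x hx. specialize (Hm x ts hx hts). unfold V in Hm. apply Rmult_le_reg_l in Hm; auto. }
  assert (D : 0 <= exp (- ((C + 1) * ts)) * (Wt rs ts - (C + 1) * W rs ts)).
  { apply (derive_left_max (V rs) _ ta ts). lra.
    - unfold V. eapply is_derive_val. apply is_derive_mult'. 2: now apply dT.
      apply (is_derive_comp' exp (fun t => - ((C + 1) * t))). apply is_derive_exp.
      apply is_derive_opp'. apply (is_derive_scal' (fun y => y)). apply is_derive_i. cbv beta. ring.
    - intros s hs. apply Hm; lra. }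
  assert (D' : 0 <= Wt rs ts - (C + 1) * W rs ts).
  { apply Rmult_le_reg_l with (exp (- ((C + 1) * ts))); auto. lra. }
  specialize (hp rs ts i1 i2 hW z1). lra.
Qed.

(* The weight r removes the condition at the origin: r w satisfies (r w)_rr + (r w)_r / r - (r w) / r^2 = r (w_rr + 3 w_r / r). *)
Lemma cmp_radial (w wt wr wrr : R -> R -> R) rho ta tb C : 0 < rho -> 0 <= C ->
  (forall r t, 0 <= r <= rho -> ta <= t <= tb -> continuous (fun p : R * R => w (fst p) (snd p)) (r, t)) ->
  (forall t, ta <= t <= tb -> w rho t <= 0) ->
  (forall r, 0 < r <= rho -> w r ta <= 0) ->
  (forall r t, 0 < r < rho -> ta < t <= tb -> is_derive (w r) t (wt r t)) ->
  (forall r t, 0 < r < rho -> ta < t <= tb -> is_derive (fun x => w x t) r (wr r t)) ->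
  (forall r t, 0 < r < rho -> ta < t <= tb -> is_derive (fun x => wr x t) r (wrr r t)) ->
  (forall r t, 0 < r < rho -> ta < t <= tb -> 0 < w r t -> wt r t <= wrr r t + 3 * wr r t / r + C * w r t) ->
  forall r t, 0 < r <= rho -> ta <= t <= tb -> w r t <= 0.
Proof.
  intros hrho hC hc h1 hi dT d1 d2 hp r t hr ht.
  assert (H : r * w r t <= 0).
  { apply (cmp (fun r t => r * w r t) (fun r t => r * wt r t) (fun r t => w r t + r * wr r t) (fun r t => 2 * wr r t + r * wrr r t) rho ta tb C); auto; try lra.
    - intros x s hx hs. apply (cont_mult fst (fun p : R * R => w (fst p) (snd p))). apply continuous_fst. now apply hc.
    - intros s hs. lra.
    - intros s hs. specialize (h1 s hs). nra.
    - intros x hx. destruct (Req_dec x 0) as [->|]. lra. specialize (hi x ltac:(lra)). nra.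
    - intros x s hx hs. apply is_derive_scal'. now apply dT.
    - intros x s hx hs. eapply is_derive_val. apply (is_derive_mult' (fun x => x)). apply is_derive_i. now apply d1. cbv beta. ring.
    - intros x s hx hs. eapply is_derive_val. apply is_derive_plus'. now apply d1.
      apply (is_derive_mult' (fun x => x)). apply is_derive_i. now apply d2. cbv beta. ring.
    - intros x s hx hs hw hz. assert (hw' : 0 < w x s) by nra.
      specialize (hp x s hx hs hw').
      assert (E : wr x s = - w x s / x). { apply Rmult_eq_reg_l with x; [|lra]. field_simplify; lra. }
      rewrite E in *.
      assert (0 < w x s / x) by (apply Rdiv_lt_0_compat; lra).
      apply Rmult_le_compat_l with (r := x) in hp; [|lra].
      replace (x * (wrr x s + 3 * (- w x s / x) / x + C * w x s)) with (x * wrr x s - 3 * (w x s / x) + C * (x * w x s)) in hp by (field; lra).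
      replace (2 * (- w x s / x)) with (- 2 * (w x s / x)) by (field; lra). lra. }
  destruct (Rle_dec (w r t) 0); auto. nra.
Qed.

Lemma le_at_0 (f : R -> R) c : continuous f 0 -> (forall x, 0 < x <= 1 -> f x <= c) -> f 0 <= c.
Proof.
  intros hf H. destruct (Rle_dec (f 0) c) as [|hn]; auto. exfalso.
  destruct (proj1 (continuous_eps _ _) hf (f 0 - c)) as [d Hd]. lra.
  assert (hd := cond_pos d). set (x := Rmin (d / 2) 1).
  assert (hx : 0 < x) by (apply Rmin_pos; lra). assert (hx1 : x <= d / 2) by apply Rmin_l. assert (hx2 : x <= 1) by apply Rmin_r.
  assert (B : Rabs (f x - f 0) < f 0 - c).
  { apply Hd. change (Rabs (x - 0) < d). rewrite Rminus_0_r, Rabs_pos_eq; lra. }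
  apply Rabs_def2 in B. specialize (H x ltac:(lra)). lra.
Qed.

(** A one-sided Lipschitz bound for the term with 1/r^2. The difference of sines is 2 cos (f + p)
    sin (f - p). If M r <= 1 both factors are nonnegative and the left side is at most 0; otherwise
    1/r^2 < M^2. *)
Lemma sin_sub_le (f p r M : R) : 0 < r -> 0 <= M -> p < f -> Rabs f + Rabs p <= M * r ->
  - (sin (2 * f) - sin (2 * p)) / (2 * r ^ 2) <= M ^ 2 * (f - p).
Proof.
  intros hr hM hfp hb.
  assert (E : sin (2 * f) - sin (2 * p) = 2 * (cos (f + p) * sin (f - p))).
  { replace (2 * f) with ((f + p) + (f - p)) by ring. replace (2 * p) with ((f + p) - (f - p)) by ring.
    rewrite (sin_plus (f + p) (f - p)), (sin_minus (f + p) (f - p)). ring. }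
  rewrite E. replace (- (2 * (cos (f + p) * sin (f - p))) / (2 * r ^ 2)) with (- (cos (f + p) * sin (f - p)) / r ^ 2) by (field; lra).
  assert (hp3 := PI_gt_3). assert (r2 : 0 < r ^ 2) by (apply pow_lt; auto).
  apply Rmult_le_reg_r with (r ^ 2); auto. unfold Rdiv. rewrite Rmult_assoc, Rinv_l, Rmult_1_r by lra.
  assert (Rabs (f + p) <= M * r) by (eapply Rle_trans; [apply Rabs_triang|lra]).
  assert (Rabs (f - p) <= M * r) by (unfold Rminus; eapply Rle_trans; [apply Rabs_triang|rewrite Rabs_Ropp; lra]).
  apply Rabs_le_between in H. apply Rabs_le_between in H0.
  destruct (Rle_dec (M * r) 1) as [h|h].
  - assert (0 <= cos (f + p)) by (apply cos_ge_0; lra). assert (0 <= sin (f - p)) by (apply sin_ge_0; lra).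
    assert (0 <= M ^ 2 * (f - p) * r ^ 2) by (apply Rmult_le_pos; [apply Rmult_le_pos; [apply pow_le|]|]; lra). nra.
  - assert (A : Rabs (cos (f + p) * sin (f - p)) <= f - p).
    { rewrite Rabs_mult. assert (Rabs (cos (f + p)) <= 1) by (apply Rabs_le; apply COS_bound).
      assert (Rabs (sin (f - p)) <= f - p).
      { apply Rabs_le. split; [|left; apply sin_lt_x; lra]. assert (S := SIN_bound (f - p)).
        destruct (Rle_dec 1 (f - p)). lra. assert (0 <= sin (f - p)) by (apply sin_ge_0; lra). lra. }
      generalize (Rabs_pos (cos (f + p))) (Rabs_pos (sin (f - p))). nra. }
    apply Rabs_le_between in A. replace (M ^ 2 * (f - p) * r ^ 2) with ((M * r) ^ 2 * (f - p)) by ring.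
    assert (B : 1 <= (M * r) ^ 2) by (simpl; nra). assert (B2 : 1 * (f - p) <= (M * r) ^ 2 * (f - p)) by (apply Rmult_le_compat_r; lra). lra.
Qed.

(** Put x = 8 PI r. For r >= 0.62, just above the positive root of r^2 + r = 1, reflection at r = 1
    reduces the claim to 1 <= r (1 + r). For smaller r the factor 1 - r^2 is at least 0.6, which
    suffices once x >= 1.7. For x < 1.7 the bound sin x <= x - x^3/6 + x^5/120 works, with r^2 <=
    x^2/576 because 8 PI > 24. *)
Lemma forcing_sign r : 0 < r <= 1 -> sin (8 * PI * r) <= 8 * PI * r * (1 - r ^ 2).
Proof.
  intros hr. assert (hp := PI_gt_3). assert (hp4 := PI_4).
  destruct (Rle_dec (62 / 100) r) as [h|h].
  - assert (E : sin (8 * PI * r) = - sin (8 * PI * (1 - r))).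
    { replace (8 * PI * r) with (- (8 * PI * (1 - r)) + 2 * INR 4 * PI) by (simpl; ring).
      rewrite sin_period, sin_neg. reflexivity. }
    rewrite E. assert (A : - (8 * PI * (1 - r)) <= sin (8 * PI * (1 - r))).
    { set (x := 8 * PI * (1 - r)). assert (0 <= x) by (unfold x; nra).
      destruct (Rle_dec 1 x). generalize (SIN_bound x). lra.
      assert (0 <= sin x) by (apply sin_ge_0; lra). lra. }
    assert (8 * PI * (1 - r) <= 8 * PI * r * (1 - r ^ 2)); [|lra].
    replace (8 * PI * r * (1 - r ^ 2)) with (8 * PI * (1 - r) * (r * (1 + r))) by ring.
    assert (1 <= r * (1 + r)) by nra. assert (0 <= 8 * PI * (1 - r)) by nra. nra.
  - set (x := 8 * PI * r). assert (hx : 0 < x) by (unfold x; nra).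
    assert (hr2 : r ^ 2 <= 4 / 10) by (simpl; nra).
    destruct (Rle_dec (17 / 10) x) as [hx'|hx'].
    + generalize (SIN_bound x). nra.
    + assert (r * 24 <= x) by (unfold x; nra). assert (B : r ^ 2 * 576 <= x ^ 2) by (simpl; nra).
      destruct (sin_bound x 0) as [_ S]; try lra. unfold sin_approx, sin_term in S. simpl in S.
      apply Rle_trans with (1 := S).
      assert (x ^ 2 <= 289 / 100) by (simpl; nra).
      assert (0 <= x * (x ^ 2 / 6 - (x ^ 2) ^ 2 / 120 - r ^ 2)).
      { apply Rmult_le_pos. lra. assert (0 <= x ^ 2) by (apply pow2_ge_0). nra. }
      simpl in *. lra.
Qed.

(** * The truncated problem *)

(* As sin (2 c0) = 0, the function c0 r is a subsolution, see forcing_sign. *)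
Definition c0 : R := 4 * PI.
(** The constant of [psi_le]: G <= 16 (1 + y) and |h| <= 2 give twice 16^3, that is 8192, and the
    linear term 2 y fits into the remainder. *)
Definition kap : R := 10000.
(* Short enough for the solution to outlive the ramp: this is the lifespan given by ys_growth for zero data. *)
Definition t1 : R := / (4 * kap).
Lemma t1_pos : 0 < t1.
Proof. unfold t1, kap. lra. Qed.
Definition eta (t : R) : R := step (t / t1).
Lemma eta_range t : 0 <= eta t <= 1.
Proof. apply step_range. Qed.
Lemma eta_0 t : t <= 0 -> eta t = 0.
Proof.
  intros ht. apply step_0. apply Rmult_le_reg_r with t1. apply t1_pos. assert (a := t1_pos). field_simplify; lra.
Qed.
Lemma eta_1 t : t1 <= t -> eta t = 1.
Proof.
  intros ht. apply step_1. apply Rmult_le_reg_r with t1. apply t1_pos. assert (a := t1_pos). field_simplify; lra.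
Qed.

(* With phi = r G, the term (phi_r / r - sin (2 phi) / (2 r^2)) contributes Fr r G to the equation of G. *)
Definition Fr (r G : R) : R := G ^ 3 * h (r * G) - G.
Definition N0 (r s : R) : R := exp (- (r ^ 2 / 4)) * Fr r (c0 + exp (r ^ 2 / 4) * s).
(** Conjugating G_rr + 3 G_r / r - r G_r by exp (r^2/4) cancels the drift and leaves the coefficient
    2 - r^2/4. Only the nonlinear part is truncated and multiplied by the ramp value [et], so y = 0
    is a solution as long as et = 0. *)
Definition psi (et M r y : R) : R := (2 - r ^ 2 / 4) * y + et * N0 r (cut M y).

Definition exp_smf : smf := mksmf (fun _ => exp) (fun _ => is_derive_exp).
Definition cut_smf M : smf := proj1_sig (constructive_indefinite_description _ (cut_smf_ex M)).
Lemma cut_smfE M : sf (cut_smf M) 0 = cut M.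
Proof. exact (proj2_sig (constructive_indefinite_description _ (cut_smf_ex M))). Qed.
Definition eta_smf : smf := proj1_sig (constructive_indefinite_description _ (eta_smf_ex t1)).
Lemma eta_smfE : sf eta_smf 0 = eta.
Proof. exact (proj2_sig (constructive_indefinite_description _ (eta_smf_ex t1))). Qed.

Definition eG (s : expr) := Eadd (Ec c0) (Emul (Ecomp exp_smf (Emul (Ec (1 / 4)) (Emul Er Er))) s).
Definition eN (s : expr) := Emul (Ecomp exp_smf (Emul (Ec (-1 / 4)) (Emul Er Er)))
  (Eadd (Emul (Emul (eG s) (Emul (eG s) (eG s))) (Ecomp h_smf (Emul Er (eG s)))) (Emul (Ec (-1)) (eG s))).
Definition ePsi M := Eadd (Emul (Eadd (Ec 2) (Emul (Ec (-1 / 4)) (Emul Er Er))) Ey)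
  (Emul (Ecomp eta_smf Et) (eN (Ecomp (cut_smf M) Ey))).

Lemma eval_eN s t r y : eval (eN s) t r y = N0 r (eval s t r y).
Proof.
  unfold eN, eG, N0, Fr. simpl eval. rewrite h_smfE.
  replace (-1 / 4 * (r * r)) with (- (r ^ 2 / 4)) by field. replace (1 / 4 * (r * r)) with (r ^ 2 / 4) by field. simpl sf. ring.
Qed.
Lemma eval_ePsi M t r y : eval (ePsi M) t r y = psi (eta t) M r y.
Proof.
  unfold ePsi. cbn [eval]. rewrite eval_eN. cbn [eval]. rewrite eta_smfE, cut_smfE. unfold psi. field.
Qed.

Lemma h_even x : h (- x) = h x.
Proof.
  unfold h, trigI. apply RInt_ext. intros s _. replace (2 * s * - x) with (- (2 * s * x)) by ring. now rewrite cos_neg.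
Qed.
Lemma psi_even et M r y : psi et M (- r) y = psi et M r y.
Proof.
  unfold psi, N0, Fr. replace ((- r) ^ 2) with (r ^ 2) by ring.
  rewrite Ropp_mult_distr_l_reverse, h_even. reflexivity.
Qed.

Lemma psi_lip M : 0 < M -> exists L, 0 <= L /\ forall et r y z, 0 <= et <= 1 -> 0 <= r <= 1 -> Rabs (psi et M r y - psi et M r z) <= L * Rabs (y - z).
Proof.
  intros hM. destruct (cut_lip M hM) as [L1 [hL1 H1]].
  destruct (eval_lipschitz (eN Ey) (1 + 2 * M)) as [L2 [hL2 H2]].
  exists (2 + L2 * L1). split. nra. intros et r y z he hr.
  assert (A : Rabs (N0 r (cut M y) - N0 r (cut M z)) <= L2 * Rabs (cut M y - cut M z)).
  { assert (Ev : forall s, N0 r s = eval (eN Ey) 0 r s) by (intros s; now rewrite eval_eN).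
    rewrite !Ev. apply H2; try (eapply Rle_trans; [apply cut_bound; auto|lra]). rewrite Rabs_R0; lra. rewrite Rabs_pos_eq; lra. }
  unfold psi. replace ((2 - r ^ 2 / 4) * y + et * N0 r (cut M y) - ((2 - r ^ 2 / 4) * z + et * N0 r (cut M z)))
    with ((2 - r ^ 2 / 4) * (y - z) + et * (N0 r (cut M y) - N0 r (cut M z))) by ring.
  eapply Rle_trans. apply Rabs_triang. rewrite !Rabs_mult, Rmult_plus_distr_r.
  assert (0 <= r ^ 2 <= 1) by (simpl; nra).
  rewrite (Rabs_pos_eq (2 - r ^ 2 / 4)) by lra. rewrite (Rabs_pos_eq et) by lra.
  specialize (H1 y z). assert (B := Rabs_pos (y - z)). assert (C := Rabs_pos (N0 r (cut M y) - N0 r (cut M z))).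
  apply Rplus_le_compat. nra.
  apply Rle_trans with (L2 * Rabs (cut M y - cut M z)). nra. rewrite Rmult_assoc. apply Rmult_le_compat_l; auto.
Qed.

Lemma c0_bounds : 12 < c0 <= 16.
Proof. unfold c0. generalize PI_gt_3 PI_4. lra. Qed.
Lemma cut_range M y : 0 <= y -> 0 <= cut M y <= y.
Proof.
  intros hy. unfold cut. assert (a := step_range (2 - y / M)). assert (b := step_range (2 + y / M)).
  assert (0 <= step (2 - y / M) * step (2 + y / M) <= 1) by (split; nra). nra.
Qed.
Lemma expr2_bounds r : 0 <= r <= 1 -> 1 <= exp (r ^ 2 / 4) <= 2.
Proof.
  intros hr. assert (0 <= r ^ 2 / 4 <= / 2) by (simpl; nra). split. generalize (exp_ineq1_le (r^2/4)). lra.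
  assert (e := exp_ineq1_le (- (r ^ 2 / 4))). rewrite exp_Ropp in e.
  assert (p := exp_pos (r ^ 2 / 4)). assert (/2 <= / exp (r^2/4)) by lra.
  apply Rinv_le_contravar in H0; [|lra]. rewrite !Rinv_inv in H0. lra.
Qed.
Lemma exp_inv x : exp (- x) * exp x = 1.
Proof. rewrite <- exp_plus. replace (- x + x) with 0 by ring. apply exp_0. Qed.

Lemma psi_le M et r y : 0 <= et <= 1 -> 0 <= r <= 1 -> 0 <= y -> psi et M r y <= kap * (1 + y) ^ 3.
Proof.
  intros he hr hy. assert (hc := c0_bounds). assert (hcut := cut_range M y hy). assert (hE := expr2_bounds r hr).
  unfold psi, N0, Fr. set (E := exp (r ^ 2 / 4)) in *.
  set (G := c0 + E * cut M y).
  assert (hEc : 0 <= E * cut M y <= 2 * y) by (split; nra).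
  assert (hG : 0 < G <= 16 * (1 + y)) by (unfold G; lra).
  assert (hG3 : 0 <= G ^ 3 <= 4096 * (1 + y) ^ 3).
  { split. apply pow_le; lra. replace (4096 * (1 + y) ^ 3) with ((16 * (1 + y)) ^ 3) by ring. apply pow_incr. lra. }
  assert (hh := h_bound (r * G)). apply Rabs_le_between in hh.
  assert (e1 : 0 < exp (- (r ^ 2 / 4)) <= 1).
  { split. apply exp_pos. generalize (exp_inv (r ^ 2 / 4)) (exp_pos (- (r ^ 2 / 4))). fold E. nra. }
  assert (X : G ^ 3 * h (r * G) - G <= 2 * (4096 * (1 + y) ^ 3)) by nra.
  assert (y3 : 1 + y <= (1 + y) ^ 3) by (simpl; nra).
  assert (Y : et * (exp (- (r ^ 2 / 4)) * (G ^ 3 * h (r * G) - G)) <= 2 * (4096 * (1 + y) ^ 3)).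
  { rewrite <- Rmult_assoc. set (k := et * exp (- (r ^ 2 / 4))). assert (0 <= k <= 1) by (unfold k; split; nra). nra. }
  assert (Z : (2 - r ^ 2 / 4) * y <= 2 * y) by (assert (0 <= r ^ 2) by apply pow2_ge_0; nra).
  unfold kap. lra.
Qed.

Lemma Fr_c0 r : 0 < r <= 1 -> 0 <= Fr r c0.
Proof.
  intros hr. unfold Fr. assert (H := h_id (r * c0)). assert (F := forcing_sign r hr).
  replace (2 * (r * c0)) with (8 * PI * r) in H by (unfold c0; ring).
  assert (r3 : 0 < r ^ 3) by (apply pow_lt; lra).
  apply Rmult_le_reg_l with (r ^ 3); auto. rewrite Rmult_0_r.
  replace (r ^ 3 * (c0 ^ 3 * h (r * c0) - c0)) with ((r * c0) ^ 3 * h (r * c0) - c0 * r ^ 3) by ring.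
  rewrite H. unfold c0. simpl in *. lra.
Qed.
Lemma psi_0 M et r : 0 < M -> 0 <= et -> 0 < r <= 1 -> 0 <= psi et M r 0.
Proof.
  intros hM he hr. unfold psi, N0. rewrite cut_id by (auto; rewrite Rabs_R0; lra).
  rewrite !Rmult_0_r, Rplus_0_l, Rplus_0_r. apply Rmult_le_pos; auto. apply Rmult_le_pos. left; apply exp_pos. now apply Fr_c0.
Qed.

Lemma truncated_ex M : exists Y : nat -> R -> R -> R, 0 < M ->
  (forall k, XT (Y k)) /\ (forall k r t, is_derive (Y k r) t (Y (S k) r t)) /\ (forall r t, t <= 0 -> Y 0%nat r t = 0) /\
  (forall r t, Y 0%nat r t = lift K (fun r t => Fe (ePsi M) (Y 0%nat) r t - Y 1%nat r t) r t).
Proof.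
  destruct (Rlt_dec 0 M) as [hM|hM]; [|exists (fun _ _ _ => 0); lra].
  destruct (psi_lip M hM) as [L [hL HL]].
  destruct (evolution_ex (ePsi M) L hL) as [Y HY].
  - intros t r y z. rewrite !eval_ePsi. apply HL. apply eta_range. apply cl_range.
  - intros r t ht. rewrite eval_ePsi. unfold psi. rewrite eta_0 by auto. ring.
  - exists Y. intros _. exact HY.
Qed.
Definition YM M := proj1_sig (constructive_indefinite_description _ (truncated_ex M)).
Lemma YM_spec M : 0 < M -> 
  (forall k, XT (YM M k)) /\ (forall k r t, is_derive (YM M k r) t (YM M (S k) r t)) /\ (forall r t, t <= 0 -> YM M 0%nat r t = 0) /\
  (forall r t, YM M 0%nat r t = lift K (fun r t => Fe (ePsi M) (YM M 0%nat) r t - YM M 1%nat r t) r t).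
Proof. exact (proj2_sig (constructive_indefinite_description _ (truncated_ex M))). Qed.

(** * The truncated solution and its growth *)

Definition ys M := YM M 0.
Definition yst M := YM M 1.
(** By [ys_K] this is minus the radial Laplacian of [ys] in R^4, so y_r and y_rr have the explicit
    forms [ysr] and [ysrr]. *)
Definition qs M r t := Fe (ePsi M) (ys M) r t - yst M r t.
Definition ysr M r t := - (r * Ap 3 (qs M) r t).
Definition ysrr M r t := - qs M r t + 3 * Ap 3 (qs M) r t.

Lemma Ap_cont p w : XT w -> cont2 (Ap p w).
Proof.
  intros hw q. apply (continuous_RInt_par (fun (q : R * R) s => s ^ p * w (fst q * s) (snd q))). lra.
  intros u s _. apply (cont_mult (fun z : (R * R) * R => snd z ^ p)). apply cont_pow, continuous_snd.
  apply (continuous_comp (fun z : (R * R) * R => (fst (fst z) * snd z, snd (fst z))) (fun z : R * R => w (fst z) (snd z))); [|apply hw].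
  apply continuous_pair. apply (cont_mult (fun z : (R * R) * R => fst (fst z))). apply (continuous_comp fst fst); apply continuous_fst.
  apply continuous_snd. apply (continuous_comp fst snd). apply continuous_fst. apply continuous_snd.
Qed.

Section Truncated.
Context (M : R).
Hypothesis hM : 0 < M.

Lemma ys_XT : XT (ys M).
Proof. apply (YM_spec M hM). Qed.
Lemma qs_XT : XT (qs M).
Proof. apply XT_minus. apply Fe_XT, ys_XT. apply (YM_spec M hM). Qed.
Lemma ys_derive r t : is_derive (ys M r) t (yst M r t).
Proof. apply (YM_spec M hM). Qed.
Lemma ys_zero r t : t <= 0 -> ys M r t = 0.
Proof. apply (YM_spec M hM). Qed.
Lemma ys_K r t : ys M r t = K (fun x => qs M x t) r.
Proof. apply (YM_spec M hM). Qed.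
Lemma ys_class j k : Cc j k (ys M).
Proof.
  destruct (YM_spec M hM) as [h1 [h2 [h3 h4]]]. apply (solution_class (ePsi M) (YM M)); auto.
  intros t r y. rewrite !eval_ePsi. apply psi_even.
Qed.
Lemma ys_sm : sm (fun p => -1 < fst p < 1) (ys M).
Proof.
  apply CU_sm. apply open_and; [apply open_fst_gt|apply open_fst_lt].
  intros j k. apply (CU_of_Cc (j + k)); auto. apply ys_class.
Qed.
Lemma ys_cl r t : ys M r t = ys M (cl r) t.
Proof. apply ys_XT. Qed.
Lemma ys_1 t : ys M 1 t = 0.
Proof. rewrite ys_K. apply K_1. rewrite Rabs_R1. lra. Qed.
Lemma ys_r r t : -1 < r < 1 -> is_derive (fun x => ys M x t) r (ysr M r t).
Proof.
  intros hr. apply (is_derive_ext (K (fun x => qs M x t))). intros; symmetry; apply ys_K.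
  apply K_derive; auto. apply (XT_slice _ t qs_XT).
Qed.
Lemma ysr_r r t : 0 < r -> is_derive (fun x => ysr M x t) r (ysrr M r t).
Proof.
  intros hr. set (q := fun x => qs M x t).
  assert (hq : cont1 q) by apply (XT_slice _ t qs_XT).
  apply (is_derive_ext_loc (fun x => - ((x ^ 4 * A 3 q x) * (/ x) ^ 3))).
  - exists (mkposreal r hr). intros x hx. change (Rabs (x - r) < r) in hx. apply Rabs_def2 in hx.
    change (- (x ^ 4 * A 3 q x * (/ x) ^ 3) = - (x * A 3 q x)). field. lra.
  - eapply is_derive_val. apply is_derive_opp'. apply is_derive_mult'. now apply A_derive.
    apply (is_derive_pow (fun x => / x) 3). apply is_derive_inv. apply is_derive_i. lra.
    unfold ysrr. change (qs M r t) with (q r). change (Ap 3 (qs M) r t) with (A 3 q r). simpl. field. lra.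
Qed.
Lemma pde r t : 0 < r <= 1 -> yst M r t = ysrr M r t + 3 * ysr M r t / r + psi (eta t) M r (ys M r t).
Proof.
  intros hr. unfold ysrr, ysr. assert (E : qs M r t = psi (eta t) M r (ys M r t) - yst M r t).
  { unfold qs, Fe. rewrite eval_ePsi, cl_id by lra. reflexivity. }
  rewrite E. field. lra.
Qed.

(** Zero is a subsolution: the forcing at y = 0 is nonnegative by [psi_0], which rests on
    [forcing_sign]. The value at r = 0 follows by continuity. *)
Lemma ys_nonneg r t : 0 <= ys M r t.
Proof.
  destruct (Rle_dec t 0) as [ht|ht]. rewrite ys_zero; lra.
  assert (P : forall x, 0 < x <= 1 -> 0 <= ys M x t).
  { intros x hx. destruct (psi_lip M hM) as [L [hL HL]].
    assert (- ys M x t <= 0); [|lra].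
    apply (cmp_radial (fun r t => - ys M r t) (fun r t => - yst M r t) (fun r t => - ysr M r t) (fun r t => - ysrr M r t) 1 (-1) t L); try lra.
    - intros. apply cont_opp. apply ys_XT.
    - intros. rewrite ys_1. lra.
    - intros. rewrite ys_zero; lra.
    - intros. apply is_derive_opp'. apply ys_derive.
    - intros. apply is_derive_opp'. apply ys_r. lra.
    - intros. apply is_derive_opp'. apply ysr_r. lra.
    - intros y s hy hs hw. rewrite pde by lra.
      assert (a := HL (eta s) y (ys M y s) 0 (eta_range s) ltac:(lra)). rewrite Rminus_0_r, (Rabs_left (ys M y s)) in a by lra.
      apply Rabs_le_between in a. assert (b := psi_0 M (eta s) y hM ltac:(apply eta_range) ltac:(lra)).
      replace (3 * - ysr M y s / y) with (- (3 * ysr M y s / y)) by (field; lra). lra. }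
  rewrite ys_cl. destruct (Req_dec (cl r) 0) as [->|h]; [|apply P; generalize (cl_range r); lra].
  assert (- ys M 0 t <= 0); [|lra]. apply (le_at_0 (fun x => - ys M x t)).
  apply cont_opp. apply (XT_slice _ t ys_XT). intros x hx. specialize (P x hx). lra.
Qed.

(** Comparison with u (t) - 1, where u' = kap u^3 and u (s0) = 1 + N, that is u = D^(-1/2) with D
    linear in t. On the stated interval D keeps at least half of its initial value, so u stays below
    2 (1 + N). *)
Lemma ys_growth N s0 : 0 <= N -> (forall r, 0 <= r <= 1 -> ys M r s0 <= N) ->
  forall r t, 0 <= r <= 1 -> s0 <= t <= s0 + / (4 * kap * (1 + N) ^ 2) -> ys M r t <= 2 * (1 + N).
Proof.
  intros hN h0 r t hr ht.
  set (D := fun t => / (1 + N) ^ 2 - 2 * kap * (t - s0)).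
  assert (hN2 : 0 < (1 + N) ^ 2) by (apply pow_lt; lra).
  assert (hk : 0 < kap) by (unfold kap; lra).
  set (tb := s0 + / (4 * kap * (1 + N) ^ 2)) in *.
  assert (hD : forall t, t <= tb -> / (1 + N) ^ 2 / 2 <= D t).
  { intros s hs. unfold D. assert (s - s0 <= / (4 * kap * (1 + N) ^ 2)) by (unfold tb in hs; lra).
    assert (2 * kap * (s - s0) <= 2 * kap * / (4 * kap * (1 + N) ^ 2)) by (apply Rmult_le_compat_l; lra).
    replace (2 * kap * / (4 * kap * (1 + N) ^ 2)) with (/ (1 + N) ^ 2 / 2) in H0 by (field; lra). lra. }
  assert (hi : 0 < / (1 + N) ^ 2) by (apply Rinv_0_lt_compat; auto).
  assert (hDp : forall t, t <= tb -> 0 < D t) by (intros s hs; specialize (hD s hs); lra).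
  set (u := fun t => / sqrt (D t)).
  assert (us : forall t, t <= tb -> 0 < sqrt (D t)) by (intros; apply sqrt_lt_R0; auto).
  assert (up : forall t, t <= tb -> 0 < u t) by (intros; apply Rinv_0_lt_compat; auto).
  assert (du : forall t, t <= tb -> is_derive u t (kap * u t ^ 3)).
  { intros s hs. assert (a := us s hs). eapply is_derive_val. apply is_derive_inv; [|lra].
    apply is_derive_sqrt; [|now apply hDp]. unfold D. apply is_derive_minus'. apply is_derive_c.
    apply (is_derive_scal' (fun t => t - s0)). apply is_derive_minus'. apply is_derive_i. apply is_derive_c.
    unfold u. simpl. change (/ ((1 + N) * ((1 + N) * 1)) - 2 * kap * (s - s0)) with (D s). field. lra. }
  destruct (XT_bounded (ys M) (Rabs s0 + Rabs tb) ys_XT) as [B [hB HB]].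
  assert (hub : forall t, t <= tb -> u t <= 2 * (1 + N)).
  { intros s hs. unfold u. rewrite <- (Rinv_inv (2 * (1 + N))). apply Rinv_le_contravar.
    apply Rinv_0_lt_compat; lra. apply Rsqr_incr_0_var. 2: left; auto. rewrite Rsqr_sqrt by (left; auto).
    eapply Rle_trans. 2: apply hD; auto. unfold Rsqr.
    replace (/ (2 * (1 + N)) * / (2 * (1 + N))) with (/ (1 + N) ^ 2 / 4) by (field; lra). lra. }
  assert (uN : u s0 = 1 + N).
  { unfold u, D. replace (/ (1 + N) ^ 2 - 2 * kap * (s0 - s0)) with ((/ (1 + N)) ^ 2) by (field; lra).
    rewrite sqrt_pow2. apply Rinv_inv. left. apply Rinv_0_lt_compat. lra. }
  assert (hstb : s0 <= tb) by lra.
  assert (P : forall x, 0 < x <= 1 -> ys M x t - (u t - 1) <= 0).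
  { intros x hx.
    (* The a priori bound B only provides a Lipschitz constant of the cube for the comparison; the
       resulting estimate is free of B and of M. *)
    apply (cmp_radial (fun r t => ys M r t - (u t - 1)) (fun r t => yst M r t - kap * u t ^ 3) (ysr M) (ysrr M) 1 s0 tb (kap * (3 * (1 + B) ^ 2))); try lra.
    - apply Rmult_le_pos. lra. assert (0 <= (1 + B) ^ 2) by apply pow2_ge_0. lra.
    - intros y s hy hs. apply cont_minus. apply ys_XT. apply (cont_comp snd (fun t => u t - 1)). apply continuous_snd.
      apply (ex_derive_continuous (V := R_NormedModule)). eexists. apply is_derive_minus'. apply du. simpl; lra. apply is_derive_c.
    - intros s hs. rewrite ys_1. assert (1 <= u s); [|lra].
      unfold u. rewrite <- Rinv_1. apply Rinv_le_contravar. apply us; lra.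
      rewrite <- sqrt_1. apply sqrt_le_1_alt. unfold D.
      assert (/ (1 + N) ^ 2 <= 1). { rewrite <- Rinv_1 at 2. apply Rinv_le_contravar. lra. simpl; nra. }
      assert (0 <= 2 * kap * (s - s0)) by (apply Rmult_le_pos; lra). lra.
    - intros y hy. rewrite uN. specialize (h0 y ltac:(lra)). lra.
    - intros y s hy hs. eapply is_derive_val. apply is_derive_minus'. apply ys_derive. apply is_derive_minus'. apply du; lra. apply is_derive_c. ring.
    - intros y s hy hs. eapply is_derive_val. apply is_derive_minus'. apply ys_r; lra. apply is_derive_c. ring.
    - intros y s hy hs. apply ysr_r; lra.
    - intros y s hy hs hw. rewrite pde by lra. assert (a := psi_le M (eta s) y (ys M y s) (eta_range s) ltac:(lra) (ys_nonneg y s)).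
      assert (b := HB y s). assert (Rabs s <= Rabs s0 + Rabs tb).
      { apply Rabs_le. assert (q1 := Rle_abs s0). assert (q2 := Rle_abs tb). assert (q3 := Rle_abs (- s0)). assert (q4 := Rle_abs (- tb)).
        rewrite Rabs_Ropp in q3, q4. split; lra. }
      specialize (b H). rewrite Rabs_pos_eq in b by apply ys_nonneg. assert (up' := up s ltac:(lra)). assert (yn := ys_nonneg y s).
      set (Y := 1 + ys M y s) in *. set (U := u s) in *. assert (hYU : 0 < Y - U) by (unfold Y; lra).
      assert (X : Y ^ 3 - U ^ 3 <= 3 * (1 + B) ^ 2 * (Y - U)).
      { replace (Y ^ 3 - U ^ 3) with ((Y ^ 2 + Y * U + U ^ 2) * (Y - U)) by ring. apply Rmult_le_compat_r. lra.
        assert (Y <= 1 + B) by (unfold Y; lra). assert (Y ^ 2 <= (1 + B) ^ 2) by (apply pow_incr; lra). simpl in *. nra. }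
      assert (X' : kap * (Y ^ 3 - U ^ 3) <= kap * (3 * (1 + B) ^ 2 * (Y - U))) by (apply Rmult_le_compat_l; lra).
      replace (ys M y s - (U - 1)) with (Y - U) by (unfold Y; ring). lra. }
  assert (P' : forall x, 0 < x <= 1 -> ys M x t <= 2 * (1 + N)).
  { intros x hx. specialize (P x hx). specialize (hub t ltac:(lra)). lra. }
  destruct (Req_dec r 0) as [->|hr0]; [|apply P'; lra].
  apply (le_at_0 (fun x => ys M x t)); auto. apply (XT_slice _ t ys_XT).
Qed.
End Truncated.

Lemma cut_same M M' y : 0 < M <= M' -> 0 <= y <= M -> cut M' y = cut M y.
Proof. intros h hy. rewrite !cut_id; auto; try rewrite Rabs_pos_eq; lra. Qed.

Lemma ys_compare M M' L T : 0 < M -> 0 < M' -> 0 <= L ->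
  (forall r t, 0 < r <= 1 -> 0 < t <= T -> psi (eta t) M r (ys M r t) - psi (eta t) M' r (ys M' r t) <= L * Rabs (ys M r t - ys M' r t)) ->
  forall r t, 0 < r <= 1 -> 0 <= t <= T -> ys M r t - ys M' r t <= 0.
Proof.
  intros hM hM' hL H r t hr ht.
  apply (cmp_radial (fun r t => ys M r t - ys M' r t) (fun r t => yst M r t - yst M' r t) (fun r t => ysr M r t - ysr M' r t) (fun r t => ysrr M r t - ysrr M' r t) 1 0 t L); try lra.
  - intros. apply cont_minus; now apply ys_XT.
  - intros. rewrite !ys_1; auto; lra.
  - intros. rewrite !ys_zero; auto; lra.
  - intros. apply is_derive_minus'; now apply ys_derive.
  - intros. apply is_derive_minus'; apply ys_r; auto; lra.
  - intros. apply is_derive_minus'; apply ysr_r; auto; lra.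
  - intros x s hx hs hw. rewrite !pde by (auto; lra). specialize (H x s ltac:(lra) ltac:(lra)). rewrite Rabs_pos_eq in H by lra.
    replace (3 * (ysr M x s - ysr M' x s) / x) with (3 * ysr M x s / x - 3 * ysr M' x s / x) by (field; lra). lra.
Qed.

(** On [0, M] the truncations at M and M' are both the identity, so up to T the function [ys M] also
    solves the problem truncated at M'. Comparison in both directions gives equality. *)
Lemma ys_unique M M' T : 0 < M <= M' -> (forall r t, t <= T -> ys M r t <= M) ->
  forall r t, t <= T -> ys M' r t = ys M r t.
Proof.
  intros hM hg r t ht.
  assert (hM0 : 0 < M) by lra. assert (hM' : 0 < M') by lra.
  destruct (Rle_dec t 0) as [h0|h0]. rewrite !ys_zero; auto.
  destruct (psi_lip M' hM') as [L [hL HL]].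
  assert (H : forall x s, 0 < x <= 1 -> 0 < s <= T -> Rabs (psi (eta s) M x (ys M x s) - psi (eta s) M' x (ys M' x s)) <= L * Rabs (ys M x s - ys M' x s)).
  { intros x s hx hs. replace (psi (eta s) M x (ys M x s)) with (psi (eta s) M' x (ys M x s)). apply HL. apply eta_range. lra.
    unfold psi. rewrite (cut_same M M'); auto. split. now apply ys_nonneg. apply hg. lra. }
  assert (P1 : forall x, 0 < x <= 1 -> ys M x t - ys M' x t <= 0).
  { intros x hx. apply (ys_compare M M' L T); auto; try lra. intros y s hy hs. eapply Rle_trans. apply Rle_abs. now apply H. }
  assert (P2 : forall x, 0 < x <= 1 -> ys M' x t - ys M x t <= 0).
  { intros x hx. apply (ys_compare M' M L T); auto; try lra. intros y s hy hs.
    rewrite (Rabs_minus_sym (ys M' y s)). eapply Rle_trans; [|now apply H]. rewrite Rabs_minus_sym. apply Rle_abs. }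
  rewrite (ys_cl M'), (ys_cl M) by auto. assert (hr := cl_range r).
  assert (c1 := proj1 (XT_slice _ t (ys_XT M hM0)) 0). assert (c2 := proj1 (XT_slice _ t (ys_XT M' hM')) 0).
  apply Rle_antisym; apply Rminus_le; (destruct (Req_dec (cl r) 0) as [->|hne]; [|(apply P2 || apply P1); lra]).
  - apply (le_at_0 (fun x => ys M' x t - ys M x t)); auto. now apply cont_minus.
  - apply (le_at_0 (fun x => ys M x t - ys M' x t)); auto. now apply cont_minus.
Qed.

(** * Monotonicity of the profile *)

Lemma sm_schwarz U f x y : open U -> sm U f -> U (x, y) -> pdx (pdt f) x y = pdt (pdx f) x y.
Proof.
  intros hU hf h. unfold pdx, pdt.
  apply Schwarz.
  - apply locally_2d_locally. apply (filter_imp U); [|exact (hU _ h)]. intros [u v] huv. simpl.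
    split; [apply (hf nil u v huv)|split; [apply (hf nil u v huv)|split]].
    apply (hf (false :: nil) u v huv). apply (hf (true :: nil) u v huv).
  - apply continuity_2d_pt_filterlim. apply (hf (true :: false :: nil) x y h).
  - apply continuity_2d_pt_filterlim. apply (hf (false :: true :: nil) x y h).
Qed.

Definition gs M r t := c0 + exp (r ^ 2 / 4) * ys M r t.
Definition gsr M r t := exp (r ^ 2 / 4) * (ysr M r t + r / 2 * ys M r t).
(** The equation of G solved for G_rr. In this form a further r-derivative asks only for the mixed
    derivative of [ys]. *)
Definition gsrr M r t := exp (r ^ 2 / 4) * yst M r t - 3 * gsr M r t / r + r * gsr M r t - eta t * Fr r (gs M r t).

Lemma is_derive_E r : is_derive (fun x => exp (x ^ 2 / 4)) r (exp (r ^ 2 / 4) * (r / 2)).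
Proof.
  apply (is_derive_comp' exp (fun x => x ^ 2 / 4)). apply is_derive_exp. auto_derive; auto. field.
Qed.

Section Profile.
Context (M T : R).
Hypotheses (hM : 0 < M) (hg : forall r t, t <= T -> ys M r t <= M).

Lemma gs_ge r t : c0 <= gs M r t.
Proof.
  unfold gs. assert (0 <= exp (r ^ 2 / 4) * ys M r t); [|lra].
  apply Rmult_le_pos. left; apply exp_pos. now apply ys_nonneg.
Qed.
Lemma gs_le r t : 0 <= r <= 1 -> gs M r t <= 16 + 2 * ys M r t.
Proof.
  intros hr. unfold gs. assert (a := c0_bounds). assert (b := expr2_bounds r hr). assert (c := ys_nonneg M hM r t). nra.
Qed.
Lemma gs_r r t : -1 < r < 1 -> is_derive (fun x => gs M x t) r (gsr M r t).
Proof.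
  intros hr. unfold gs, gsr. eapply is_derive_val. apply is_derive_plus'. apply is_derive_c. apply is_derive_mult'.
  apply is_derive_E. now apply ys_r. cbv beta. field.
Qed.
Lemma gs_t r t : is_derive (gs M r) t (exp (r ^ 2 / 4) * yst M r t).
Proof.
  unfold gs. eapply is_derive_val. apply is_derive_plus'. apply is_derive_c. apply is_derive_scal'. now apply ys_derive. ring.
Qed.
Lemma psi_good r t : t <= T -> psi (eta t) M r (ys M r t) = (2 - r ^ 2 / 4) * ys M r t + eta t * (exp (- (r ^ 2 / 4)) * Fr r (gs M r t)).
Proof.
  intros ht. unfold psi, N0, gs. rewrite cut_id; auto. rewrite Rabs_pos_eq; auto. now apply ys_nonneg.
Qed.
Lemma gsr_r r t : 0 < r < 1 -> t <= T -> is_derive (fun x => gsr M x t) r (gsrr M r t).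
Proof.
  intros hr ht. unfold gsr at 1. eapply is_derive_val. apply is_derive_mult'. apply is_derive_E.
  apply is_derive_plus'. apply ysr_r; auto; lra. apply is_derive_mult'.
  apply (is_derive_mult' (fun x => x) (fun _ => / 2)). apply is_derive_i. apply is_derive_c. apply ys_r; auto; lra.
  cbv beta. unfold gsrr. rewrite pde by (auto; lra). rewrite psi_good by auto. unfold gsr.
  assert (e := exp_inv (r ^ 2 / 4)). set (E := exp (r ^ 2 / 4)) in *. set (E' := exp (- (r ^ 2 / 4))) in *.
  replace (E * (ysrr M r t + 3 * ysr M r t / r + ((2 - r ^ 2 / 4) * ys M r t + eta t * (E' * Fr r (gs M r t))))) with
   (E * (ysrr M r t + 3 * ysr M r t / r + (2 - r ^ 2 / 4) * ys M r t) + (E' * E) * (eta t * Fr r (gs M r t))) by ring.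
  rewrite e. field. lra.
Qed.

Definition ysrt r t := pdx (pdt (ys M)) r t.
Lemma yst_r r t : -1 < r < 1 -> is_derive (fun x => yst M x t) r (ysrt r t).
Proof.
  intros hr. assert (hs := ys_sm M hM). unfold ysrt.
  apply (is_derive_ext (fun x => pdt (ys M) x t)).
  { intros x. apply is_derive_unique. now apply ys_derive. }
  apply Derive_correct. apply (hs (false :: nil) r t hr).
Qed.
Lemma ysr_t r t : -1 < r < 1 -> is_derive (ysr M r) t (ysrt r t).
Proof.
  intros hr. assert (hs := ys_sm M hM). unfold ysrt.
  rewrite (sm_schwarz (fun p => -1 < fst p < 1)); auto. 2: apply open_and; [apply open_fst_gt|apply open_fst_lt].
  apply (is_derive_ext (fun s => pdx (ys M) r s)).
  { intros s. apply is_derive_unique. now apply ys_r. }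
  apply Derive_correct. apply (hs (true :: nil) r t hr).
Qed.

Lemma Fr_r r t : 0 < r < 1 -> is_derive (fun x => Fr x (gs M x t)) r
  (3 * gs M r t ^ 2 * gsr M r t * h (r * gs M r t) + gs M r t ^ 3 * (h' (r * gs M r t) * (gs M r t + r * gsr M r t)) - gsr M r t).
Proof.
  intros hr. unfold Fr. assert (D := gs_r r t ltac:(lra)). eapply is_derive_val. apply is_derive_minus'; [|exact D].
  apply is_derive_mult'. apply (is_derive_pow (fun x => gs M x t) 3). exact D.
  apply (is_derive_comp' h (fun x => x * gs M x t)). apply h_derive.
  apply (is_derive_mult' (fun x => x)). apply is_derive_i. exact D. simpl. ring.
Qed.

Lemma gsrr_r r t : 0 < r < 1 -> t <= T -> is_derive (fun x => gsrr M x t) r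
  (exp (r ^ 2 / 4) * (ysrt r t + r / 2 * yst M r t) - 3 * (gsrr M r t / r - gsr M r t / r ^ 2) + gsr M r t + r * gsrr M r t
   - eta t * (3 * gs M r t ^ 2 * gsr M r t * h (r * gs M r t) + gs M r t ^ 3 * (h' (r * gs M r t) * (gs M r t + r * gsr M r t)) - gsr M r t)).
Proof.
  intros hr ht. assert (D := gsr_r r t hr ht). unfold gsrr at 1. eapply is_derive_val.
  apply is_derive_minus'. 2: { apply is_derive_scal'. now apply Fr_r. }
  apply is_derive_plus'. apply is_derive_minus'.
  apply is_derive_mult'. apply is_derive_E. apply yst_r; lra.
  unfold Rdiv. apply is_derive_mult'. apply is_derive_scal'. exact D. apply is_derive_inv. apply is_derive_i. lra.
  apply (is_derive_mult' (fun x => x)). apply is_derive_i. exact D. cbv beta. field. lra.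
Qed.

(** A positive slope at r = 1, where [ys] vanishes, would make it negative just inside. *)
Lemma ysr_1_nonpos t : ysr M 1 t <= 0.
Proof.
  destruct (Rle_dec (ysr M 1 t) 0) as [|hn]; auto. exfalso.
  set (q := fun x => qs M x t). assert (hq : inX q) by (apply (XT_slice _ t (qs_XT M hM))).
  assert (cq : continuous (fun x => - (x * A 3 q x)) 1).
  { apply cont_opp. apply cont_mult. apply continuous_id. apply A_cont, hq. }
  change (~ - (1 * A 3 q 1) <= 0) in hn.
  destruct (proj1 (continuous_eps _ _) cq (- (1 * A 3 q 1))) as [d Hd]. lra.
  assert (hd := cond_pos d). set (x := 1 - Rmin (d / 2) (/2)).
  assert (0 < Rmin (d / 2) (/2)) by (apply Rmin_pos; lra). assert (Rmin (d / 2) (/2) <= d / 2) by apply Rmin_l.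
  assert (Rmin (d / 2) (/2) <= /2) by apply Rmin_r.
  destruct (mvt (Kt q) (fun x => - (x * A 3 q x)) x 1) as [c [hc E]].
  { intros y _. apply Kt_derive, hq. }
  rewrite Rmin_left, Rmax_right in hc by (unfold x; lra).
  specialize (Hd c). assert (B : Rabs (- (c * A 3 q c) - - (1 * A 3 q 1)) < - (1 * A 3 q 1)).
  { apply Hd. change (Rabs (c - 1) < d). apply Rabs_def1; unfold x in hc; lra. }
  apply Rabs_def2 in B. assert (0 < - (c * A 3 q c)) by lra.
  rewrite <- !K_Kt in E by (auto; unfold x; lra). rewrite (K_1 q 1) in E by (rewrite Rabs_R1; lra).
  assert (P := ys_nonneg M hM x t). rewrite ys_K in P by auto. change (0 <= K q x) in P. unfold x in *. nra.
Qed.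

(* The comparison starts at t = -1, where the solution vanishes identically. *)
Lemma gsr_nonpos r t : 0 <= r <= 1 -> -1 <= t <= T -> gsr M r t <= 0.
Proof.
  intros hr ht. destruct (XT_bounded (ys M) (1 + Rabs T) (ys_XT M hM)) as [B [hB HB]].
  assert (e0 : forall x, 0 < exp (x ^ 2 / 4)) by (intros; apply exp_pos).
  apply (cmp (gsr M) (fun r t => exp (r ^ 2 / 4) * (ysrt r t + r / 2 * yst M r t)) (gsrr M)
    (fun r t => exp (r ^ 2 / 4) * (ysrt r t + r / 2 * yst M r t) - 3 * (gsrr M r t / r - gsr M r t / r ^ 2) + gsr M r t + r * gsrr M r t
   - eta t * (3 * gs M r t ^ 2 * gsr M r t * h (r * gs M r t) + gs M r t ^ 3 * (h' (r * gs M r t) * (gs M r t + r * gsr M r t)) - gsr M r t))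
    1 (-1) T (6 * (16 + 2 * B) ^ 2)); try lra.
  - apply Rmult_le_pos. lra. apply pow2_ge_0.
  - intros x s hx hs. unfold gsr. apply cont_mult.
    + apply (cont_comp fst (fun x => exp (x ^ 2 / 4))). apply continuous_fst. apply (ex_derive_continuous (V := R_NormedModule)). eexists. apply is_derive_E.
    + apply cont_plus. unfold ysr. apply cont_opp. apply (cont_mult fst). apply continuous_fst. apply Ap_cont. now apply qs_XT.
      apply cont_mult; [|apply (ys_XT M hM)]. apply (cont_mult fst). apply continuous_fst. apply continuous_const.
  - intros s hs. unfold gsr, ysr. right. field.
  - intros s hs. unfold gsr. rewrite ys_1 by auto. assert (a := ysr_1_nonpos s). specialize (e0 1). nra.
  - intros x hx. assert (Z : forall s, s < 0 -> forall x, qs M x s = 0).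
    { intros s hs y. unfold qs, Fe. rewrite eval_ePsi, ys_zero by (auto; lra). unfold psi. rewrite eta_0 by lra.
      assert (yst M y s = 0); [|lra]. rewrite <- (is_derive_unique _ _ _ (ys_derive M hM y s)).
      apply is_derive_unique. apply (is_derive_ext_loc (fun _ => 0)); [|apply is_derive_c].
      exists (mkposreal (- s) ltac:(lra)). intros z hz. change (Rabs (z - s) < - s) in hz. apply Rabs_def2 in hz.
      symmetry. apply ys_zero; auto; lra. }
    unfold gsr, ysr, Ap, A. rewrite (RInt_ext _ (fun _ => 0)).
    + rewrite RInt_const. unfold scal; simpl; unfold mult; simpl. rewrite ys_zero by (auto; lra). right. field.
    + intros y _. rewrite Z by lra. rring.
  - intros x s hx hs. unfold gsr. eapply is_derive_val. apply is_derive_scal'. apply is_derive_plus'.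
    apply ysr_t; lra. apply is_derive_scal'. now apply ys_derive. ring.
  - intros x s hx hs. apply gsr_r; lra.
  - intros x s hx hs. apply gsrr_r; lra.
  (* The time derivatives cancel. Of the rest, 3 p / x^2 has the good sign, the term with h' is
     nonpositive because h' <= 0 and G + x p > 0, and what remains is bounded by the constant of the
     comparison times p. *)
  - intros x s hx hs hw hz. rewrite hz.
    assert (G1 := gs_ge x s). assert (G2 := gs_le x s ltac:(lra)). assert (cb := c0_bounds).
    assert (b := HB x s). assert (Rabs s <= 1 + Rabs T).
    { apply Rabs_le. generalize (Rle_abs T) (Rabs_pos T). lra. }
    specialize (b H). rewrite Rabs_pos_eq in b by now apply ys_nonneg.
    set (G := gs M x s) in *. set (p := gsr M x s) in *.
    assert (hh := h_bound (x * G)). apply Rabs_le_between in hh.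
    assert (hh' : h' (x * G) <= 0) by (apply h'_nonpos; nra).
    assert (G2p : 0 < G ^ 2) by (apply pow_lt; lra). assert (G3p : 0 < G ^ 3) by (apply pow_lt; lra).
    assert (X1 : 3 * G ^ 2 * p * h (x * G) <= 6 * G ^ 2 * p).
    { replace (6 * G ^ 2 * p) with (3 * G ^ 2 * p * 2) by ring. apply Rmult_le_compat_l; [|lra].
      apply Rmult_le_pos; lra. }
    assert (X2 : G ^ 3 * (h' (x * G) * (G + x * p)) <= 0).
    { assert (0 <= G + x * p) by nra. assert (h' (x * G) * (G + x * p) <= 0) by nra. nra. }
    assert (X3 : 6 * G ^ 2 * p <= 6 * (16 + 2 * B) ^ 2 * p).
    { apply Rmult_le_compat_r. lra. apply Rmult_le_compat_l. lra. apply pow_incr. lra. }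
    assert (he := eta_range s).
    set (Z := 3 * G ^ 2 * p * h (x * G) + G ^ 3 * (h' (x * G) * (G + x * p)) - p).
    assert (X4 : eta s * Z <= 6 * (16 + 2 * B) ^ 2 * p).
    { assert (0 <= 6 * (16 + 2 * B) ^ 2 * p) by (apply Rle_trans with (2 := X3); apply Rmult_le_pos; lra). unfold Z. set (zz := _ - p). assert (zz <= 6 * (16 + 2 * B) ^ 2 * p) by (unfold zz; lra).
      destruct (Rle_dec 0 zz); nra. }
    assert (0 < p / x ^ 2) by (apply Rdiv_lt_0_compat; [auto|apply pow_lt; lra]).
    replace (0 / x) with 0 by (field; lra). lra.
Qed.

(** [gs] decreases in r and exp (r^2/4) >= 1, so y cannot exceed its value at the centre. *)
Lemma ys_le_0 r t : 0 <= r <= 1 -> t <= T -> ys M r t <= ys M 0 t.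
Proof.
  intros hr ht. destruct (Rle_dec t 0). rewrite !ys_zero; auto; lra.
  destruct (Req_dec r 1) as [->|]. rewrite ys_1 by auto. now apply ys_nonneg.
  destruct (mvt (fun x => gs M x t) (fun x => gsr M x t) 0 r) as [c [hc E]].
  { intros x. rewrite Rmin_left, Rmax_right by lra. intros hx. apply gs_r. lra. }
  rewrite Rmin_left, Rmax_right in hc by lra. assert (a := gsr_nonpos c t ltac:(lra) ltac:(lra)).
  assert (gs M r t <= gs M 0 t) by nra. unfold gs in H0.
  replace (0 ^ 2 / 4) with 0 in H0 by field. rewrite exp_0 in H0.
  assert (b := expr2_bounds r hr). assert (c' := ys_nonneg M hM r t). nra.
Qed.

Definition phs r t := r * gs M r t.
Definition phsr r t := gs M r t + r * gsr M r t.
Definition phsrr r t := 2 * gsr M r t + r * gsrr M r t.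
Lemma phs_r r t : -1 < r < 1 -> is_derive (fun x => phs x t) r (phsr r t).
Proof.
  intros hr. unfold phs. eapply is_derive_val. apply (is_derive_mult' (fun x => x)). apply is_derive_i. now apply gs_r.
  unfold phsr. ring.
Qed.
Lemma phsr_r r t : 0 < r < 1 -> t <= T -> is_derive (fun x => phsr x t) r (phsrr r t).
Proof.
  intros hr ht. unfold phsr. eapply is_derive_val. apply is_derive_plus'. apply gs_r; lra.
  apply (is_derive_mult' (fun x => x)). apply is_derive_i. now apply gsr_r. unfold phsrr. ring.
Qed.
Lemma phs_pde r t : 0 < r < 1 -> t1 <= t <= T ->
  r * (exp (r ^ 2 / 4) * yst M r t) + r * phsr r t = phsrr r t + phsr r t / r - sin (2 * phs r t) / (2 * r ^ 2).
Proof.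
  intros hr ht. unfold phsr, phsrr, phs, gsrr. rewrite eta_1 by lra. unfold Fr.
  assert (H := h_id (r * gs M r t)). set (G := gs M r t) in *.
  replace (sin (2 * (r * G))) with (2 * (r * G - (r * G) ^ 3 * h (r * G))) by (rewrite H; field).
  field. lra.
Qed.
Lemma phs_t r t : is_derive (phs r) t (r * (exp (r ^ 2 / 4) * yst M r t)).
Proof. unfold phs. apply is_derive_scal'. apply gs_t. Qed.
Lemma phs_cont r t : continuous (fun p : R * R => phs (fst p) (snd p)) (r, t).
Proof.
  unfold phs, gs. apply (cont_mult fst). apply continuous_fst. apply cont_plus. apply continuous_const. apply cont_mult.
  apply (cont_comp fst (fun x => exp (x ^ 2 / 4))). apply continuous_fst. apply (ex_derive_continuous (V := R_NormedModule)). eexists. apply is_derive_E.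
  apply (ys_XT M hM).
Qed.
Lemma phs_bounds r t : 0 <= r <= 1 -> t <= T -> c0 * r <= phs r t <= (16 + 2 * M) * r.
Proof.
  intros hr ht. unfold phs. assert (a := gs_ge r t). assert (b := gs_le r t hr). assert (c := hg r t ht). split; nra.
Qed.
End Profile.

(** * The subsolution and the maximal time *)

Lemma sin_2atan x : sin (2 * atan x) = 2 * x / (1 + x ^ 2).
Proof.
  rewrite sin_2a, sin_atan, cos_atan. assert (0 < 1 + x²) by (generalize (Rle_0_sqr x); lra).
  assert (S := sqrt_lt_R0 _ H). assert (E := sqrt_sqrt (1 + x²) ltac:(lra)).
  replace (1 + x ^ 2) with (sqrt (1 + x²) * sqrt (1 + x²)) by (rewrite E; unfold Rsqr; ring). field. lra.
Qed.
Lemma cos_2atan x : cos (2 * atan x) = (1 - x ^ 2) / (1 + x ^ 2).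
Proof.
  rewrite cos_2a_cos, cos_atan. assert (0 < 1 + x²) by (generalize (Rle_0_sqr x); lra).
  assert (S := sqrt_lt_R0 _ H). assert (E := sqrt_sqrt (1 + x²) ltac:(lra)).
  replace (1 / sqrt (1 + x²)) with (/ sqrt (1 + x²)) by (field; lra).
  replace (2 * / sqrt (1 + x²) * / sqrt (1 + x²)) with (2 * / (sqrt (1 + x²) * sqrt (1 + x²))) by (field; lra).
  rewrite E. unfold Rsqr. field. simpl. unfold Rsqr in H. lra.
Qed.
Lemma atan_le x : 0 <= x -> 0 <= atan x <= x.
Proof.
  intros hx. split.
  - destruct (Req_dec x 0) as [->|]. rewrite atan_0; lra. left. rewrite <- atan_0. apply atan_increasing. lra.
  - assert (H : 0 - atan 0 <= x - atan x); [|rewrite atan_0 in H; lra].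
    apply (nondec_of_derive (fun x => x - atan x) (fun x => 1 - / (1 + x²))); auto.
    + intros y _. apply is_derive_minus'. apply is_derive_i. apply is_derive_atan.
    + intros y _. assert (0 < / (1 + y²) <= / 1).
      { split. apply Rinv_0_lt_compat. generalize (Rle_0_sqr y); lra. apply Rinv_le_contravar; generalize (Rle_0_sqr y); lra. }
      rewrite Rinv_1 in H. lra.
Qed.

Lemma sin_add_le a b : 0 <= b -> sin (a + 2 * b) <= sin a + 2 * b.
Proof.
  intros hb. destruct (Req_dec b 0) as [->|hn]. rewrite Rmult_0_r, Rplus_0_r. lra.
  destruct (MVT_cor2 sin cos a (a + 2 * b)) as [c [hc _]]. lra.
  intros; apply is_derive_Reals, is_derive_sin. generalize (COS_bound c). nra.
Qed.

(* The bubble 2 atan (r / l) is an exact stationary solution of the equation without drift;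
   4 r^(3/2) produces the margin 5 / sqrt r that absorbs the time derivative and the drift. *)
Lemma subsolution_ineq r m : 0 < r <= /2 -> 0 < m <= 1 ->
  2 * r * m / ((m ^ 2) ^ 2 + r ^ 2) + r * (2 * m ^ 2 / ((m ^ 2) ^ 2 + r ^ 2) + 6 * sqrt r) <=
  (- 4 * m ^ 2 * r / ((m ^ 2) ^ 2 + r ^ 2) ^ 2 + 3 / sqrt r) + (2 * m ^ 2 / ((m ^ 2) ^ 2 + r ^ 2) + 6 * sqrt r) / r
  - sin (2 * (2 * atan (r / m ^ 2) + 4 * (r * sqrt r))) / (2 * r ^ 2).
Proof.
  intros hr hm. set (l := m ^ 2). assert (hl : 0 < l) by (apply pow_lt; lra).
  set (s := sqrt r). assert (hs : 0 < s) by (apply sqrt_lt_R0; lra).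
  assert (ss : s * s = r) by (apply sqrt_sqrt; lra).
  set (D := l ^ 2 + r ^ 2). assert (hD : 0 < D) by (unfold D; assert (0 < l ^ 2) by (apply pow_lt; auto); assert (0 < r ^ 2) by (apply pow_lt; lra); lra).
  assert (S2 : sin (2 * (2 * atan (r / l))) = 4 * r * l * (l ^ 2 - r ^ 2) / D ^ 2).
  { rewrite sin_2a, sin_2atan, cos_2atan. unfold D. field. split; [unfold D in hD; lra|lra]. }
  assert (B : sin (2 * (2 * atan (r / l) + 4 * (r * s))) <= 4 * r * l * (l ^ 2 - r ^ 2) / D ^ 2 + 2 * (4 * (r * s))).
  { rewrite <- S2. replace (2 * (2 * atan (r / l) + 4 * (r * s))) with (2 * (2 * atan (r / l)) + 2 * (4 * (r * s))) by ring.
    apply sin_add_le. nra. }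
  assert (r2 : 0 < 2 * r ^ 2) by (assert (0 < r ^ 2) by (apply pow_lt; lra); lra).
  assert (C : sin (2 * (2 * atan (r / l) + 4 * (r * s))) / (2 * r ^ 2) <= (4 * r * l * (l ^ 2 - r ^ 2) / D ^ 2 + 2 * (4 * (r * s))) / (2 * r ^ 2)).
  { apply Rmult_le_compat_r; auto. left. now apply Rinv_0_lt_compat. }
  (* The bubble terms cancel exactly; 4 r^(3/2) contributes 3 from its second derivative and 6 from
     its first derivative over r, and loses 4 in the sine. *)
  assert (E : (- 4 * l * r / D ^ 2 + 3 / s) + (2 * l / D + 6 * s) / r - (4 * r * l * (l ^ 2 - r ^ 2) / D ^ 2 + 2 * (4 * (r * s))) / (2 * r ^ 2) = 5 / s).
  { assert (Er : l ^ 2 = D - r ^ 2) by (unfold D; ring). rewrite Er. rewrite <- ss. field. split; lra. }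
  (* After multiplication by s the time derivative, the drift of the bubble and the drift of 4
     r^(3/2) are at most 3/2, 1 and 3/2, in total less than 5. *)
  assert (F : 2 * r * m / D + r * (2 * l / D + 6 * s) <= 5 / s); [|lra].
  apply Rmult_le_reg_r with s; auto. replace (5 / s * s) with 5 by (field; lra).
  assert (s1 : s <= 1) by nra.
  assert (F1 : 2 * r * m / D * s <= 3 / 2).
  { apply Rmult_le_reg_r with D; auto. replace (2 * r * m / D * s * D) with (2 * (s ^ 3 * m)) by (rewrite <- ss; field; lra).
    assert (Ed : D = m ^ 4 + s ^ 4) by (unfold D, l; rewrite <- ss; ring). rewrite Ed.
    (* Weighted arithmetic-geometric mean inequality 4 s^3 m <= 3 s^4 + m^4 in factored form. *)
    assert (0 <= (s - m) ^ 2 * (3 * s ^ 2 + 2 * s * m + m ^ 2)).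
    { apply Rmult_le_pos. apply pow2_ge_0. assert (0 <= s ^ 2) by apply pow2_ge_0. assert (0 <= m ^ 2) by apply pow2_ge_0. nra. }
    replace ((s - m) ^ 2 * (3 * s ^ 2 + 2 * s * m + m ^ 2)) with (3 * s ^ 4 - 4 * (s ^ 3 * m) + m ^ 4) in H by ring.
    assert (0 <= s ^ 4) by (apply pow_le; lra). assert (0 <= m ^ 4) by (apply pow_le; lra). lra. }
  assert (F2 : r * (2 * l / D) <= 1).
  { apply Rmult_le_reg_r with D; auto. replace (r * (2 * l / D) * D) with (2 * (r * l)) by (field; lra). unfold D.
    assert (0 <= (r - l) ^ 2) by apply pow2_ge_0. simpl in *. lra. }
  assert (F3 : 6 * (r * s) * s <= 3 / 2). { replace (6 * (r * s) * s) with (6 * r * r) by (rewrite <- ss; ring). nra. }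
  replace ((2 * r * m / D + r * (2 * l / D + 6 * s)) * s) with (2 * r * m / D * s + r * (2 * l / D) * s + 6 * (r * s) * s) by ring.
  assert (0 <= r * (2 * l / D)). { apply Rmult_le_pos. lra. apply Rdiv_le_0_compat; lra. } nra.
Qed.

(** The truncation at M is inactive up to time T, so [ys M] solves the ramped equation itself
    there. *)
Definition good (M T : R) := 0 < M /\ forall r t, t <= T -> ys M r t <= M.

(** Square root of the bubble scale l, so that l' = - sqrt l; it vanishes at t1 + 2. At this rate
    the time derivative of the bubble stays within the margin of order 1 / sqrt r. *)
Definition lm (t : R) := 1 - (t - t1) / 2.
Definition sub (r t : R) := 2 * atan (r / lm t ^ 2) + 4 * (r * sqrt r).

Lemma den_pos l x : 0 < l -> 0 < (l * l) * (l * l) + x * x.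
Proof. intros hl. assert (0 < (l * l) * (l * l)) by (repeat apply Rmult_lt_0_compat; auto). nra. Qed.

(** The comparison stops when lm = m, before the bubble becomes singular. At t1 the subsolution is
    at most 6 r, below c0 r; at r = 1/2 it is at most PI + 2, below c0 / 2 = 2 PI. *)
Lemma phs_ge_sub M T m : good M T -> 0 < m <= 1 -> t1 + 2 - 2 * m <= T ->
  forall r t, 0 <= r <= /2 -> t1 <= t <= t1 + 2 - 2 * m -> sub r t <= phs M r t.
Proof.
  intros [hM hg] hm hT r t hr ht.
  assert (hlm : forall t, t1 <= t <= t1 + 2 - 2 * m -> m <= lm t <= 1) by (intros; unfold lm; lra).
  assert (hl2 : forall t, t1 <= t <= t1 + 2 - 2 * m -> m ^ 2 <= lm t ^ 2 <= 1).
  { intros x hx. specialize (hlm x hx). split. apply pow_incr; lra. replace 1 with (1 ^ 2) by ring. apply pow_incr; lra. }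
  assert (m2 : 0 < m ^ 2) by (apply pow_lt; lra).
  assert (hb : forall x s, 0 <= x <= /2 -> t1 <= s <= t1 + 2 - 2 * m -> 0 <= sub x s <= (2 / m ^ 2 + 4) * x).
  { intros x s hx hs. specialize (hl2 s hs). unfold sub.
    assert (q : 0 <= x / lm s ^ 2 <= x / m ^ 2).
    { split. apply Rdiv_le_0_compat; lra. apply Rmult_le_compat_l. lra. apply Rinv_le_contravar; lra. }
    assert (a := atan_le (x / lm s ^ 2) ltac:(lra)). assert (b := sqrt_pos x).
    assert (sqrt x <= 1). { rewrite <- sqrt_1. apply sqrt_le_1_alt. lra. }
    replace ((2 / m ^ 2 + 4) * x) with (2 * (x / m ^ 2) + 4 * x) by (field; lra). split; nra. }
  apply Rminus_le.
  apply (cmp (fun r t => sub r t - phs M r t)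
    (fun r t => 2 * r * lm t / ((lm t ^ 2) ^ 2 + r ^ 2) - r * (exp (r ^ 2 / 4) * yst M r t))
    (fun r t => 2 * lm t ^ 2 / ((lm t ^ 2) ^ 2 + r ^ 2) + 6 * sqrt r - phsr M r t)
    (fun r t => - 4 * lm t ^ 2 * r / ((lm t ^ 2) ^ 2 + r ^ 2) ^ 2 + 3 / sqrt r - phsrr M r t)
    (/2) t1 (t1 + 2 - 2 * m) ((2 / m ^ 2 + 4 + (16 + 2 * M)) ^ 2)); try lra.
  - apply pow2_ge_0.
  - intros x s hx hs. specialize (hl2 s hs). apply cont_minus; [|now apply phs_cont]. unfold sub. apply cont_plus.
    + apply cont_mult. apply continuous_const. apply (cont_comp (fun p : R * R => fst p / lm (snd p) ^ 2) atan).
      * apply (cont_mult fst). apply continuous_fst. apply (cont_comp (fun p : R * R => lm (snd p) ^ 2) Rinv).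
        apply cont_pow. apply (cont_comp snd lm). apply continuous_snd. unfold lm, Rdiv. cc. apply continuous_Rinv. simpl in *. lra.
      * apply continuous_atan.
    + apply cont_mult. apply continuous_const. apply (cont_mult fst). apply continuous_fst. apply (cont_comp fst sqrt). apply continuous_fst. apply continuous_sqrt.
  - intros s hs. unfold sub, phs. rewrite sqrt_0. replace (0 / lm s ^ 2) with 0 by (unfold Rdiv; ring). rewrite atan_0. lra.
  - intros s hs. unfold sub. assert (a := atan_bound (/ 2 / lm s ^ 2)). assert (b := phs_bounds M T hM hg (/2) s ltac:(lra) ltac:(lra)).
    assert (sqrt (/2) <= 1). { rewrite <- sqrt_1. apply sqrt_le_1_alt. lra. } unfold c0 in b. assert (p := PI_gt_3). lra.
  - intros x hx. assert (b := phs_bounds M T hM hg x t1 ltac:(lra) ltac:(lra)). assert (c := c0_bounds).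
    unfold sub. replace (lm t1) with 1 by (unfold lm; field). replace (x / 1 ^ 2) with x by field.
    assert (a := atan_le x ltac:(lra)). assert (sqrt x <= 1). { rewrite <- sqrt_1. apply sqrt_le_1_alt. lra. }
    assert (x * sqrt x <= x) by nra. nra.
  - intros x s hx hs. apply is_derive_minus'; [|now apply phs_t].
    specialize (hlm s ltac:(lra)). assert (l0 : 0 < lm s ^ 2) by (apply pow_lt; lra).
    unfold sub. eapply is_derive_val. apply is_derive_plus'; [|apply is_derive_c]. apply is_derive_scal'.
    apply (is_derive_comp' atan (fun t => x / lm t ^ 2)). apply is_derive_atan.
    unfold Rdiv. apply is_derive_scal'. apply is_derive_inv. apply (is_derive_pow lm 2 s (- / 2)).
    unfold lm. apply (is_derive_val _ _ (0 - (1 - 0) * / 2)). 2: field. apply is_derive_minus'. apply is_derive_c.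
    eapply is_derive_val. unfold Rdiv. apply is_derive_mult'. apply is_derive_minus'. apply is_derive_i. apply is_derive_c. apply is_derive_c. cbv beta. ring.
    lra. unfold Rsqr. simpl. assert (d0 := den_pos (lm s) x ltac:(lra)). field. repeat split; lra.
  - intros x s hx hs. apply is_derive_minus'; [|apply phs_r; auto; lra].
    specialize (hlm s ltac:(lra)). assert (l0 : 0 < lm s ^ 2) by (apply pow_lt; lra).
    unfold sub. assert (sx : 0 < sqrt x) by (apply sqrt_lt_R0; lra). assert (se : sqrt x * sqrt x = x) by (apply sqrt_sqrt; lra).
    apply is_derive_plus'.
    + eapply is_derive_val. apply is_derive_scal'. apply (is_derive_comp' atan (fun x => x / lm s ^ 2)). apply is_derive_atan.
      unfold Rdiv. apply is_derive_mult'. apply is_derive_i. apply is_derive_c.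
      unfold Rsqr. simpl. assert (d0 := den_pos (lm s) x ltac:(lra)). field. repeat split; lra.
    + eapply is_derive_val. apply is_derive_scal'. apply (is_derive_mult' (fun x => x) sqrt). apply is_derive_i.
      apply is_derive_Reals. apply derivable_pt_lim_sqrt. lra.
      replace (4 * (1 * sqrt x + x * / (2 * sqrt x))) with (4 * sqrt x + 2 * (x / sqrt x)) by (field; lra). rewrite <- se at 2. field. lra.
  - intros x s hx hs. apply is_derive_minus'; [|apply (phsr_r M T); auto; lra].
    specialize (hlm s ltac:(lra)). assert (l0 : 0 < lm s ^ 2) by (apply pow_lt; lra). assert (sx : 0 < sqrt x) by (apply sqrt_lt_R0; lra).
    assert (d0 : 0 < (lm s ^ 2) ^ 2 + x ^ 2) by (assert (0 < x ^ 2) by (apply pow_lt; lra); assert (0 < (lm s ^ 2) ^ 2) by (apply pow_lt; lra); lra).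
    apply is_derive_plus'.
    + unfold Rdiv. eapply is_derive_val. apply is_derive_scal'. apply is_derive_inv. apply is_derive_plus'. apply is_derive_c.
      apply (is_derive_pow (fun x => x) 2). apply is_derive_i. lra. simpl. simpl in d0. field. lra.
    + eapply is_derive_val. apply is_derive_scal'. apply is_derive_Reals. apply derivable_pt_lim_sqrt. lra. field. lra.
  - intros x s hx hs hw hz. specialize (hlm s ltac:(lra)).
    assert (I := subsolution_ineq x (lm s) ltac:(lra) ltac:(lra)). fold (sub x s) in I.
    assert (P := phs_pde M T x s ltac:(lra) ltac:(lra)).
    assert (b1 := hb x s ltac:(lra) ltac:(lra)). assert (b2 := phs_bounds M T hM hg x s ltac:(lra) ltac:(lra)). assert (cb := c0_bounds).
    assert (S := sin_sub_le (sub x s) (phs M x s) x (2 / m ^ 2 + 4 + (16 + 2 * M)) ltac:(lra)).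
    assert (0 < 2 / m ^ 2) by (apply Rdiv_lt_0_compat; lra).
    specialize (S ltac:(lra) ltac:(lra)). rewrite (Rabs_pos_eq (sub x s)), (Rabs_pos_eq (phs M x s)) in S by nra. specialize (S ltac:(lra)).
    set (fr := 2 * lm s ^ 2 / ((lm s ^ 2) ^ 2 + x ^ 2) + 6 * sqrt x) in *.
    assert (hfr : phsr M x s = fr) by lra. rewrite hfr in P.
    replace (- (sin (2 * sub x s) - sin (2 * phs M x s)) / (2 * x ^ 2)) with (- (sin (2 * sub x s) / (2 * x ^ 2)) + sin (2 * phs M x s) / (2 * x ^ 2)) in S by (field; lra).
    lra.
Qed.

(** Otherwise evaluate at r = m^2 when the scale is also m^2: the subsolution is at least 2 atan 1 =
    PI/2, while phi <= (16 + 2 M) r. The choice m = 1 / (18 + 2 M) makes the latter at most 1. *)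
Lemma good_bound M T : good M T -> T < t1 + 2.
Proof.
  intros hG. destruct (Rlt_dec T (t1 + 2)) as [|hn]; auto. exfalso. assert (hG' := hG). destruct hG' as [hM hg].
  set (m := / (18 + 2 * M)). assert (hm : 0 < m <= / 18). { split. apply Rinv_0_lt_compat; lra. apply Rinv_le_contravar; lra. }
  assert (mM : m * (18 + 2 * M) = 1) by (unfold m; field; lra).
  set (tb := t1 + 2 - 2 * m). assert (hl : lm tb = m) by (unfold lm, tb; field).
  assert (m2 : 0 < m ^ 2) by (apply pow_lt; lra).
  assert (A := phs_ge_sub M T m hG ltac:(lra) ltac:(unfold tb in *; lra) (m ^ 2) tb).
  assert (m2' : m ^ 2 <= /2) by (simpl; nra). specialize (A ltac:(lra) ltac:(unfold tb; lra)).
  assert (B := phs_bounds M T hM hg (m ^ 2) tb ltac:(lra) ltac:(unfold tb; lra)).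
  unfold sub in A. rewrite hl in A. replace (m ^ 2 / m ^ 2) with 1 in A by (field; lra). rewrite atan_1 in A.
  assert (0 <= m ^ 2 * sqrt (m ^ 2)) by (apply Rmult_le_pos; [lra|apply sqrt_pos]).
  assert (p := PI_gt_3). assert ((16 + 2 * M) * m ^ 2 <= 1) by (simpl; nra). lra.
Qed.

(** * The maximal time *)

Lemma good_agree M M' T r t : good M T -> good M' T -> t <= T -> ys M r t = ys M' r t.
Proof.
  intros [h1 h2] [h3 h4] ht. destruct (Rle_dec M M').
  - symmetry. apply (ys_unique M M' T); auto.
  - apply (ys_unique M' M T); auto. lra.
Qed.
Lemma good_le M T T' : T' <= T -> good M T -> good M T'.
Proof. intros h [a b]. split; auto. intros; apply b; lra. Qed.

(** The time gained depends on the current size N alone and not on M: the truncation is first raised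
    to M', which changes nothing up to T by [ys_unique], and then [ys_growth] applies. *)
Lemma good_extend M T N : good M T -> 0 <= N -> (forall r, 0 <= r <= 1 -> ys M r T <= N) ->
  exists M', good M' (T + / (4 * kap * (1 + N) ^ 2)).
Proof.
  intros [hM hg] hN h. set (M' := Rmax M (2 * (1 + N))).
  assert (a : M <= M') by apply Rmax_l. assert (b : 2 * (1 + N) <= M') by apply Rmax_r.
  assert (E := ys_unique M M' T ltac:(lra) hg).
  exists M'. split. lra. intros r t ht. destruct (Rle_dec t T) as [h0|h0].
  - rewrite E by auto. specialize (hg r t h0). lra.
  - rewrite ys_cl by lra. apply Rle_trans with (2 * (1 + N)); auto.
    apply (ys_growth M' ltac:(lra) N T hN); auto. 2: apply cl_range. 2: lra.
    intros x hx. rewrite E by lra. auto.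
Qed.

Lemma good_t1 : exists M, good M t1.
Proof.
  destruct (good_extend 1 0 0) as [M hM].
  - split. lra. intros. rewrite ys_zero; lra.
  - lra.
  - intros. rewrite ys_zero; lra.
  - exists M. replace t1 with (0 + / (4 * kap * (1 + 0) ^ 2)); auto. unfold t1, kap. field.
Qed.

(** Ts is the supremum of the times reached by some truncation, finite by [good_bound]. Extending
    from a time t < Ts cannot pass Ts, and by [ys_le_0] the size that governs the extension is the
    value at r = 0. *)
Lemma max_time : exists Ts, t1 < Ts /\ (forall t, t < Ts -> exists M, good M t) /\
  (forall M t, t < Ts -> good M t -> / (4 * kap * (1 + ys M 0 t) ^ 2) <= Ts - t).
Proof.
  destruct (completeness (fun T => exists M, good M T)) as [Ts [hu hl]].
  - exists (t1 + 2). intros T [M hM]. left. now apply good_bound in hM.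
  - exists t1. apply good_t1.
  - assert (ext : forall M t, good M t -> t + / (4 * kap * (1 + ys M 0 t) ^ 2) <= Ts).
    { intros M t hG. assert (hG' := hG). destruct hG' as [hM hg]. apply hu. apply (good_extend M); auto.
      now apply ys_nonneg. intros r hr. apply (ys_le_0 M t); auto. lra. }
    assert (pos : forall M t, 0 < M -> 0 < / (4 * kap * (1 + ys M 0 t) ^ 2)).
    { intros M t hM. apply Rinv_0_lt_compat. unfold kap. assert (a := ys_nonneg M hM 0 t). assert (0 < (1 + ys M 0 t) ^ 2) by (apply pow_lt; lra). lra. }
    exists Ts. split; [|split].
    + destruct good_t1 as [M hM]. assert (a := ext M t1 hM). assert (b := pos M t1 (proj1 hM)). lra.
    + intros t ht. apply NNPP. intros hn. assert (Ts <= t); [|lra]. apply hl. intros T [M hM].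
      destruct (Rle_dec T t) as [|h]; auto. exfalso. apply hn. exists M. apply (good_le M T); auto. lra.
    + intros M t ht hG. assert (a := ext M t hG). lra.
Qed.

(** * The solution of the system *)

Lemma CU_shift n a U : forall j k, (j + k <= n)%nat -> forall f, CU U j k f ->
  CU (fun p => U (fst p, snd p + a)) j k (fun p => f (fst p, snd p + a)).
Proof.
  induction n as [|n IH]; intros j k hn f hf; assert (h0 := Cl_base _ _ _ _ _ _ hf); apply Cl_eq.
  all: assert (HP : P0u (fun p => U (fst p, snd p + a)) (fun p => f (fst p, snd p + a))) by
    (intros p hp; apply (continuous_comp (fun p : R * R => (fst p, snd p + a)) f); [|apply h0; exact hp];
     apply continuous_pair; [apply continuous_fst|apply cont_plus; [apply continuous_snd|apply continuous_const]]).
  all: split; [exact HP|split; intros l ->]; try lia.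
  - destruct (Cl_D1 _ _ _ _ _ _ hf) as [g [hg hg']]. exists (fun p => g (fst p, snd p + a)). split.
    + intros x t hx. simpl. apply hg. exact hx.
    + apply IH; auto. lia.
  - destruct (Cl_D2 _ _ _ _ _ _ hf) as [g [hg hg']]. exists (fun p => g (fst p, snd p + a)). split.
    + intros x t hx. simpl. eapply is_derive_val. apply (is_derive_comp' (fun s => f (x, s)) (fun s => s + a)). apply hg. exact hx.
      apply is_derive_plus'. apply is_derive_i. apply is_derive_c. ring.
    + apply IH; auto. lia.
Qed.

(** Primitive in r from 0, rescaled to [0, 1] so that r and t become parameters; it builds the
    pressure Q. The regions [UT] contain with (r, t) the whole segment to (0, t). *)
Definition prim (f : R * R -> R) (p : R * R) : R := fst p * RInt (fun s => f (fst p * s, snd p)) 0 1.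

Definition UT T (p : R * R) := -1 < fst p /\ snd p < T.
Lemma UT_open T : open (UT T).
Proof. apply open_and; [apply open_fst_gt|apply open_snd_lt]. Qed.
Lemma UT_star T r t s : UT T (r, t) -> 0 <= s <= 1 -> UT T (r * s, t).
Proof. intros [h1 h2] hs. simpl in *. split; auto. simpl. destruct (Rle_dec 0 r); nra. Qed.

Lemma prim_derive T f r t : P0u (UT T) f -> UT T (r, t) -> is_derive (fun x => prim f (x, t)) r (f (r, t)).
Proof.
  intros hf [hr ht]. simpl in hr, ht.
  assert (cs : forall z, -1 < z -> continuous (fun z => f (z, t)) z).
  { intros z hz. apply (continuous_slice' f). apply hf. now split. }
  assert (ex : forall x, Rabs (x - r) < r + 1 -> ex_RInt (fun z => f (z, t)) 0 x).
  { intros x hx. apply Rabs_def2 in hx. apply (ex_RInt_continuous (V := R_CompleteNormedModule)). intros z hz. apply cs.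
    revert hz. unfold Rmin, Rmax. destruct Rle_dec; lra. }
  apply (is_derive_ext_loc (fun x => RInt (fun z => f (z, t)) 0 x)).
  - exists (mkposreal (r + 1) ltac:(lra)). intros x hx. change (Rabs (x - r) < r + 1) in hx.
    assert (I := ex x hx). apply Rabs_def2 in hx. unfold prim. simpl.
    assert (E := RInt_comp_lin (V := R_CompleteNormedModule) (fun z => f (z, t)) x 0 0 1).
    rewrite Rmult_0_r, Rplus_0_r, Rmult_1_r, Rplus_0_r in E. rewrite <- E by exact I.
    rewrite (RInt_ext _ (fun y => scal x (f (x * y, t)))) by (intros; now rewrite Rplus_0_r).
    apply (RInt_scal (V := R_CompleteNormedModule) (fun y => f (x * y, t))). apply ex_RInt_cont. lra.
    intros s hs. apply (cont_comp (fun s => x * s) (fun z => f (z, t))). cc. apply cs.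
    destruct (Rle_dec 0 x); nra.
  - apply (is_derive_RInt (fun z => f (z, t)) _ 0); [|now apply cs].
    exists (mkposreal (r + 1) ltac:(lra)). intros x hx. change (Rabs (x - r) < r + 1) in hx.
    apply (RInt_correct (V := R_CompleteNormedModule)). auto.
Qed.

Lemma CU_prim T n : forall j k, (j + k <= n)%nat -> forall f, CU (UT T) j k f -> CU (UT T) j k (prim f).
Proof.
  assert (HP : forall f, P0u (UT T) f -> P0u (UT T) (prim f)).
  { intros f hf p hp. unfold prim. apply cont_mult. apply continuous_fst.
    apply (continuous_RInt_par_loc (fun (p : R * R) s => f (fst p * s, snd p))). lra.
    apply (filter_imp (UT T)); [|exact (UT_open T p hp)]. intros [r t] hu s hs.
    apply (continuous_comp (fun z : (R * R) * R => (fst (fst z) * snd z, snd (fst z))) f).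
    - apply continuous_pair. apply (cont_mult (fun z : (R * R) * R => fst (fst z))). apply (continuous_comp fst fst); apply continuous_fst.
      apply continuous_snd. apply (continuous_comp fst snd). apply continuous_fst. apply continuous_snd.
    - apply hf. now apply UT_star. }
  induction n as [|n IH]; intros j k hn f hf; assert (h0 := Cl_base _ _ _ _ _ _ hf); apply Cl_eq;
    (split; [now apply HP|split; intros l ->]); try lia.
  - exists f. split; [|exact (Cl_mono1 _ _ _ _ _ _ hf)]. intros r t hu. now apply (prim_derive T).
  - destruct (Cl_D2 _ _ _ _ _ _ hf) as [g [hg hg']]. assert (hgb := Cl_base _ _ _ _ _ _ hg'). exists (prim g). split.
    + intros r t hu. assert (ht : t < T) by apply hu. unfold prim. simpl. apply is_derive_scal'.
      assert (near : forall x, Rabs (x - t) < T - t -> UT T (r, x)) by (intros x hx; apply Rabs_def2 in hx; split; simpl; [apply hu|lra]).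
      apply (is_derive_RInt_par (fun x s => f (r * s, x)) (fun x s => g (r * s, x)) t 0 1 (T - t)); try lra.
      * intros x s hx hs. apply hg. apply UT_star; auto.
      * intros x s hx hs. apply (continuous_comp (fun z : R * R => (r * snd z, fst z)) f).
        apply continuous_pair. apply cont_mult. apply continuous_const. apply continuous_snd. apply continuous_fst. apply h0. apply UT_star; auto.
      * intros s hs. apply (continuous_comp (fun z : R * R => (r * snd z, fst z)) g).
        apply continuous_pair. apply cont_mult. apply continuous_const. apply continuous_snd. apply continuous_fst. apply hgb. apply UT_star; auto.
    + apply IH; auto. lia.
Qed.

(** Uniqueness determines phi on [0, 1] only, so its derivative at r = 0 has to be identified from
    the right. *)
Lemma right_derive_unique (f g : R -> R) x a b d : 0 < d -> (forall y, x <= y <= x + d -> f y = g y) ->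
  is_derive f x a -> is_derive g x b -> a = b.
Proof.
  intros hd E hf hg. apply Rminus_diag_uniq. destruct (Req_dec (a - b) 0) as [|hn]; auto. exfalso.
  assert (hp := Rabs_pos_lt _ hn).
  destruct (proj1 (is_derive_eps _ _ _) hf (Rabs (a - b) / 4)) as [d1 [h1 H1]]. lra.
  destruct (proj1 (is_derive_eps _ _ _) hg (Rabs (a - b) / 4)) as [d2 [h2 H2]]. lra.
  set (e := Rmin d (Rmin (d1 / 2) (d2 / 2))).
  assert (he : 0 < e) by (repeat apply Rmin_pos; lra). assert (e1 : e <= d) by apply Rmin_l.
  assert (e2 : e <= Rmin (d1 / 2) (d2 / 2)) by apply Rmin_r.
  assert (e3 := Rle_trans _ _ _ e2 (Rmin_l _ _)). assert (e4 := Rle_trans _ _ _ e2 (Rmin_r _ _)).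
  specialize (H1 (x + e)). specialize (H2 (x + e)). replace (x + e - x) with e in * by ring.
  rewrite (Rabs_pos_eq e) in * by lra. specialize (H1 ltac:(lra)). specialize (H2 ltac:(lra)).
  rewrite (E (x + e)), (E x) in H1 by lra.
  assert (Rabs (e * (a - b)) <= Rabs (a - b) / 2 * e).
  { replace (e * (a - b)) with ((g (x + e) - g x - e * b) - (g (x + e) - g x - e * a)) by ring.
    unfold Rminus at 1. eapply Rle_trans. apply Rabs_triang. rewrite Rabs_Ropp. lra. }
  rewrite Rabs_mult, (Rabs_pos_eq e) in H by lra. nra.
Qed.

Section Final.
Context (Ts : R).
Hypotheses (hTs : t1 < Ts) (hgood : forall t, t < Ts -> exists M, good M t)
  (hlife : forall M t, t < Ts -> good M t -> / (4 * kap * (1 + ys M 0 t) ^ 2) <= Ts - t).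

Lemma Mt_ex t : exists M, t < Ts -> good M t.
Proof. destruct (Rlt_dec t Ts) as [h|h]. destruct (hgood t h) as [M hM]. now exists M. exists 0. tauto. Qed.
Definition Mt t := proj1_sig (constructive_indefinite_description _ (Mt_ex t)).
Lemma Mt_good t : t < Ts -> good (Mt t) t.
Proof. exact (proj2_sig (constructive_indefinite_description _ (Mt_ex t))). Qed.

Definition T0 := Ts - t1.
Lemma T0_pos : 0 < T0.
Proof. unfold T0. lra. Qed.
Definition U0 := UT T0.
Lemma U0_open : open U0.
Proof. apply UT_open. Qed.
Lemma U0_slab r t : slab T0 r t -> U0 (r, t).
Proof. intros [h1 h2]. split; simpl; lra. Qed.

(** The truncation level changes with t, but by [good_agree] any level good for a later time gives
    the same values on [0, 1] and before. The shift by t1 puts the end of the ramp at time 0. *)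
Definition yF r t := exts (fun x => ys (Mt (t + t1)) x (t + t1)) r.
Lemma yF_sm : sm U0 yF.
Proof.
  (* One truncation, good up to the midpoint T' of t and T0, serves a whole neighbourhood of (r,
     t). *)
  intros l r t [hr ht]. simpl in hr, ht. set (T' := (t + T0) / 2). set (M' := Mt (T' + t1)).
  assert (hG : good M' (T' + t1)) by (apply Mt_good; unfold T', T0 in *; lra).
  assert (oU := UT_open T').
  assert (S : sm (fun p => -1 < fst p) (fun r t => exts (fun x => ys M' x (t + t1)) r)).
  { apply CU_sm. apply open_fst_gt. intros j k.
    apply (CU_shift (j + k) t1 (fun p => -1 < fst p) j k (Nat.le_refl _) (fun p => exts (fun x => ys M' x (snd p)) (fst p))).
    apply (sm_CU (fun p => -1 < fst p) (fun r t => exts (fun x => ys M' x t) r)). apply exts_smooth. intros; apply ys_class, hG. }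
  apply (sm_ext (UT T') (fun r t => exts (fun x => ys M' x (t + t1)) r)); auto.
  - intros x s [hx hs]. simpl in hs. unfold yF. f_equal. apply functional_extensionality. intros z.
    apply (good_agree _ _ (s + t1)); try lra. apply (good_le _ (T' + t1)); auto; lra. apply Mt_good. unfold T', T0 in *; lra.
  - intros l' x s [hx hs]. apply S. exact hx.
  - split; simpl; auto. unfold T'. lra.
Qed.

Definition phF r t := r * (c0 + exp (r ^ 2 / 4) * yF r t).
Lemma phF_CU j k : CU U0 j k (fun p => phF (fst p) (snd p)).
Proof.
  apply (CU_mult U0 j k fst). apply CU_fst. apply (CU_plus U0 j k (fun _ => c0)). apply CU_const.
  apply (CU_mult U0 j k (fun p => exp (fst p ^ 2 / 4)) (fun p => yF (fst p) (snd p))).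
  - apply (CU_comp U0 j k exp_smf (fun p => fst p ^ 2 / 4)).
    apply (CU_ext U0 j k (fun p => / 4 * (fst p * fst p))). apply U0_open. intros p _. simpl; field.
    apply (CU_mult U0 j k (fun _ => / 4)). apply CU_const. apply CU_mult; apply CU_fst.
  - apply sm_CU. exact yF_sm.
Qed.
Lemma phF_sm : sm U0 phF.
Proof. apply CU_sm. apply U0_open. exact phF_CU. Qed.

Lemma phF_eq M T r t : good M T -> t + t1 <= T -> t < T0 -> r <= 1 -> phF r t = phs M r (t + t1).
Proof.
  intros hG ht ht0 hr. unfold phF, yF, phs, gs. rewrite exts_id by auto.
  rewrite (good_agree (Mt (t + t1)) M (t + t1) r (t + t1)); auto; try lra.
  apply Mt_good. unfold T0 in ht0. lra. apply (good_le _ T); auto.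
Qed.

Lemma phF_derivs r t : 0 < r < 1 -> t < T0 -> exists M, good M ((t + Ts - t1) / 2 + t1) /\
  pdt phF r t = r * (exp (r ^ 2 / 4) * yst M r (t + t1)) /\
  (forall x, -1 < x < 1 -> is_derive (fun x => phF x t) x (phsr M x (t + t1))) /\ pdx phF r t = phsr M r (t + t1) /\
  pdx (pdx phF) r t = phsrr M r (t + t1).
Proof.
  intros hr ht. set (T := (t + Ts - t1) / 2 + t1). assert (hT : t + t1 < T < Ts) by (unfold T, T0 in *; lra).
  set (M := Mt T). assert (hG : good M T) by (apply Mt_good; lra). exists M. split; [exact hG|].
  assert (hM := proj1 hG).
  assert (d1 : forall x, -1 < x < 1 -> is_derive (fun x => phF x t) x (phsr M x (t + t1))).
  { intros x hx. apply (is_derive_ext_loc (fun x => phs M x (t + t1))); [|now apply phs_r].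
    exists (mkposreal (1 - x) ltac:(lra)). intros z hz. change (Rabs (z - x) < 1 - x) in hz. apply Rabs_def2 in hz.
    symmetry. apply (phF_eq M T); auto; lra. }
  split; [|split; [exact d1|split]].
  - apply is_derive_unique. apply (is_derive_ext_loc (fun s => phs M r (s + t1))).
    + exists (mkposreal (T - t - t1) ltac:(lra)). intros s hs. change (Rabs (s - t) < T - t - t1) in hs. apply Rabs_def2 in hs.
      symmetry. apply (phF_eq M T); auto; unfold T0; lra.
    + eapply is_derive_val. apply (is_derive_comp' (phs M r) (fun s => s + t1)). now apply phs_t.
      apply is_derive_plus'. apply is_derive_i. apply is_derive_c. ring.
  - apply is_derive_unique. apply d1. lra.
  - apply is_derive_unique. apply (is_derive_ext_loc (fun x => phsr M x (t + t1))).
    + exists (mkposreal (Rmin r (1 - r)) ltac:(apply Rmin_pos; lra)). intros x hx. change (Rabs (x - r) < Rmin r (1 - r)) in hx.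
      assert (a := Rlt_le_trans _ _ _ hx (Rmin_l _ _)). assert (b := Rlt_le_trans _ _ _ hx (Rmin_r _ _)).
      apply Rabs_def2 in a. apply Rabs_def2 in b. symmetry. apply is_derive_unique. apply d1. lra.
    + apply (phsr_r M T); auto; try lra. apply hG.
Qed.

Lemma phF_pde r t : 0 < r < 1 -> 0 <= t < T0 ->
  pdt phF r t + r * pdx phF r t = pdx (pdx phF) r t + pdx phF r t / r - sin (2 * phF r t) / (2 * r ^ 2).
Proof.
  intros hr ht. destruct (phF_derivs r t hr ltac:(lra)) as [M [hG [E1 [_ [E2 E3]]]]].
  rewrite E1, E2, E3. rewrite (phF_eq M ((t + Ts - t1) / 2 + t1)); auto; try lra; try (unfold T0 in *; lra).
  apply (phs_pde M (t + t1)); auto; try lra.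
Qed.

(** The momentum equation with v = r, whose viscous term vanishes, solved for Q_r. Its bracket is
    replaced by phi_t + r phi_r through the equation of phi, so the formula is smooth at r = 0. *)
Definition qF r t := - r - (pdt phF r t + r * pdx phF r t) * pdx phF r t.
Definition QF r t := prim (fun p => qF (fst p) (snd p)) (r, t).
Lemma qF_CU j k : CU U0 j k (fun p => qF (fst p) (snd p)).
Proof.
  assert (X : CU U0 j k (fun p => pdx phF (fst p) (snd p))) by (apply CU_pdx; [apply U0_open|apply phF_CU]).
  assert (Y : CU U0 j k (fun p => pdt phF (fst p) (snd p))) by (apply CU_pdt; [apply U0_open|apply phF_CU]).
  apply (CU_ext U0 j k (fun p => -1 * fst p - (pdt phF (fst p) (snd p) + fst p * pdx phF (fst p) (snd p)) * pdx phF (fst p) (snd p))).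
  apply U0_open. intros [x y] _. unfold qF. simpl. ring.
  apply (CU_minus U0 j k (fun p => -1 * fst p)). apply (CU_mult U0 j k (fun _ => -1)). apply CU_const. apply CU_fst.
  apply (CU_mult U0 j k (fun p => pdt phF (fst p) (snd p) + fst p * pdx phF (fst p) (snd p))); auto.
  apply CU_plus; auto. apply (CU_mult U0 j k fst); auto. apply CU_fst.
Qed.
Lemma QF_sm : sm U0 QF.
Proof.
  apply CU_sm. apply U0_open. intros j k. apply (CU_ext U0 j k (prim (fun p => qF (fst p) (snd p)))). apply U0_open.
  intros [r t] _. reflexivity. apply (CU_prim T0 (j + k)); auto. exact (qF_CU j k).
Qed.
Lemma QF_r r t : U0 (r, t) -> pdx QF r t = qF r t.
Proof.
  intros hu. apply is_derive_unique.
  exact (prim_derive T0 (fun p => qF (fst p) (snd p)) r t (Cl_base _ _ _ _ _ _ (qF_CU 0 0)) hu).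
Qed.

Lemma c0_gt_pi : Rabs c0 > PI.
Proof. unfold c0. assert (p := PI_gt_3). rewrite Rabs_pos_eq; lra. Qed.

Lemma phF_0 t : phF 0 t = 0.
Proof. unfold phF. ring. Qed.
Lemma phF_1 t : t < T0 -> phF 1 t = c0.
Proof.
  intros ht. unfold phF, yF. rewrite exts_id by lra. rewrite ys_1. ring. apply (Mt_good (t + t1)). unfold T0 in ht. lra.
Qed.

Lemma phF_init_smooth : smooth1_on (fun r => 0 <= r <= 1) (fun r => phF r 0).
Proof.
  exists (fun x => -1 < x). split; [apply open_gt|split; [intros; lra|]].
  assert (U : forall x, -1 < x -> U0 (x, 0)) by (intros x hx; split; simpl; auto; apply T0_pos).
  assert (E : forall n x, -1 < x -> Derive_n (fun r => phF r 0) n x = Dl (repeat true n) phF x 0).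
  { intros n. induction n as [|n IH]; intros x hx; simpl; auto. unfold pdx. apply Derive_ext_loc.
    exists (mkposreal (x + 1) ltac:(lra)). intros y hy. change (Rabs (y - x) < x + 1) in hy. apply Rabs_def2 in hy. apply IH. lra. }
  intros n x hx. destruct n as [|n]; simpl; auto.
  apply (ex_derive_ext_loc (fun y => Dl (repeat true n) phF y 0)).
  - exists (mkposreal (x + 1) ltac:(lra)). intros y hy. change (Rabs (y - x) < x + 1) in hy. apply Rabs_def2 in hy. symmetry. apply E. lra.
  - apply (phF_sm (repeat true n) x 0). now apply U.
Qed.

Lemma open_all : open (fun _ : R * R => True).
Proof. apply open_true. Qed.

Lemma solution_phF mu : is_solution mu (fun r => phF r 0) T0 (fun r _ => r) (fun z _ => -2 * z) phF QF (fun z _ => -2 * (z * z)).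
Proof.
  assert (dv : forall r t, pdx (fun r _ => r) r t = 1) by (intros; apply is_derive_unique; apply is_derive_i).
  assert (dw : forall z t, pdx (fun z _ => -2 * z) z t = -2).
  { intros. apply is_derive_unique. eapply is_derive_val. apply (is_derive_scal' (fun z => z)). apply is_derive_i. ring. }
  assert (sm_pol : forall f : R -> R -> R, (forall j k, CU (fun _ => True) j k (fun p => f (fst p) (snd p))) -> smooth2_on (slab T0) f).
  { intros f hf. exists (fun _ => True). split; [exact open_all|split; auto]. exact (CU_sm _ f open_all hf). }
  assert (sm_u0 : forall f, sm U0 f -> smooth2_on (slab T0) f).
  { intros f hf. exists U0. split; [apply U0_open|split; [apply U0_slab|exact hf]]. }
  split; [|split; [|split; [|split; [|split; [|split; [|split; [|split; [|split; [|split; [|split]]]]]]]]]].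
  - apply sm_pol. intros. apply CU_fst.
  - apply sm_pol. intros. apply (CU_mult _ j k (fun _ => -2)). apply CU_const. apply CU_fst.
  - apply sm_u0, phF_sm.
  - apply sm_u0, QF_sm.
  - apply sm_pol. intros. apply (CU_mult _ j k (fun _ => -2)). apply CU_const. apply CU_mult; apply CU_fst.
  - intros r t hr ht. rewrite dv. assert (h := phF_pde r t hr ltac:(lra)).
    rewrite QF_r by (split; simpl; lra). unfold qF.
    assert (e1 : pdt (fun r _ => r) r t = 0) by (apply is_derive_unique; apply (is_derive_c r)).
    assert (e2 : pdx (pdx (fun r _ => r)) r t = 0).
    { apply is_derive_unique. apply (is_derive_ext (fun _ => 1)). intros; symmetry; apply dv. apply is_derive_c. }
    rewrite e1, e2.
    replace (pdx (pdx phF) r t + pdx phF r t / r - sin (2 * phF r t) / (2 * r ^ 2)) with (pdt phF r t + r * pdx phF r t) by exact h.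
    field. lra.
  - intros z t hz ht. rewrite dw.
    assert (e1 : pdt (fun z _ => -2 * z) z t = 0) by (apply is_derive_unique; apply (is_derive_c (-2 * z))).
    assert (e2 : pdx (pdx (fun z _ => -2 * z)) z t = 0).
    { apply is_derive_unique. apply (is_derive_ext (fun _ => -2)). intros; symmetry; apply dw. apply is_derive_c. }
    assert (e3 : pdx (fun z _ => -2 * (z * z)) z t = -4 * z).
    { apply is_derive_unique. eapply is_derive_val. apply (is_derive_scal' (fun z => z * z)). apply (is_derive_mult' (fun z => z) (fun z => z)); apply is_derive_i. ring. }
    rewrite e1, e2, e3. ring.
  - intros r z t hr hz ht. rewrite dw.
    assert (e1 : pdx (fun r' _ => r' * r') r t = 2 * r).
    { apply is_derive_unique. eapply is_derive_val. apply (is_derive_mult' (fun z => z) (fun z => z)); apply is_derive_i. ring. }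
    rewrite e1. field. lra.
  - intros r t hr ht. apply phF_pde; auto. lra.
  - intros r hr. auto.
  - intros z hz. reflexivity.
  - intros t ht. rewrite phF_0, phF_1 by lra. rewrite phF_1 by apply T0_pos. repeat split; ring.
Qed.

(** * Uniqueness and blow-up *)

Lemma sm_of_smooth2 S f : smooth2_on S f -> exists U, open U /\ (forall x y, S x y -> U (x, y)) /\ sm U f.
Proof. intros [U [a [b c]]]. exists U. auto. Qed.

(** The divergence equation separates variables, so (r v)_r / r depends on t only. Its value m, read
    off at z = 1/2, gives r v = m r^2 / 2, and v = 1 at r = 1 forces m = 2. *)
Lemma velocity_unique mu v w ph Q Rp r t : is_solution mu (fun r => phF r 0) T0 v w ph Q Rp -> 0 < r < 1 -> 0 < t < T0 -> v r t = r.
Proof.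
  intros [sv [_ [_ [_ [_ [_ [_ [hdiv [_ [_ [_ hbc]]]]]]]]]]] hr ht.
  destruct (sm_of_smooth2 _ _ sv) as [U [oU [hU sU]]].
  assert (vd : forall x, 0 <= x <= 1 -> is_derive (fun x => v x t) x (pdx v x t)).
  { intros x hx. apply Derive_correct. apply (sU nil x t). apply hU. split; lra. }
  set (m := - pdx w (/2) t).
  assert (D : forall x, 0 <= x <= 1 -> is_derive (fun x => x * v x t) x (v x t + x * pdx v x t)).
  { intros x hx. eapply is_derive_val. apply (is_derive_mult' (fun x => x)). apply is_derive_i. apply vd; auto. cbv beta. ring. }
  assert (E : forall x, 0 < x < 1 -> v x t + x * pdx v x t = m * x).
  { intros x hx. specialize (hdiv x (/2) t hx ltac:(lra) ht).
    assert (e1 : pdx (fun r' t' => r' * v r' t') x t = v x t + x * pdx v x t) by (apply is_derive_unique; apply D; lra).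
    rewrite e1 in hdiv.
    assert (F : / x * (v x t + x * pdx v x t) = m) by (unfold m; lra). rewrite <- F. field. lra. }
  assert (G : forall x, 0 <= x <= 1 -> x * v x t = m * x ^ 2 / 2).
  { intros x hx. destruct (Req_dec x 0) as [->|hx0]. field.
    destruct (MVT_gen (fun x => x * v x t - m * x ^ 2 / 2) 0 x (fun _ => 0)) as [c [_ hc]].
    - intros y. rewrite Rmin_left, Rmax_right by lra. intros hy.
      eapply is_derive_val. apply is_derive_minus'. apply D; lra.
      apply (is_derive_ext (fun x => m / 2 * (x * x))). intros; unfold Rdiv; simpl; rring.
      apply is_derive_scal'. apply (is_derive_mult' (fun z => z) (fun z => z)); apply is_derive_i.
      rewrite E by lra. field.
    - intros y. rewrite Rmin_left, Rmax_right by lra. intros hy. apply continuity_pt_filterlim.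
      apply (ex_derive_continuous (V := R_NormedModule) (fun x => x * v x t - m * x ^ 2 / 2) y). eexists.
      apply (is_derive_minus' (fun x => x * v x t) (fun x => m * x ^ 2 / 2)). apply D; lra.
      apply (is_derive_ext (fun x => m / 2 * (x * x))). intros; unfold Rdiv; simpl; rring.
      apply is_derive_scal'. apply (is_derive_mult' (fun z => z) (fun z => z)); apply is_derive_i.
    - lra. }
  assert (m2 : m = 2). { assert (a := G 1 ltac:(lra)). destruct (hbc t ltac:(lra)) as [_ [b _]]. rewrite b in a. lra. }
  assert (a := G r ltac:(lra)). rewrite m2 in a. apply Rmult_eq_reg_l with r; [|lra]. lra.
Qed.

(** It supplies the size hypothesis of [sin_sub_le] near the axis, from the vanishing at r = 0 and a
    bound on the r-derivative. *)
Lemma linear_bound U f T : sm U f -> (forall r t, 0 <= r <= 1 -> 0 <= t <= T -> U (r, t)) -> (forall t, 0 <= t <= T -> f 0 t = 0) -> 0 <= T ->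
  exists B, 0 <= B /\ forall r t, 0 <= r <= 1 -> 0 <= t <= T -> Rabs (f r t) <= B * r.
Proof.
  intros hs hU h0 hT.
  destruct (max_rect (fun r t => Rabs (pdx f r t)) 0 1 0 T) as [a [b [_ [_ H]]]]; try lra.
  { intros x y hx hy. apply cont_abs. apply (hs (true :: nil) x y). auto. }
  exists (Rabs (pdx f a b)). split. apply Rabs_pos. intros r t hr ht.
  destruct (mvt (fun x => f x t) (fun x => pdx f x t) 0 r) as [c [hc E]].
  { intros x. rewrite Rmin_left, Rmax_right by lra. intros hx. apply Derive_correct. apply (hs nil x t). apply hU; lra. }
  rewrite Rmin_left, Rmax_right in hc by lra. rewrite h0 in E by auto. replace (f r t) with (pdx f c t * r) by lra.
  rewrite Rabs_mult, (Rabs_pos_eq r) by lra. apply Rmult_le_compat_r. lra. apply H; lra.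
Qed.

Lemma phase_compare U f g T : open U -> sm U f -> sm U g -> (forall r t, 0 <= r <= 1 -> 0 <= t <= T -> U (r, t)) -> 0 <= T ->
  (forall t, 0 <= t <= T -> f 0 t = 0 /\ g 0 t = 0 /\ f 1 t = g 1 t) -> (forall r, 0 <= r <= 1 -> f r 0 = g r 0) ->
  (forall r t, 0 < r < 1 -> 0 < t <= T -> pdt f r t + r * pdx f r t = pdx (pdx f) r t + pdx f r t / r - sin (2 * f r t) / (2 * r ^ 2)) ->
  (forall r t, 0 < r < 1 -> 0 < t <= T -> pdt g r t + r * pdx g r t = pdx (pdx g) r t + pdx g r t / r - sin (2 * g r t) / (2 * r ^ 2)) ->
  forall r t, 0 <= r <= 1 -> 0 <= t <= T -> f r t <= g r t.
Proof.
  intros oU sf sg hU hT hb hi pf pg r t hr ht. apply Rminus_le.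
  destruct (linear_bound U f T sf hU ltac:(intros; now apply hb) hT) as [B1 [b1 H1]].
  destruct (linear_bound U g T sg hU ltac:(intros; now apply hb) hT) as [B2 [b2 H2]].
  apply (cmp (fun r t => f r t - g r t) (fun r t => pdt f r t - pdt g r t) (fun r t => pdx f r t - pdx g r t)
    (fun r t => pdx (pdx f) r t - pdx (pdx g) r t) 1 0 T ((B1 + B2) ^ 2)); try lra.
  - apply pow2_ge_0.
  - intros x s hx hs. apply cont_minus; [apply (sf nil x s)|apply (sg nil x s)]; auto.
  - intros s hs. destruct (hb s hs) as [a [b c]]. lra.
  - intros s hs. destruct (hb s hs) as [a [b c]]. lra.
  - intros x hx. rewrite hi by auto. lra.
  - intros x s hx hs. apply is_derive_minus'; apply Derive_correct; [apply (sf nil x s)|apply (sg nil x s)]; apply hU; lra.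
  - intros x s hx hs. apply is_derive_minus'; apply Derive_correct; [apply (sf nil x s)|apply (sg nil x s)]; apply hU; lra.
  - intros x s hx hs. apply is_derive_minus'; apply Derive_correct; [apply (sf (true :: nil) x s)|apply (sg (true :: nil) x s)]; apply hU; lra.
  - intros x s hx hs hw hz. specialize (pf x s hx hs). specialize (pg x s hx hs).
    assert (S := sin_sub_le (f x s) (g x s) x (B1 + B2) ltac:(lra) ltac:(lra) ltac:(lra)).
    specialize (H1 x s ltac:(lra) ltac:(lra)). specialize (H2 x s ltac:(lra) ltac:(lra)). specialize (S ltac:(lra)).
    assert (E : pdx f x s = pdx g x s) by lra. rewrite E in pf.
    replace (- (sin (2 * f x s) - sin (2 * g x s)) / (2 * x ^ 2)) with (- (sin (2 * f x s) / (2 * x ^ 2)) + sin (2 * g x s) / (2 * x ^ 2)) in S by (field; lra).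
    lra.
Qed.

Lemma phase_unique mu v w ph Q Rp r t : is_solution mu (fun r => phF r 0) T0 v w ph Q Rp -> 0 <= r <= 1 -> 0 <= t < T0 -> ph r t = phF r t.
Proof.
  intros hs hr ht. assert (hv := fun r t => velocity_unique mu v w ph Q Rp r t hs).
  destruct hs as [_ [_ [sp [_ [_ [_ [_ [_ [hph [hin [_ hbc]]]]]]]]]]].
  destruct (sm_of_smooth2 _ _ sp) as [U [oU [hU sU]]].
  set (V := fun p : R * R => U p /\ U0 p).
  assert (oV : open V) by (apply open_and; [exact oU|apply U0_open]).
  assert (s1 : sm V ph) by (intros l x y h; apply sU, h). assert (s2 : sm V phF) by (intros l x y h; apply phF_sm, h).
  assert (hV : forall r s, 0 <= r <= 1 -> 0 <= s <= t -> V (r, s)).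
  { intros x s hx hs. split. apply hU. split; lra. apply U0_slab. split; lra. }
  assert (p1 : forall r s, 0 < r < 1 -> 0 < s <= t -> pdt ph r s + r * pdx ph r s = pdx (pdx ph) r s + pdx ph r s / r - sin (2 * ph r s) / (2 * r ^ 2)).
  { intros x s hx hs. rewrite <- hph by lra. rewrite hv; lra. }
  assert (p2 : forall r s, 0 < r < 1 -> 0 < s <= t -> pdt phF r s + r * pdx phF r s = pdx (pdx phF) r s + pdx phF r s / r - sin (2 * phF r s) / (2 * r ^ 2)).
  { intros x s hx hs. apply phF_pde; lra. }
  assert (b : forall s, 0 <= s <= t -> ph 0 s = 0 /\ phF 0 s = 0 /\ ph 1 s = phF 1 s).
  { intros s hs. destruct (hbc s ltac:(lra)) as [_ [_ [_ [_ [b1 b2]]]]]. rewrite b2, phF_0, !phF_1 by (lra || apply T0_pos). auto. }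
  apply Rle_antisym.
  - apply (phase_compare V ph phF t); auto; try lra. intros; now apply hin.
  - apply (phase_compare V phF ph t); auto; try lra. intros s hs'. destruct (b s hs') as [c1 [c2 c3]]; auto.
    intros; symmetry; now apply hin.
Qed.

(** A value of [ys] at r = 0 not above B' guarantees a remaining lifespan of at least d, impossible
    at a time closer than d to T0. This excludes even isolated returns to bounded values. *)
Lemma phase_blowup mu v w ph Q Rp : is_solution mu (fun r => phF r 0) T0 v w ph Q Rp ->
  forall B, exists d, 0 < d /\ forall t, 0 <= t -> T0 - d < t < T0 -> B < pdx ph 0 t.
Proof.
  intros hs B. set (B' := Rmax B 0). assert (hB : B <= B') by apply Rmax_l. assert (hB' : 0 <= B') by apply Rmax_r.
  assert (q1 : 0 < (1 + B') ^ 2) by (apply pow_lt; lra). assert (hk : 0 < kap) by (unfold kap; lra).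
  exists (/ (4 * kap * (1 + B') ^ 2)). split. { apply Rinv_0_lt_compat. nra. }
  intros t ht0 ht. set (M := Mt (t + t1)). assert (hG : good M (t + t1)) by (apply Mt_good; unfold T0 in *; lra).
  assert (hM := proj1 hG).
  assert (E : pdx ph 0 t = c0 + ys M 0 (t + t1)).
  { assert (U := phase_unique mu v w ph Q Rp).
    assert (D : is_derive (fun x => ph x t) 0 (pdx ph 0 t)).
    { destruct hs as [_ [_ [sp _]]]. destruct (sm_of_smooth2 _ _ sp) as [V [oV [hV sV]]].
      apply Derive_correct. apply (sV nil 0 t). apply hV. split; lra. }
    rewrite (right_derive_unique (fun x => ph x t) (fun x => phs M x (t + t1)) 0 (pdx ph 0 t) (phsr M 0 (t + t1)) 1); auto; try lra.
    - unfold phsr, gs. replace (0 ^ 2 / 4) with 0 by field. rewrite exp_0. ring.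
    - intros y hy. rewrite U by (auto; lra). apply (phF_eq M (t + t1)); auto; lra.
    - apply phs_r; auto; lra. }
  rewrite E. assert (c := c0_bounds). assert (n := ys_nonneg M hM 0 (t + t1)).
  destruct (Rle_dec (ys M 0 (t + t1)) B') as [h|h]; [|lra]. exfalso.
  assert (L := hlife M (t + t1) ltac:(unfold T0 in *; lra) hG).
  assert (/ (4 * kap * (1 + B') ^ 2) <= / (4 * kap * (1 + ys M 0 (t + t1)) ^ 2)).
  { assert (0 < (1 + ys M 0 (t + t1)) ^ 2) by (apply pow_lt; lra).
    apply Rinv_le_contravar. nra. apply Rmult_le_compat_l. lra. apply pow_incr. lra. }
  unfold T0 in *. lra.
Qed.
End Final.

Lemma is_solution_restrict mu phi0 T T' v w ph Q Rp : T' <= T -> is_solution mu phi0 T v w ph Q Rp -> is_solution mu phi0 T' v w ph Q Rp.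
Proof.
  intros hT [s1 [s2 [s3 [s4 [s5 [h1 [h2 [h3 [h4 [h5 [h6 h7]]]]]]]]]]].
  assert (S : forall f, smooth2_on (slab T) f -> smooth2_on (slab T') f).
  { intros f [U [a [b c]]]. exists U. split; auto. split; auto. intros x y [hx hy]. apply b. split; lra. }
  split; [|split; [|split; [|split; [|split; [|split; [|split; [|split; [|split; [|split; [|split]]]]]]]]]]; auto.
  - intros. apply h1; lra.
  - intros. apply h2; lra.
  - intros. apply h3; lra.
  - intros. apply h4; lra.
  - intros. apply h7; lra.
Qed.

Theorem theorem2p6 (mu : R) (hmu : 0 < mu) :
  exists phi0 : R -> R,
    smooth1_on (fun r => 0 <= r <= 1) phi0 /\ phi0 0 = 0 /\ Rabs (phi0 1) > PI /\
    exists T0 : R, 0 < T0 /\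
      (* a smooth solution exists on [0,1] x [0,T0) *)
      (exists v w ph Q Rp, is_solution mu phi0 T0 v w ph Q Rp) /\
      (* every such solution has phi_r(0,t) -> +oo as t -> T0^- *)
      (forall v w ph Q Rp, is_solution mu phi0 T0 v w ph Q Rp ->
         filterlim (fun t => pdx ph 0 t) (at_left T0) (Rbar_locally p_infty)) /\
      (* no smooth solution exists beyond T0 *)
      (forall T, T0 < T -> ~ exists v w ph Q Rp, is_solution mu phi0 T v w ph Q Rp).
Proof.
  destruct max_time as [Ts [hTs [hgood hlife]]].
  assert (pos := T0_pos Ts hTs).
  exists (fun r => phF Ts hgood r 0). split; [|split; [|split]].
  - now apply phF_init_smooth.
  - apply phF_0.
  - rewrite phF_1 by auto. apply c0_gt_pi.
  - exists (T0 Ts). split; [auto|split; [|split]].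
    + do 5 eexists. now apply solution_phF.
    + intros v w ph Q Rp hs P [B HB].
      destruct (phase_blowup Ts hgood hlife mu v w ph Q Rp hs B) as [d [hd Hd]].
      exists (mkposreal (Rmin d (T0 Ts)) (Rmin_pos _ _ hd pos)). intros t ht hlt.
      change (Rabs (t - T0 Ts) < Rmin d (T0 Ts)) in ht.
      assert (a := Rlt_le_trans _ _ _ ht (Rmin_l _ _)). assert (b := Rlt_le_trans _ _ _ ht (Rmin_r _ _)).
      apply Rabs_def2 in a. apply Rabs_def2 in b. apply HB, Hd; lra.
    (* A solution beyond T0 would have phi_r (0, t) continuous at T0, against the blow-up of its
       restriction. *)
    + intros T hT [v [w [ph [Q [Rp hs]]]]].
      assert (hs0 := is_solution_restrict _ _ T (T0 Ts) _ _ _ _ _ ltac:(lra) hs).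
      destruct hs as [_ [_ [sp _]]]. destruct (sm_of_smooth2 _ _ sp) as [U [oU [hU sU]]].
      assert (c : continuous (fun t => pdx ph 0 t) (T0 Ts)).
      { apply (continuous_slice (fun p : R * R => pdx ph (fst p) (snd p)) 0 (T0 Ts)). apply (sU (true :: nil)). apply hU. split; lra. }
      destruct (proj1 (continuous_eps _ _) c 1) as [d1 H1]. lra.
      destruct (phase_blowup Ts hgood hlife mu v w ph Q Rp hs0 (pdx ph 0 (T0 Ts) + 1)) as [d [hd Hd]].
      assert (hd1 := cond_pos d1).
      set (e := Rmin (Rmin (d / 2) (d1 / 2)) (T0 Ts / 2)).
      assert (he : 0 < e) by (repeat apply Rmin_pos; lra). assert (e1 : e <= Rmin (d / 2) (d1 / 2)) by apply Rmin_l.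
      assert (e2 : e <= T0 Ts / 2) by apply Rmin_r.
      assert (e3 := Rle_trans _ _ _ e1 (Rmin_l _ _)). assert (e4 := Rle_trans _ _ _ e1 (Rmin_r _ _)).
      specialize (Hd (T0 Ts - e) ltac:(lra) ltac:(lra)). specialize (H1 (T0 Ts - e)).
      assert (Rabs (pdx ph 0 (T0 Ts - e) - pdx ph 0 (T0 Ts)) < 1).
      { apply H1. change (Rabs (T0 Ts - e - T0 Ts) < d1). apply Rabs_def1; lra. }
      apply Rabs_def2 in H. lra.
Qed.
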